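(* Let $(a,b)\in\mathbb{R}/\mathbb{Z}\times[0,1]$ be a parameter in a tongue of the complexified Double Standard Map family, i.e. $g_{a,b}$ has an attracting cycle on $\mathbb{S}^1$. Then the map $g_{a,b}$ is Devaney chaotic restricted to $C_{a,b}$. Hence, $C_{a,b}$ is the unique maximal chaotic set for $g_{a,b}|_{\mathbb{S}^1}$.
   Context: For $(a,b)\in\mathbb{R}/\mathbb{Z}\times[0,1]$, $g_{a,b}:\mathbb{C}^*\to\mathbb{C}^*$ is $g_{a,b}(z)=e^{2\pi i a}z^2\exp(bz-b/z)$, where $\mathbb{C}^*=\mathbb{C}\setminus\{0\}$; it preserves the unit circle $\mathbb{S}^1$. A parameter $(a,b)$ lies in a tongue iff $g_{a,b}$ has an attracting cycle on $\mathbb{S}^1$; this attracting cycle is then unique. Let $B_0$ be the immediate basin of attraction of this cycle, $\mathcal{B}_\infty=\left(\bigcup_{j\ge 0}g_{a,b}^{-j}(B_0)\right)\cap\mathbb{S}^1$ (the total basin of attraction in $\mathbb{S}^1$) and $C_{a,b}=\mathbb{S}^1\setminus\mathcal{B}_\infty$. A continuous map $f:X\to X$ is Devaney chaotic if (1) it is topologically transitive: for any two non-empty open sets $U,V$ of $X$ there is $n\in\mathbb{N}$ with $f^{\circ n}(U)\cap V\neq\emptyset$; and (2) the set of all periodic points of $f$ is dense in $X$. A closed, forward invariant set $X\subset\mathbb{S}^1$ is a maximal chaotic set for $g_{a,b}:\mathbb{S}^1\to\mathbb{S}^1$ if $g_{a,b}|_X$ is Devaney chaotic and there is no $Y\subset\mathbb{S}^1$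 with $X\subsetneq Y$ such that $Y$ is forward invariant under $g_{a,b}$ and $g_{a,b}|_Y$ is Devaney chaotic.
   Formalization: Uniqueness is asserted only among maximal chaotic sets other than the attracting cycle itself, since with the given definition of Devaney chaotic the attracting cycle is also a maximal chaotic set, disjoint from C_{a,b}, so literal uniqueness fails. *)

(* Defs.v *)
From HB Require Import structures.
From mathcomp Require Import all_boot all_order all_algebra.
From mathcomp Require Import all_classical all_reals all_analysis.
From mathcomp Require Import complex.

Set Implicit Arguments.
Unset Strict Implicit.
Unset Printing Implicit Defensive.

Import Order.TTheory GRing.Theory Num.Theory.
Import numFieldNormedType.Exports.

Local Open Scope classical_set_scope.
Local Open Scope ring_scope.
Local Open Scope complex_scope.

(* The library puts the norm topology of a field F on F^o, and on F itself only
   when F is an abstract structure; the instances are transported to R[i]. *)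
#[warnings="-redundant-canonical-projection", non_forgetful_inheritance]
HB.instance Definition _ (R : realType) := NormedModule.copy R[i] R[i]^o.

Definition periodic_point (T : Type) (f : T -> T) (x : T) : Prop :=
  exists2 n, (0 < n)%N & iter n f x = x.

Definition forward_invariant (T : Type) (f : T -> T) (X : set T) : Prop :=
  f @` X `<=` X.

(* The (relatively) open subsets of X are the X `&` U with U open in T. *)
Definition topologically_transitive_on (T : topologicalType) (X : set T)
    (f : T -> T) : Prop :=
  forall U V : set T, open U -> open V ->
    X `&` U !=set0 -> X `&` V !=set0 ->
    exists n : nat, (iter n f @` (X `&` U)) `&` (X `&` V) !=set0.

Definition devaney_chaotic_on (T : topologicalType) (X : set T)
    (f : T -> T) : Prop :=
  [/\ {within X, continuous f},
      forward_invariant f X,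
      topologically_transitive_on X f &
      X `<=` closure (X `&` periodic_point f)].

Section DoubleStandardMap.
Variable R : realType.
Implicit Types (a b : R) (z : R[i]) (gamma X : set R[i]).

Definition cexp z : R[i] :=
  (expR (complex.Re z))%:C * (cos (complex.Im z) +i* sin (complex.Im z)).

(* A map of C^*; since 0^-1 = 0, the total function also fixes 0, so that
   iterating it never moves a point into or out of C^*. *)
Definition dsm a b z : R[i] :=
  cexp (0 +i* (2 * pi * a)) * z ^+ 2 * cexp (b%:C * z - b%:C / z).

Definition punctured_plane : set R[i] := [set z | z != 0].

Definition unit_circle : set R[i] := [set z | `|z| = 1].

(* p is the exact period, so (dsm a b)^p has derivative the multiplier. *)
Definition attracting_cycle a b gamma : Prop :=
  exists z (p : nat),
    [/\ (0 < p)%N, iter p (dsm a b) z = z,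
        forall k, (0 < k < p)%N -> iter k (dsm a b) z <> z,
        gamma = [set iter k (dsm a b) z | k in [set k | (k < p)%N]] &
        exists2 lambda : R[i],
          is_derive z 1 (iter p (dsm a b)) lambda & `|lambda| < 1].

(* The points of C^* whose orbit converges to gamma. *)
Definition basin a b gamma : set R[i] :=
  punctured_plane `&`
  [set z | iter n (dsm a b) z @[n --> \oo] `=>` set_nbhs gamma].

Definition immediate_basin a b gamma : set R[i] :=
  \bigcup_(w in gamma) connected_component (basin a b gamma) w.

Definition total_circle_basin a b gamma : set R[i] :=
  (\bigcup_(j in [set: nat]) iter j (dsm a b) @^-1` immediate_basin a b gamma)
  `&` unit_circle.

Definition basin_complement a b gamma : set R[i] :=
  unit_circle `\` total_circle_basin a b gamma.

Definition maximal_chaotic_set a b X : Prop :=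
  [/\ X `<=` unit_circle, closed X, forward_invariant (dsm a b) X,
      devaney_chaotic_on X (dsm a b) &
      ~ exists Y : set R[i],
          [/\ Y `<=` unit_circle, X `<` Y, forward_invariant (dsm a b) Y &
              devaney_chaotic_on Y (dsm a b)]].

End DoubleStandardMap.

(* Main.v *)
Require Import Defs.
From mathcomp Require Import all_boot all_order all_algebra.
From mathcomp Require Import all_classical all_reals all_analysis.
From mathcomp Require Import complex.
From mathcomp Require Import ring lra zify.

(** Put F(w) = 2w + 2 pi a + 2b sin w, so that exp(iF(w)) = g(exp(iw)); F is
    [clift] on the plane and [rlift] on the line, where it is strictly
    increasing and doubles translations by 2 pi. Let B be the basin of the
    attracting cycle gamma and C its complement in the circle.

    The heart of the matter is that branches of F^(-N) contract uniformly near
    the points of C, and this is where the complex critical points enter. If a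
    square around a real point x0 contains no point F^(n+1)(c) with F'(c) = 0,
    then every branch of F^(-N) extends to a holomorphic psi on the square
    ([inverse_branch]), real exactly on the real axis. For a real t left of
    the values of psi on the axis, psi - t avoids the half-line of negative
    reals, so log (psi - t) has imaginary part in (-pi, pi), vanishing on the
    axis; comparison with an explicit harmonic function ([maximum_principle])
    bounds its derivative on the axis by 4 pi / r, where r is the half-side
    ([log_derivative_bound]). Integrating gives a distortion inequality for
    real inverse branches whose constant does not depend on N
    ([distortion_left], [distortion_right]): if F^N shrinks an interval below a
    certain size, the interval was short from the start.

    Apply this at a point of gamma. Intervals there do shrink, so some critical
    orbit must come near gamma ([attracted_critical_point], Fatou's theorem).
    All critical points of g lie on one orbit of z -> 1/conj(z), a symmetry of
    g, so all critical orbits converge to gamma and keep a definite distance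
    from C: the inequality holds with a uniform r at all points of C
    ([uniform_expansion]).

    The rest is real dynamics. Call x and y equivalent when
    |F^n x - F^n y| <= 2 pi for all n; the classes are the fibres of the
    semiconjugacy of g to the doubling map, compact intervals that F permutes.
    Suppose that a neighbourhood of a point x of C lies in one fibre. Uniform
    expansion gives all fibres of F^n x a definite width on both sides of
    F^n x, so two of them agree modulo 2 pi and there is a fibre [P, Q] which
    some G = F^n - 2 pi k maps onto itself, with a point y of C inside. Points
    of C in [P, Q] are fixed by G (a moving orbit would take arbitrarily small
    steps). If [P, y] were all fixed, the distortion inequality at P would be
    violated, because points just left of P are expelled. So [P, y] and
    likewise [y, Q] contain basin points, hence points of gamma; but a fibre
    contains at most one point of gamma ([cycle_same_fibre_eq]). Therefore every
    neighbourhood of a point of C is eventually mapped over the whole circle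
    ([expansion]), which gives transitivity of g on C and, by the intermediate
    value theorem for F^n x - x, density of periodic points.

    Maximality is soft. A periodic point in the basin belongs to gamma, so a
    Devaney chaotic subset of the circle that meets the basin meets gamma, and
    transitivity forces it to be gamma itself; any other one lies in C
    ([chaotic_dichotomy]). *)

Set Implicit Arguments.
Unset Strict Implicit.
Unset Printing Implicit Defensive.

Import Order.TTheory GRing.Theory Num.Theory.
Import numFieldNormedType.Exports.

Local Open Scope classical_set_scope.
Local Open Scope ring_scope.
Local Open Scope complex_scope.

Local Notation nrm := (@Normc.normc _).
Local Notation re := (@complex.Re _).
Local Notation im := (@complex.Im _).
Local Notation per k := (k%:~R * (pi *+ 2)).

(** * Modulus and derivatives of complex functions *)

Section Modulus.
Variable R : realType.
Implicit Types (z w : R[i]) (x y : R).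

Lemma normrC z : `|z| = (nrm z)%:C.
Proof. by case: z. Qed.

Lemma nrm_ge0 z : 0 <= nrm z.
Proof. by case: z => x y; exact: sqrtr_ge0. Qed.

Lemma nrm0 : nrm (0 : R[i]) = 0.
Proof. exact: Normc.normc0. Qed.

Lemma nrm1 : nrm (1 : R[i]) = 1.
Proof. exact: Normc.normc1. Qed.

Lemma nrmD z w : nrm (z + w) <= nrm z + nrm w.
Proof. exact: le_normcD. Qed.

Lemma nrmN z : nrm (- z) = nrm z.
Proof. exact: normcN. Qed.

Lemma nrmB z w : nrm (z - w) = nrm (w - z).
Proof. by rewrite -nrmN opprB. Qed.

Lemma nrmM z w : nrm (z * w) = nrm z * nrm w.
Proof. exact: Normc.normcM. Qed.

Lemma nrmV z : nrm z^-1 = (nrm z)^-1.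
Proof. exact: Normc.normcV. Qed.

Lemma nrm_eq0 z : (nrm z == 0) = (z == 0).
Proof. by apply/eqP/eqP => [/Normc.eq0_normc//|->]; exact: nrm0. Qed.

Lemma nrm_gt0 z : (0 < nrm z) = (z != 0).
Proof. by rewrite lt_def nrm_ge0 andbT nrm_eq0. Qed.

Lemma nrm_real x : nrm x%:C = `|x|.
Proof. by rewrite /= expr0n /= addr0 sqrtr_sqr. Qed.

Lemma nrm_tri u z w : nrm (z - w) <= nrm (z - u) + nrm (u - w).
Proof. by rewrite -[z - w](subrKA u) nrmD. Qed.

Lemma nrmDB z w : nrm z - nrm w <= nrm (z + w).
Proof. by rewrite lerBlDr -{1}[z](addrK w) -(nrmN w) nrmD. Qed.

Lemma nrmBB z w : nrm z - nrm w <= nrm (z - w).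
Proof. by rewrite -(nrmN w) nrmDB. Qed.

Lemma nrm_dist z w : `|nrm z - nrm w| <= nrm (z - w).
Proof. by rewrite ler_norml nrmBB andbT lerNl opprB nrmB nrmBB. Qed.

Lemma absRe_le z : `|re z| <= nrm z.
Proof.
by case: z => x y /=; rewrite -sqrtr_sqr ler_wsqrtr // lerDl sqr_ge0.
Qed.

Lemma absIm_le z : `|im z| <= nrm z.
Proof.
by case: z => x y /=; rewrite -sqrtr_sqr ler_wsqrtr // lerDr sqr_ge0.
Qed.

Lemma reD z w : re (z + w) = re z + re w.
Proof. by case: z w => [? ?] [? ?]. Qed.
Lemma imD z w : im (z + w) = im z + im w.
Proof. by case: z w => [? ?] [? ?]. Qed.
Lemma reN z : re (- z) = - re z.
Proof. by case: z. Qed.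
Lemma imN z : im (- z) = - im z.
Proof. by case: z. Qed.
Lemma reM z w : re (z * w) = re z * re w - im z * im w.
Proof. by case: z w => [? ?] [? ?]. Qed.
Lemma imM z w : im (z * w) = re z * im w + im z * re w.
Proof. by case: z w => [? ?] [? ?]. Qed.

Definition reimE := (reD, imD, reN, imN, reM, imM).

Lemma complex_split z : z = re z +i* im z.
Proof. by case: z. Qed.

Lemma nrm_le_ReIm z : nrm z <= `|re z| + `|im z|.
Proof.
rewrite {1}(complexE z) (le_trans (nrmD _ _)) // nrmM !nrm_real.
suff -> : nrm ('i : R[i]) = 1 by rewrite mul1r.
by rewrite /= expr0n /= add0r expr1n sqrtr1.
Qed.

Lemma nrm_i : nrm ('i : R[i]) = 1.
Proof. by rewrite /= expr0n /= add0r expr1n sqrtr1. Qed.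

Lemma nrm_conj z : nrm z^* = nrm z.
Proof. by case: z => x y /=; rewrite sqrrN. Qed.

Lemma nbhs_nrmP z (A : set R[i]) :
  nbhs z A <-> exists2 e : R, 0 < e & forall w, nrm (w - z) < e -> A w.
Proof.
split.
  case/nbhs_ballP => e /= e0 eA.
  move: e0 eA; rewrite ltcE => /andP[/eqP ie rege0] eA.
  exists (re e) => // w wz; apply: eA; rewrite -ball_normE /= normrC.
  by rewrite ltcE /= ie eqxx -nrmN opprB.
case=> e e0 eA; apply/nbhs_ballP; exists e%:C; first by rewrite /= ltcR.
by move=> w; rewrite -ball_normE /= normrC ltcR => h; apply: eA; rewrite nrmB.
Qed.

End Modulus.

Lemma is_derive_small (K : numFieldType) (f : K -> K) (x l : K) :
  is_derive (x : K^o) 1 (f : K^o -> K^o) l ->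
  forall e, 0 < e -> exists2 d, 0 < d &
    forall h, `|h| < d -> `|f (x + h) - f x - l * h| <= e * `|h|.
Proof.
move=> [df <-] e e0; move/cvgrPdist_le: df => /(_ e e0).
rewrite near_withinE => /nbhs_ballP[d /= d0 H]; exists d => // h hd.
have [->|h0] := eqVneq h 0; first by rewrite addr0 subrr mulr0 subrr !normr0 mulr0.
have := H h; rewrite -ball_normE /= sub0r normrN => /(_ hd h0).
rewrite -(ler_pM2r (_ : 0 < `|h|)) ?normr_gt0 // -normrM; apply: le_trans.
rewrite distrC mulrBl /GRing.scale /= mulrAC mulVf // mul1r mulr1.
by rewrite [h + x]addrC.
Qed.

Lemma small_is_derive (K : numFieldType) (f : K -> K) (x l : K) :
  (forall e, 0 < e -> exists2 d, 0 < d &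
    forall h, `|h| < d -> `|f (x + h) - f x - l * h| <= e * `|h|) ->
  is_derive (x : K^o) 1 (f : K^o -> K^o) l.
Proof.
move=> H.
suff cl : h^-1 *: ((f \o shift x) (h *: (1 : K^o)) - f x) @[h --> (0 : K)^'] --> (l : K^o).
  split; first by apply/cvg_ex; exists l.
  exact: (cvg_lim _ cl).
apply/cvgrPdist_le => e e0; have [d d0 {}H] := H e e0.
rewrite near_withinE; apply/nbhs_ballP; exists d => // h.
rewrite -ball_normE /= sub0r normrN => hd h0.
rewrite -(ler_pM2r (_ : 0 < `|h|)) ?normr_gt0 // -normrM; apply: le_trans (H h hd).
rewrite distrC mulrBl /GRing.scale /= mulrAC mulVf // mul1r mulr1.
by rewrite [h + x]addrC.
Qed.

Section ComplexDerivative.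
Variable R : realType.
Implicit Types (f g : R[i] -> R[i]) (z w l m : R[i]).

(** The derivative in epsilon-delta form with a real-valued modulus, which is
    the form in which it is used in estimates; [cderivP] relates it to
    [is_derive]. *)
Definition cderiv f z l := forall e : R, 0 < e -> exists2 d : R, 0 < d &
  forall h, nrm h < d -> nrm (f (z + h) - f z - l * h) <= e * nrm h.

Lemma cderivP f z l :
  cderiv f z l <-> is_derive (z : R[i]^o) 1 (f : R[i]^o -> R[i]^o) l.
Proof.
split=> H.
  apply: small_is_derive => e.
  rewrite ltcE => /andP[/eqP ime ree]; have [d d0 {}H] := H _ ree.
  exists d%:C; first by rewrite ltcR.
  move=> h; rewrite !normrC ltcR => /H hd.
  by rewrite (complex_split e) ime complexr0 -rmorphM lecR.
move=> e e0; have [|d d0 {}H] := is_derive_small H (_ : 0 < e%:C).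
  by rewrite ltcR.
move: d0 H; rewrite ltcE => /andP[/eqP imd red] H.
exists (re d) => // h hd; have := H h; rewrite !normrC -rmorphM lecR; apply.
by rewrite (complex_split d) imd complexr0 ltcR.
Qed.

Lemma cderiv_cst c z : cderiv (fun=> c) z 0.
Proof. by apply/cderivP; exact: is_derive_cst. Qed.

Lemma cderiv_id z : cderiv id z 1.
Proof. by apply/cderivP; exact: is_derive_id. Qed.

Lemma cderivD f g z l m : cderiv f z l -> cderiv g z m ->
  cderiv (fun w => f w + g w) z (l + m).
Proof. by move=> /cderivP fl /cderivP gm; apply/cderivP; exact: is_deriveD. Qed.

Lemma cderivM f g z l m : cderiv f z l -> cderiv g z m ->
  cderiv (fun w => f w * g w) z (l * g z + f z * m).
Proof.
move=> /cderivP fl /cderivP gm; apply/cderivP.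
have -> : l * g z + f z * m = f z *: (m : R[i]^o) + g z *: (l : R[i]^o).
  by rewrite addrC /GRing.scale /= [l * _]mulrC.
exact: is_deriveM.
Qed.

Lemma cderivN f z l : cderiv f z l -> cderiv (fun w => - f w) z (- l).
Proof. by move=> /cderivP fl; apply/cderivP; exact: is_deriveN. Qed.

Lemma cderivB f g z l m : cderiv f z l -> cderiv g z m ->
  cderiv (fun w => f w - g w) z (l - m).
Proof. by move=> fl gm; apply: cderivD => //; exact: cderivN. Qed.

Lemma cderivZ c f z l : cderiv f z l -> cderiv (fun w => c * f w) z (c * l).
Proof. by move=> /(cderivM (cderiv_cst c z)); rewrite mul0r add0r. Qed.

Lemma cderivV f z l : f z != 0 -> cderiv f z l ->
  cderiv (fun w => (f w)^-1) z (- l / f z ^+ 2).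
Proof.
move=> fz0 /cderivP fl; apply/cderivP.
have [df ef] := fl.
split; first exact: derivableV.
by rewrite deriveV // ef /GRing.scale /= mulNr mulrC mulNr.
Qed.

Lemma cderiv_lip f z l : cderiv f z l -> exists2 d : R, 0 < d &
  forall h, nrm h < d -> nrm (f (z + h) - f z) <= (nrm l + 1) * nrm h.
Proof.
move=> /(_ 1 ltr01)[d d0 H]; exists d => // h /H hd.
rewrite -[f (z + h) - f z](subrK (l * h)) (le_trans (nrmD _ _)) // mulrDl nrmM addrC.
by rewrite lerD2l.
Qed.

Lemma cderiv_cont f z l : cderiv f z l -> forall e : R, 0 < e ->
  exists2 d : R, 0 < d & forall w, nrm (w - z) < d -> nrm (f w - f z) < e.
Proof.
move=> /cderiv_lip[d d0 H] e e0.
have l0 : 0 < nrm l + 1 by rewrite ltr_wpDl ?nrm_ge0.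
exists (Num.min d (e / (nrm l + 1))); first by rewrite lt_min d0 divr_gt0.
move=> w; rewrite lt_min => /andP[wd we].
have := H _ wd; rewrite [z + _]addrC subrK => /le_lt_trans; apply.
by rewrite mulrC -ltr_pdivlMr.
Qed.

Lemma cderiv_comp f g z l m : cderiv g z m -> cderiv f (g z) l ->
  cderiv (fun w => f (g w)) z (l * m).
Proof.
move=> gm fl e e0.
have l0 : 0 < nrm l + 1 by rewrite ltr_wpDl ?nrm_ge0.
have m0 : 0 < nrm m + 1 by rewrite ltr_wpDl ?nrm_ge0.
have [d1 d10 H1] := gm (e / 2 / (nrm l + 1)) ltac:(by rewrite !divr_gt0).
have [d2 d20 H2] := fl (e / 2 / (nrm m + 1)) ltac:(by rewrite !divr_gt0).
have [d3 d30 H3] := cderiv_lip gm.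
exists (Num.min (Num.min d1 d3) (d2 / (nrm m + 1))).
  by rewrite !lt_min d10 d30 divr_gt0.
move=> h; rewrite !lt_min => /andP[/andP[hd1 hd3] hd2].
have H4 := H1 _ hd1; have H5 := H3 _ hd3; set k := g (z + h) - g z in H4 H5.
have kd2 : nrm k < d2.
  by rewrite (le_lt_trans H5) // mulrC -ltr_pdivlMr.
have gk : g z + k = g (z + h) by rewrite /k addrC subrK.
have := H2 _ kd2; rewrite gk => H6.
rewrite (_ : _ - _ = (f (g (z + h)) - f (g z) - l * k) + l * (k - m * h)); last first.
  by ring.
rewrite (le_trans (nrmD _ _)) // nrmM [e]splitr mulrDl lerD //.
  rewrite (le_trans H6) // (le_trans (ler_wpM2l _ H5)) ?mulrA ?divfK ?gt_eqF //.
  by rewrite ltW // !divr_gt0.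
rewrite (le_trans (ler_wpM2l (nrm_ge0 _) H4)) // mulrA ler_wpM2r ?nrm_ge0 //.
rewrite mulrCA ger_pMr ?divr_gt0 // ler_pdivrMr // mul1r lerDl //.
Qed.

Lemma cderiv_ext f g z l : (forall w, f w = g w) -> cderiv f z l -> cderiv g z l.
Proof. by move=> /funext ->. Qed.

Lemma cderiv_uniq f z l m : cderiv f z l -> cderiv f z m -> l = m.
Proof. by move=> /cderivP[_ <-] /cderivP[_ <-]. Qed.

End ComplexDerivative.

(** * The complex exponential *)

Ltac complex_ext :=
  apply/eqP; rewrite eq_complex; apply/andP; split; apply/eqP => /=.

Section ComplexExponential.
Variable R : realType.
Implicit Types (z w u v : R[i]) (x y : R).

Lemma Complex10 : 1 +i* 0 = 1 :> R[i].
Proof. by []. Qed.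

Lemma cexpD z w : cexp (z + w) = cexp z * cexp w.
Proof.
rewrite /cexp reD imD expRD cosD sinD rmorphM /= mulrACA; congr (_ * _).
by rewrite -[RHS]/(_ +i* _) [sin _ * cos _ + _]addrC.
Qed.

Lemma cexp0 : cexp 0 = 1 :> R[i].
Proof. by rewrite /cexp /= expR0 cos0 sin0 mul1r. Qed.

Lemma nrm_cexp z : nrm (cexp z) = expR (re z).
Proof.
rewrite /cexp nrmM nrm_real ger0_norm ?expR_ge0 //=.
by rewrite cos2Dsin2 sqrtr1 mulr1.
Qed.

Lemma cexp_neq0 z : cexp z != 0.
Proof. by rewrite -nrm_eq0 nrm_cexp gt_eqF ?expR_gt0. Qed.

Lemma cexpN z : cexp (- z) = (cexp z)^-1.
Proof.
by apply: (mulIf (cexp_neq0 z)); rewrite -cexpD addNr cexp0 mulVf ?cexp_neq0.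
Qed.

Lemma cexpB z w : cexp (z - w) = cexp z / cexp w.
Proof. by rewrite cexpD cexpN. Qed.

Lemma cexp_conj z : cexp z^* = (cexp z)^*.
Proof.
case: z => x y; rewrite /cexp /= cosN sinN; complex_ext; ring.
Qed.

Lemma cexp_real x : cexp x%:C = (expR x)%:C.
Proof. by rewrite /cexp /= cos0 sin0 Complex10 mulr1. Qed.

Lemma cexp_im x : cexp ('i * x%:C) = cos x +i* sin x.
Proof. have -> : 'i * x%:C = 0 +i* x by complex_ext; ring.
by rewrite /cexp /= expR0 mul1r. Qed.

Lemma cexp_i_add z w : cexp ('i * (z + w)) = cexp ('i * z) * cexp ('i * w).
Proof. by rewrite mulrDr cexpD. Qed.

Lemma cos_sin_int (k : int) : cos (k%:~R * (pi *+ 2)) = 1 :> R /\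
  sin (k%:~R * (pi *+ 2)) = 0 :> R.
Proof.
have nat_case (n : nat) : cos (n%:R * (pi *+ 2)) = 1 :> R /\
    sin (n%:R * (pi *+ 2)) = 0 :> R.
  rewrite mulr_natl -[X in cos X]add0r -[X in sin X]add0r.
  by rewrite (periodicn (@cosD2pi R)) (periodicn (@sinD2pi R)) cos0 sin0.
case: k => n; first exact: nat_case.
by rewrite NegzE mulrNz mulNr cosN sinN; have [-> ->] := nat_case n.+1; rewrite oppr0.
Qed.

(** Reduce modulo 2 pi to [0, 2 pi); there cos is injective on either half. *)
Lemma cos_eq1 x : cos x = 1 -> exists k : int, x = k%:~R * (pi *+ 2).
Proof.
move=> cx; have p0 : 0 < pi *+ 2 :> R by rewrite pmulrn_lgt0 ?pi_gt0.
pose k := Num.floor (x / (pi *+ 2)); pose y := x - k%:~R * (pi *+ 2).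
have cy : cos y = 1.
  by rewrite /y cosB; have [-> ->] := cos_sin_int k; rewrite cx; ring.
have y0 : 0 <= y by rewrite subr_ge0 -ler_pdivlMr // floor_le.
have y2 : y < pi *+ 2.
  rewrite ltrBlDl -{2}[pi *+ 2]mul1r -mulrDl -ltr_pdivrMr //.
  by rewrite -intrD1 floorD1_gt.
exists k; apply/eqP; rewrite -subr_eq0 -/y; apply/eqP.
have [yp|yp] := leP y pi.
  by apply: (@cos_inj R); rewrite ?cos0 ?in_itv /= ?y0 ?yp ?lexx ?pi_ge0.
have : pi *+ 2 - y = 0.
  apply: (@cos_inj R); rewrite ?in_itv /= ?lexx ?pi_ge0 //.
    by rewrite subr_ge0 (ltW y2) lerBlDl mulr2n lerD2r ltW.
  by rewrite cosB cos2pi sin2pi cy cos0; ring.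
by move/eqP; rewrite subr_eq0 => /eqP e; rewrite e ltxx in y2.
Qed.

Lemma cexp_eq1 z : cexp z = 1 -> exists k : int, z = 'i * (k%:~R * (pi *+ 2))%:C.
Proof.
move=> e; have : nrm (cexp z) = 1 by rewrite e nrm1.
rewrite nrm_cexp -[RHS]expR0 => /expR_inj rez.
move: e; rewrite /cexp rez expR0 mul1r => -[/cos_eq1[k ik] _].
by exists k; rewrite (complex_split z) rez ik; complex_ext; ring.
Qed.

Lemma cexp_i_eq z w : cexp ('i * z) = cexp ('i * w) ->
  exists k : int, z = w + (k%:~R * (pi *+ 2))%:C.
Proof.
move=> e; have /cexp_eq1[k] : cexp ('i * (z - w)) = 1.
  by rewrite mulrBr cexpB e divff ?cexp_neq0.
move/mulfI => /(_ _)/eqP; rewrite subr_eq addrC => h; exists k; apply/eqP/h.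
by apply/eqP => -[/eqP]; rewrite oner_eq0.
Qed.

Lemma cexp_i_period z (k : int) :
  cexp ('i * (z + (k%:~R * (pi *+ 2))%:C)) = cexp ('i * z).
Proof.
rewrite cexp_i_add cexp_im; have [-> ->] := cos_sin_int k.
by rewrite Complex10 mulr1.
Qed.

Lemma cexp_cderiv0 : cderiv (@cexp R) 0 1.
Proof.
move=> e e0; pose c := e / 16; have c0 : 0 < c by rewrite divr_gt0.
have [d1 d10 H1] := is_derive_small (is_derive_expR (0:R)) c0.
have [d2 d20 H2] := is_derive_small (is_derive_sin (0:R)) c0.
have [d3 d30 H3] := is_derive_small (is_derive_cos (0:R)) c0.
have [d4 d40 H4] := is_derive_small (is_derive_expR (0:R)) ltr01.
pose d := Num.min (Num.min d1 d2) (Num.min d3 (Num.min d4 (Num.min 1 c))).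
exists d; first by rewrite !lt_min d10 d20 d30 d40 ltr01 c0.
move=> h; rewrite !lt_min => /andP[/andP[h1 h2] /and3P[h3 h4 /andP[h5 h6]]].
rewrite cexp0 add0r mul1r.
set x := re h; set y := im h.
have xh : `|x| <= nrm h by exact: absRe_le.
have yh : `|y| <= nrm h by exact: absIm_le.
have := H1 x (le_lt_trans xh h1); rewrite add0r expR0 mul1r => {}H1.
have := H4 x (le_lt_trans xh h4); rewrite add0r expR0 !mul1r => {}H4.
have := H2 y (le_lt_trans yh h2); rewrite add0r sin0 cos0 mul1r subr0 => {}H2.
have := H3 y (le_lt_trans yh h3).
rewrite add0r sin0 cos0 oppr0 mul0r subr0 => {}H3.
have cx : cexp h - 1 - h = ((expR x - 1 - x) +i* (sin y - y)) +
    (expR x * (cos y - 1))%:C + ((expR x - 1) * sin y)%:C * 'i.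
  rewrite /cexp -/x -/y (complex_split h) -/x -/y.
  by complex_ext; ring.
set s := nrm h in xh yh h5 h6 *.
have E1 : `|expR x - 1| <= 2 * s.
  have := ler_normD (expR x - 1 - x) x; rewrite subrK => /le_trans; apply; lra.
have E2 : `|expR x| <= 3.
  have := ler_normD (expR x - 1) 1; rewrite subrK normr1 => /le_trans; apply; lra.
have E3 : `|sin y| <= 1 by exact: sin_max.
have E4 : `|sin y| <= (1 + c) * s.
  have := ler_normD (sin y - y) y; rewrite subrK => /le_trans; apply.
  have : c * `|y| <= c * s by rewrite ler_pM2l.
  lra.
rewrite cx.
rewrite (le_trans (nrmD _ _)) // nrmM nrm_i mulr1 nrm_real normrM.
rewrite (le_trans (lerD (nrmD _ _) (lexx _))) // nrm_real normrM.
have T1 := nrm_le_ReIm ((expR x - 1 - x) +i* (sin y - y)).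
rewrite /= -/(nrm _) in T1.
have T2 : `|expR x| * `|cos y - 1| <= 3 * (c * s).
  by rewrite ler_pM // (le_trans H3) // ler_pM2l.
have T3 : `|expR x - 1| * `|sin y| <= (2 * s) * ((1 + c) * s) by rewrite ler_pM.
have T4 : (2 * s) * ((1 + c) * s) <= (2 * s) * (2 * c).
  have s0 : 0 <= s by exact: nrm_ge0.
  rewrite ler_wpM2l ?mulr_ge0 //.
  have : c * s <= c * 1 by rewrite ler_pM2l // ltW.
  lra.
have cs1 : c * `|x| <= c * s by rewrite ler_pM2l.
have cs2 : c * `|y| <= c * s by rewrite ler_pM2l.
have cs0 : 0 <= c * s by rewrite mulr_ge0 ?nrm_ge0 // ltW.
have -> : e = 16 * c by rewrite /c mulrC divfK.
move: T1 T2 T3 T4 H1 H2; rewrite /nrm; set A := Num.sqrt _; lra.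
Qed.

(** Since exp u - exp v = exp v (exp (u - v) - 1), the derivative at 0 and
    continuity at 0 give a difference quotient that is uniform in both points.
    *)
Lemma cexp_strict0 (e : R) : 0 < e -> exists2 d : R, 0 < d &
  forall u v, nrm u < d -> nrm v < d ->
    nrm (cexp u - cexp v - (u - v)) <= e * nrm (u - v).
Proof.
move=> e0; have e4 : 0 < e / 4 by rewrite divr_gt0.
have [d1 d10 H1] := cexp_cderiv0 e4.
have m0 : 0 < Num.min 1 (e / 2) by rewrite lt_min ltr01 divr_gt0.
have [d2 d20 H2] := cderiv_cont cexp_cderiv0 m0.
exists (Num.min (d1 / 2) d2); first by rewrite lt_min d20 divr_gt0.
move=> u v; rewrite !lt_min => /andP[u1 u2] /andP[v1 v2].
have hd : nrm (u - v) < d1.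
  by rewrite (le_lt_trans (nrmD _ _)) // nrmN [d1]splitr ltrD.
have := H1 _ hd; rewrite cexp0 add0r mul1r => {}H1.
have := H2 v; rewrite subr0 cexp0 => /(_ v2); rewrite lt_min => /andP[V1 V2].
have uE : cexp u = cexp v * cexp (u - v) by rewrite -cexpD addrC subrK.
rewrite (_ : _ - _ = cexp v * (cexp (u - v) - 1 - (u - v)) +
  (cexp v - 1) * (u - v)); last by rewrite uE; ring.
rewrite (le_trans (nrmD _ _)) // (nrmM (cexp v)) (nrmM (cexp v - 1)).
have V3 : nrm (cexp v) <= 2.
  by have := nrmD (cexp v - 1) 1; rewrite subrK nrm1 => /le_trans; apply; lra.
have h0 := nrm_ge0 (u - v).
have T1 : nrm (cexp v) * nrm (cexp (u - v) - 1 - (u - v)) <=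
    2 * (e / 4 * nrm (u - v)) by rewrite ler_pM ?nrm_ge0.
have T2 : nrm (cexp v - 1) * nrm (u - v) <= e / 2 * nrm (u - v).
  by rewrite ler_wpM2r // ltW.
have -> : e * nrm (u - v) = 2 * (e / 4 * nrm (u - v)) + e / 2 * nrm (u - v) by field.
exact: lerD.
Qed.

(** The error is relative to |exp w|, so that the radius d does not depend on w:
    this is what makes lifting through exp, and through F, possible with steps
    of a fixed size. *)
Lemma cexp_strict (e : R) : 0 < e -> exists2 d : R, 0 < d &
  forall w u v, nrm (u - w) < d -> nrm (v - w) < d ->
    nrm (cexp u - cexp v - cexp w * (u - v)) <= e * nrm (cexp w) * nrm (u - v).
Proof.
move=> /cexp_strict0[d d0 H]; exists d => // w u v ud vd.
have uE t : cexp t = cexp w * cexp (t - w) by rewrite -cexpD addrC subrK.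
rewrite (uE u) (uE v) -!mulrBr (nrmM (cexp w)) [e * _]mulrC -mulrA ler_wpM2l ?nrm_ge0 //.
have -> : u - v = (u - w) - (v - w) by ring.
exact: H.
Qed.

Lemma cexp_cderiv z : cderiv (@cexp R) z (cexp z).
Proof.
move=> e e0; have n0 : 0 < nrm (cexp z) by rewrite nrm_gt0 cexp_neq0.
have [d d0 H] := cexp_cderiv0 (divr_gt0 e0 n0); exists d => // h /H.
rewrite add0r cexp0 mul1r cexpD => {}H.
have -> : cexp z * cexp h - cexp z - cexp z * h = cexp z * (cexp h - 1 - h).
  by ring.
have -> : e * nrm h = nrm (cexp z) * (e / nrm (cexp z) * nrm h).
  by field; rewrite gt_eqF.
by rewrite (nrmM (cexp z)) ler_pM2l.
Qed.

End ComplexExponential.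

(** * The lift of the double standard map *)

Section Lift.
Variable R : realType.
Implicit Types (z w u v : R[i]) (a b x y : R).

(** F(w) = 2w + 2 pi a + 2b sin w, with sin expressed through exponentials. *)
Definition clift a b w : R[i] :=
  2 * w + (2 * pi * a)%:C - 'i * b%:C * (cexp ('i * w) - cexp (- ('i * w))).

(** F'(w) = 2 + 2b cos w. *)
Definition dclift b w : R[i] := 2 + b%:C * (cexp ('i * w) + cexp (- ('i * w))).

Definition rlift a b x : R := 2 * x + 2 * pi * a + 2 * b * sin x.

Lemma mulii : 'i * 'i = -1 :> R[i].
Proof. by rewrite -sqr_i expr2. Qed.

Lemma dsm_cexp a b w : dsm a b (cexp ('i * w)) = cexp ('i * clift a b w).
Proof.
rewrite /dsm -cexpN.
have -> : b%:C * cexp ('i * w) - b%:C * cexp (- ('i * w)) =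
    - ('i * 'i) * b%:C * (cexp ('i * w) - cexp (- ('i * w))).
  by rewrite mulii; ring.
have -> : 0 +i* (2 * pi * a) = 'i * (2 * pi * a)%:C :> R[i].
  by complex_ext; ring.
by rewrite expr2 -!cexpD; congr cexp; rewrite /clift; ring.
Qed.

Lemma clift_real a b x : clift a b x%:C = (rlift a b x)%:C.
Proof.
have e : - ('i * x%:C) = 'i * (- x)%:C :> R[i] by rewrite rmorphN mulrN.
by rewrite /clift /rlift e !cexp_im cosN sinN; complex_ext; ring.
Qed.

Lemma conjcN z : (- z)^* = - z^*.
Proof. by case: z. Qed.

Lemma clift_conj a b w : clift a b w^* = (clift a b w)^*.
Proof.
have e : 'i * w^* = (- ('i * w))^* by case: w => x y; complex_ext; ring.
rewrite /clift e -conjcN opprK !cexp_conj.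
case: (cexp _) => p q; case: (cexp _) => r s; case: w {e} => x y.
by complex_ext; ring.
Qed.

Lemma dclift_conj b w : dclift b w^* = (dclift b w)^*.
Proof.
have e : 'i * w^* = (- ('i * w))^* by case: w => x y; complex_ext; ring.
rewrite /dclift e -conjcN opprK !cexp_conj.
case: (cexp _) => p q; case: (cexp _) => r s.
by complex_ext; ring.
Qed.

Lemma clift_opp a b w : clift (- a) b (- w) = - clift a b w.
Proof. by rewrite /clift !mulrN opprK rmorphN /=; ring. Qed.

Lemma dclift_opp b w : dclift b (- w) = dclift b w.
Proof. by rewrite /dclift mulrN opprK [X in _ * X]addrC. Qed.

Lemma cexpN_i_period z (k : int) :
  cexp (- ('i * (z + (k%:~R * (pi *+ 2))%:C))) = cexp (- ('i * z)).
Proof. by rewrite !cexpN cexp_i_period. Qed.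

Lemma clift_period a b w (k : int) : clift a b (w + (k%:~R * (pi *+ 2))%:C) =
  clift a b w + ((k *+ 2)%:~R * (pi *+ 2))%:C.
Proof.
have -> : (k *+ 2)%:~R = 2 * k%:~R :> R by rewrite rmorphMn /= mulr_natl.
have -> : (2 * k%:~R * (pi *+ 2))%:C = 2 * (k%:~R * (pi *+ 2))%:C :> R[i].
  by complex_ext; ring.
by rewrite /clift cexp_i_period cexpN_i_period; ring.
Qed.

Lemma cderiv_lin c z : cderiv (fun w => c * w) z c.
Proof. by have := cderivZ c (cderiv_id z); rewrite mulr1. Qed.

Lemma cderiv_cexp_lin c z : cderiv (fun w => cexp (c * w)) z (c * cexp (c * z)).
Proof. by rewrite mulrC; apply: cderiv_comp (cderiv_lin _ _) (cexp_cderiv _). Qed.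

Lemma cderiv_cexp_linN c z :
  cderiv (fun w => cexp (- (c * w))) z (- c * cexp (- (c * z))).
Proof.
rewrite -mulNr; apply: cderiv_ext (cderiv_cexp_lin (- c) z) => w.
by rewrite mulNr.
Qed.

Lemma clift_cderiv a b w : cderiv (clift a b) w (dclift b w).
Proof.
have -> : dclift b w = 2 + 0 - 'i * b%:C * ('i * cexp ('i * w) - - 'i * cexp (- ('i * w))).
  rewrite (_ : 'i * b%:C * _ =
    ('i * 'i) * (b%:C * (cexp ('i * w) + cexp (- ('i * w))))); last by ring.
  by rewrite mulii /dclift; ring.
apply: cderivB; first by apply: cderivD; [exact: cderiv_lin|exact: cderiv_cst].
apply: cderivZ; apply: cderivB; first exact: cderiv_cexp_lin.
exact: cderiv_cexp_linN.
Qed.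

Lemma dclift_cderiv b w : exists m, cderiv (dclift b) w m.
Proof.
eexists; apply: cderivD; first exact: cderiv_cst.
apply: cderivZ; apply: cderivD; first exact: cderiv_cexp_lin.
exact: cderiv_cexp_linN.
Qed.

End Lift.

(** * Lifting through a holomorphic map *)

Section Inversion.
Variable R : realType.
Implicit Types (z w u v : R[i]) (a b x y : R) (E dE : R[i] -> R[i]).

Definition rect x1 x2 y1 y2 : set R[i] :=
  [set z | [/\ x1 <= re z, re z <= x2, y1 <= im z & im z <= y2]].

Definition continuous_on (Q : set R[i]) (f : R[i] -> R) := forall z, Q z ->
  forall e : R, 0 < e -> exists2 d : R, 0 < d &
    forall w, Q w -> nrm (w - z) < d -> `|f w - f z| < e.

(** Rectangles are images of compact products of intervals. *)
Lemma rect_EVT_min x1 x2 y1 y2 (f : R[i] -> R) : x1 <= x2 -> y1 <= y2 ->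
  continuous_on (rect x1 x2 y1 y2) f ->
  exists2 c, rect x1 x2 y1 y2 c & forall z, rect x1 x2 y1 y2 z -> f c <= f z.
Proof.
move=> x12 y12 fc; pose g (p : R * R) := f (p.1 +i* p.2).
pose A : set (R * R) := `[x1, x2] `*` `[y1, y2].
have AP p : A p <-> rect x1 x2 y1 y2 (p.1 +i* p.2).
  rewrite /A /rect /= !in_itv /=; split.
    by case=> /= /andP[? ?] /andP[? ?]; split.
  by case=> ? ? ? ?; split; apply/andP.
have A0 : A !=set0 by exists (x1, y1); apply/AP; split=> /=.
have cA : compact A by apply: compact_setX; exact: segment_compact.
have gc : {within A, continuous g}.
  apply/subspace_continuousP => p Ap; apply/cvgrPdist_lt => e e0.
  have [d d0 H] := fc _ ((AP p).1 Ap) e e0.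
  rewrite near_withinE; apply/nbhs_ballP; exists (d / 2); first by rewrite /= divr_gt0.
  move=> q [/= q1 q2] Aq; rewrite distrC; apply: H; first exact/AP.
  rewrite (le_lt_trans (nrm_le_ReIm _)) // reD imD reN imN /= [d]splitr.
  by rewrite ltrD // distrC.
have [c Ac H] := compact_EVT_min A0 cA gc.
exists (c.1 +i* c.2); first exact/AP/set_mem.
move=> z Qz; have := H (re z, im z); rewrite /g /= -complex_split; apply.
by rewrite inE; apply/AP; rewrite /= -complex_split.
Qed.

(** E is nearly affine, relative to |E'(w)|, on a ball around w whose radius
    depends only on a lower bound d of |E'(w)|. Plain differentiability would
    give radii without a lower bound, as the preimages of a point under E are
    not confined to a compact set. *)
Definition uniformly_strict E dE := forall d : R, 0 < d -> exists2 r : R, 0 < r &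
  forall w, d <= nrm (dE w) -> forall u v, nrm (u - w) < r -> nrm (v - w) < r ->
    nrm (E u - E v - dE w * (u - v)) <= 2^-1 * nrm (dE w) * nrm (u - v).

Lemma cexp_uniformly_strict : uniformly_strict (@cexp R) (@cexp R).
Proof.
move=> d d0; have [r r0 H] := @cexp_strict R 2^-1 ltac:(by rewrite invr_gt0).
by exists r => // w _ u v; exact: H.
Qed.

(** With p = |exp(iw)| and q = 1/p, the error is at most b (p + q) times a small
    constant, while |F'(w)| >= b (p + q) - 4: the error is small relative to
    |F'(w)| both when p + q is large and, by the lower bound d, when it is not.
    *)
Lemma clift_uniformly_strict a b : 0 <= b <= 1 -> uniformly_strict (clift a b) (dclift b).
Proof.
move=> /andP[b0 b1] d d0; pose k : R := 2^-1 / (1 + 4 / d).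
have k0 : 0 < k by rewrite divr_gt0 ?invr_gt0 // addr_gt0 ?divr_gt0.
have [r r0 H] := @cexp_strict R k k0.
exists r => // w dw u v uw vw.
set D := nrm (dclift b w) in dw *.
set p := cexp ('i * w); set q := cexp (- ('i * w)).
have iN (t : R[i]) : nrm ('i * t - 'i * w) = nrm (t - w).
  by rewrite -mulrBr nrmM nrm_i mul1r.
have iN' (t : R[i]) : nrm (- ('i * t) - - ('i * w)) = nrm (t - w).
  by rewrite opprK addrC -mulrBr nrmM nrm_i mul1r nrmB.
have Hp : nrm (cexp ('i * u) - cexp ('i * v) - p * ('i * u - 'i * v)) <=
    k * nrm p * nrm (u - v).
  have <- : nrm ('i * u - 'i * v) = nrm (u - v).
    by rewrite -mulrBr nrmM nrm_i mul1r.
  by apply: H; rewrite iN.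
have Hq : nrm (cexp (- ('i * u)) - cexp (- ('i * v)) - q * (- ('i * u) - - ('i * v))) <=
    k * nrm q * nrm (u - v).
  have <- : nrm (- ('i * u) - - ('i * v)) = nrm (u - v).
    by rewrite opprK addrC -mulrBr nrmM nrm_i mul1r nrmB.
  by apply: H; rewrite iN'.
have bE : b%:C = - ('i * 'i) * b%:C :> R[i] by rewrite mulii opprK mul1r.
have -> : clift a b u - clift a b v - dclift b w * (u - v) = - 'i * b%:C *
   ((cexp ('i * u) - cexp ('i * v) - p * ('i * u - 'i * v)) -
   (cexp (- ('i * u)) - cexp (- ('i * v)) - q * (- ('i * u) - - ('i * v)))).
  by rewrite /clift /dclift [X in 2 + X * _]bE /p /q; ring.
rewrite nrmM nrmM nrmN nrm_i mul1r nrm_real (ger0_norm b0).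
have pq : nrm p * nrm q = 1.
  by rewrite -nrmM /p /q cexpN mulfV ?cexp_neq0 // nrm1.
have p0 : 0 < nrm p by rewrite nrm_gt0 cexp_neq0.
have q0 : 0 < nrm q by rewrite nrm_gt0 cexp_neq0.
have Dlow : b * (nrm p + nrm q) <= D + 4.
  have D1 : b * nrm (p + q) - 2 <= D.
    rewrite /D /dclift -/p -/q lerBlDr.
    have := nrmD (2 + b%:C * (p + q)) (- 2); rewrite addrC addKr nrmM nrmN.
    rewrite -(rmorph_nat (real_complex R)) !nrm_real ger0_norm //.
    by rewrite ger0_norm.
  have D2 : nrm p + nrm q - 2 <= nrm (p + q).
    have E1 := nrmDB p q; have E2 := nrmDB q p; rewrite [q + p]addrC in E2.
    have [p1|p1] := leP (nrm p) 1; first lra.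
    have q1 : nrm q < 1.
      by rewrite -pq ltr_pMl.
    lra.
  have : b * (nrm p + nrm q - 2) <= b * nrm (p + q) by rewrite ler_wpM2l.
  lra.
have h0 := nrm_ge0 (u - v).
apply: (@le_trans _ _ (b * (k * nrm p * nrm (u - v) + k * nrm q * nrm (u - v)))).
  rewrite ler_wpM2l // (le_trans (nrmD _ _)) // nrmN.
  exact: lerD.
have -> : b * (k * nrm p * nrm (u - v) + k * nrm q * nrm (u - v)) =
  k * (b * (nrm p + nrm q)) * nrm (u - v) by ring.
rewrite ler_wpM2r // (@le_trans _ _ (k * (D + 4))) //.
  by rewrite ler_wpM2l // ltW.
rewrite /k mulrAC ler_pdivrMr ?addr_gt0 ?divr_gt0 // -mulrA ler_wpM2l ?invr_ge0 //.
rewrite mulrDr mulr1 lerD2l mulrCA ler_peMr // ler_pdivlMr ?mul1r //.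
Qed.

Section AtAPoint.
Variables (E dE : R[i] -> R[i]) (w : R[i]) (r : R).
Hypothesis dE0 : 0 < nrm (dE w).
Hypothesis strict : forall u v, nrm (u - w) < r -> nrm (v - w) < r ->
  nrm (E u - E v - dE w * (u - v)) <= 2^-1 * nrm (dE w) * nrm (u - v).

Lemma local_expansion u v : nrm (u - w) < r -> nrm (v - w) < r ->
  2^-1 * nrm (dE w) * nrm (u - v) <= nrm (E u - E v).
Proof.
move=> uw vw; have := strict uw vw; rewrite -nrmN opprB.
have := nrmBB (dE w * (u - v)) (E u - E v); rewrite nrmM.
lra.
Qed.

(** A minimum point of |E - v| on a small square is interior, because E expands,
    and one damped Newton step from it would decrease |E - v| if the minimum
    were positive. *)
Lemma local_inversion v : nrm (v - E w) < nrm (dE w) * r / 16 ->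
  exists2 u, nrm (u - w) < r & E u = v.
Proof.
set D := nrm (dE w) => vw.
have r0 : 0 < r.
  have := le_lt_trans (nrm_ge0 _) vw.
  by rewrite pmulr_lgt0 ?invr_gt0 // pmulr_rgt0.
(* The square of half-side r/4 is inside the ball of radius r/2, and E moves its
   boundary by at least |E'(w)| r/8, twice the allowed distance of v to E w. *)
pose s := r / 4; have s0 : 0 < s by rewrite divr_gt0.
pose Q := rect (re w - s) (re w + s) (im w - s) (im w + s).
have Qr u : Q u -> nrm (u - w) < r.
  case=> q1 q2 q3 q4; rewrite (le_lt_trans (nrm_le_ReIm _)) // reD imD reN imN.
  have : `|re u - re w| <= s by rewrite ler_norml; apply/andP; split; lra.
  have : `|im u - im w| <= s by rewrite ler_norml; apply/andP; split; lra.
  by rewrite /s; lra.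
have Qw : Q w by split; lra.
have fc : continuous_on Q (fun u => nrm (E u - v)).
  move=> u Qu e e0; exists (e / (2 * D)); first by rewrite divr_gt0 ?mulr_gt0.
  move=> u' Qu' uu; rewrite (le_lt_trans (nrm_dist _ _)) //.
  have -> : E u' - v - (E u - v) = (E u' - E u - dE w * (u' - u)) + dE w * (u' - u).
    by ring.
  rewrite (le_lt_trans (nrmD _ _)) // nrmM -/D.
  have := strict (Qr _ Qu') (Qr _ Qu); rewrite -/D => h1.
  have h2 : nrm (u' - u) * (2 * D) < e by rewrite -ltr_pdivlMr // mulr_gt0.
  have h3 : 0 <= D * nrm (u' - u) by rewrite mulr_ge0 ?nrm_ge0.
  lra.
have xx : re w - s <= re w + s by lra.
have yy : im w - s <= im w + s by lra.
have [c Qc cmin] := rect_EVT_min xx yy fc.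
exists c; first exact: Qr.
have cin : [/\ re w - s < re c, re c < re w + s, im w - s < im c & im c < im w + s].
  have cs : nrm (c - w) < s.
    have h1 := local_expansion (Qr _ Qc) (Qr _ Qw).
    have h2 := cmin _ Qw; rewrite /= (nrmB (E w)) in h2.
    have h3 : nrm (E c - E w) <= nrm (E c - v) + nrm (v - E w) by exact: nrm_tri.
    have h4 : D * nrm (c - w) < D * s.
      by move: h1 vw; rewrite -/D /s; lra.
    by rewrite ltr_pM2l in h4.
  have := le_lt_trans (absRe_le _) cs; rewrite reD reN ltr_norml => /andP[? ?].
  have := le_lt_trans (absIm_le _) cs; rewrite imD imN ltr_norml => /andP[? ?].
  by split; lra.
apply/eqP; apply: contraT; rewrite -subr_eq0 => m0.
set m := E c - v in m0; have nm0 : 0 < nrm m by rewrite nrm_gt0.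
case: cin => c1 c2 c3 c4.
(* The Newton step m / E'(w) has length k; the fraction t of it stays in the
   square. *)
pose k := nrm m / D; have k0 : 0 < k by rewrite divr_gt0.
pose g := Num.min (Num.min (re c - (re w - s)) (re w + s - re c))
            (Num.min (im c - (im w - s)) (im w + s - im c)).
have g0 : 0 < g by rewrite !lt_min !subr_gt0 c1 c2 c3 c4.
pose t := Num.min 1 (g / k).
have t0 : 0 < t by rewrite lt_min ltr01 divr_gt0.
have t1 : t <= 1 by rewrite ge_min lexx.
have tk : t * k <= g by rewrite -ler_pdivlMr // ge_min lexx orbT.
pose u := c - t%:C * (m / dE w).
have uc : nrm (u - c) = t * k.
  rewrite /u addrAC subrr add0r nrmN nrmM nrm_real ger0_norm 1?ltW //.
  by rewrite nrmM nrmV.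
have Qu : Q u.
  have := absRe_le (u - c); have := absIm_le (u - c).
  rewrite uc reD imD reN imN !ler_norml => /andP[i1 i2] /andP[i3 i4].
  move: (tk); rewrite !le_min => /andP[/andP[j1 j2] /andP[j3 j4]].
  by split; lra.
have := cmin _ Qu; rewrite -/m.
have -> : E u - v = (E u - E c - dE w * (u - c)) + (1 - t)%:C * m.
  have dw0 : dE w != 0 by rewrite -nrm_gt0.
  have -> : dE w * (u - c) = - (t%:C * m) by rewrite /u; field.
  have -> : (1 - t)%:C = 1 - t%:C :> R[i] by rewrite rmorphB.
  by rewrite mulrBl mul1r {2}/m; ring.
move=> h; have := le_trans h (nrmD _ _).
rewrite (nrmM (1 - t)%:C) nrm_real ger0_norm ?subr_ge0 //.
have := strict (Qr _ Qu) (Qr _ Qc); rewrite -/D uc.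
have -> : 2^-1 * D * (t * k) = 2^-1 * t * nrm m.
  by rewrite /k; field; rewrite gt_eqF.
have : 0 < t * nrm m by rewrite mulr_gt0.
lra.
Qed.

End AtAPoint.

End Inversion.

Section Lifting.
Variable R : realType.
Implicit Types (z w u v : R[i]) (E dE phi psi : R[i] -> R[i]) (Q : set R[i]).

(** Both constants are uniform on Q. This is the modulus of continuity which
    lifting reproduces: the new L is 2/d times the old one. *)
Definition loc_lipschitz Q phi := exists L eta : R, [/\ 0 < L, 0 < eta &
  forall z w, Q z -> Q w -> nrm (z - w) < eta -> nrm (phi z - phi w) <= L * nrm (z - w)].

Definition real_on_reals Q phi := forall z, Q z -> im z = 0 -> im (phi z) = 0.

Lemma conj_fix z : z^* = z -> im z = 0.
Proof. by case: z => x y [] /= h; lra. Qed.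

Lemma real_conj z : im z = 0 -> z^* = z.
Proof. by case: z => x y /= ->; rewrite oppr0. Qed.

Lemma conjB z w : (z - w)^* = z^* - w^*.
Proof. by case: z w => [x y] [x' y']; complex_ext; ring. Qed.

Variables (E dE : R[i] -> R[i]) (Q : set R[i]) (z0 : R[i]).
Hypothesis strictE : uniformly_strict E dE.
Hypothesis conjE : forall w, E w^* = (E w)^*.
Hypothesis Qz0 : Q z0.
Hypothesis starQ : forall z (t : R), Q z -> 0 <= t <= 1 -> Q (z0 + t%:C * (z - z0)).
Variable M : R.
Hypothesis boundedQ : forall z, Q z -> nrm (z - z0) <= M.
Hypothesis real_z0 : im z0 = 0.

(** Deform phi to the constant phi(z0) by phi_s(z) = phi(z0 + s (z - z0)) and
    follow a solution of E(psi) = phi_s from s = 0, where psi = w0, to s = 1 in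
    finitely many small steps, each by local inversion. Uniqueness of the local
    inverse propagates the Lipschitz bound, the value at z0 and, when everything
    commutes with conjugation, reality on the real axis. *)
Lemma lifting phi (d : R) w0 : loc_lipschitz Q phi -> real_on_reals Q phi ->
  0 < d -> (forall z w, Q z -> E w = phi z -> d <= nrm (dE w)) ->
  E w0 = phi z0 -> im w0 = 0 ->
  exists psi, [/\ forall z, Q z -> E (psi z) = phi z, psi z0 = w0,
    loc_lipschitz Q psi & real_on_reals Q psi].
Proof.
move=> [L [eta [L0 eta0 Hphi]]] realphi d0 dlow Ew0 rw0.
have [r r0 US] := strictE d0.
have M0 : 0 <= M by have := boundedQ Qz0; rewrite subrr nrm0.
(* L' is the Lipschitz constant of the solutions; eta' keeps two of them within
   the radius r of local inversion. *)
pose L' := 2 / d * L; have L'0 : 0 < L' by rewrite mulr_gt0 ?divr_gt0.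
pose eta' := Num.min eta (r / 4 / L').
have eta'0 : 0 < eta' by rewrite lt_min eta0 !divr_gt0.
(* Steps shorter than m change phi by less than d r/16, the range of local
   inversion. *)
pose m := Num.min eta (d * r / 16 / L).
have m0 : 0 < m by rewrite lt_min eta0 divr_gt0 // divr_gt0 // mulr_gt0.
pose N := (Num.truncn (M / m)).+1.
have N0 : 0 < N%:R :> R by rewrite ltr0n.
have MN : M / N%:R < m.
  rewrite ltr_pdivrMr // mulrC -ltr_pdivrMr //.
  exact: truncnS_gt.
pose s (j : nat) z := z0 + (j%:R / N%:R)%:C * (z - z0).
have jN j : (j <= N)%N -> 0 <= (j%:R / N%:R : R) <= 1.
  by move=> jn; rewrite divr_ge0 ?ler0n //= ler_pdivrMr // mul1r ler_nat.
have sQ j z : (j <= N)%N -> Q z -> Q (s j z).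
  by move=> jn Qz; apply: starQ => //; exact: jN.
have sz0 j : s j z0 = z0 by rewrite /s subrr mulr0 addr0.
have slip j z w : (j <= N)%N -> nrm (s j z - s j w) <= nrm (z - w).
  move=> /jN /andP[j0 j1]; rewrite /s.
  have -> : z0 + (j%:R / N%:R)%:C * (z - z0) - (z0 + (j%:R / N%:R)%:C * (w - z0)) =
    (j%:R / N%:R)%:C * (z - w) by ring.
  by rewrite nrmM nrm_real ger0_norm // ler_piMl ?nrm_ge0.
have sstep j z : Q z -> nrm (s j.+1 z - s j z) < m.
  move=> Qz; rewrite /s.
  have -> : z0 + (j.+1%:R / N%:R)%:C * (z - z0) - (z0 + (j%:R / N%:R)%:C * (z - z0)) =
    (N%:R^-1)%:C * (z - z0).
    rewrite [z0 + _]addrC opprD addrA addrK -mulrBl -rmorphB /= -mulrBl.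
    by rewrite -natr1 addrAC subrr add0r mul1r.
  rewrite nrmM nrm_real ger0_norm ?invr_ge0 ?ler0n // mulrC.
  by rewrite (le_lt_trans _ MN) // ler_wpM2r ?invr_ge0 ?ler0n // boundedQ.
have phistep j z : (j.+1 <= N)%N -> Q z ->
    nrm (phi (s j.+1 z) - phi (s j z)) < d * r / 16.
  move=> jn Qz; have := sstep j z Qz; rewrite lt_min => /andP[h1 h2].
  apply: le_lt_trans (Hphi _ _ (sQ _ _ jn Qz) (sQ _ _ (ltnW jn) Qz) h1) _.
  by rewrite mulrC -ltr_pdivlMr.
have reals j z : im z = 0 -> im (s j z) = 0.
  move=> rz; rewrite /s !reimE /= rz real_z0; ring.
have expand w u v : d <= nrm (dE w) -> nrm (u - w) < r -> nrm (v - w) < r ->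
    nrm (u - v) <= 2 / d * nrm (E u - E v).
  move=> dw uw vw; have w0' := lt_le_trans d0 dw.
  have := local_expansion (US w dw) uw vw.
  have : d * nrm (u - v) <= nrm (dE w) * nrm (u - v) by rewrite ler_wpM2r ?nrm_ge0.
  move=> h1 h2; rewrite mulrAC ler_pdivlMr //; lra.
suff H j : (j <= N)%N -> exists psi, [/\ forall z, Q z -> E (psi z) = phi (s j z),
    psi z0 = w0, (forall z w, Q z -> Q w -> nrm (z - w) < eta' ->
       nrm (psi z - psi w) <= L' * nrm (z - w)) & real_on_reals Q psi].
  have [psi [H1 H2 H3 H4]] := H N (leqnn N); exists psi; split=> //.
    move=> z Qz; rewrite H1 // /s divff ?gt_eqF // mul1r.
    by rewrite addrC subrK.
  by exists L', eta'; split.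
elim: j => [|j IH] jn.
  exists (fun=> w0); split=> //.
    by move=> z Qz; rewrite Ew0 /s mul0r mul0r addr0.
  by move=> z w _ _ _; rewrite subrr nrm0 mulr_ge0 ?nrm_ge0 // ltW.
have [psi [H1 H2 H3 H4]] := IH (ltnW jn).
have Hd z : Q z -> d <= nrm (dE (psi z)).
  by move=> Qz; apply: (dlow (s j z)); [exact: sQ (ltnW jn) Qz|exact: H1].
have step z : exists u, Q z -> nrm (u - psi z) < r /\ E u = phi (s j.+1 z).
  have [Qz|nQ] := pselect (Q z); last by exists 0.
  have dz := Hd _ Qz.
  have [u ur Eu] : exists2 u, nrm (u - psi z) < r & E u = phi (s j.+1 z).
    apply: (local_inversion (lt_le_trans d0 dz) (US _ dz)).
    rewrite H1 // (lt_le_trans (phistep _ _ jn Qz)) // ler_pdivrMr //.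
    by rewrite divfK // ler_wpM2r // ltW.
  by exists u.
have [chi Hchi] := choice step.
have chir z : Q z -> nrm (chi z - psi z) < r by move=> /Hchi[].
have chiE z : Q z -> E (chi z) = phi (s j.+1 z) by move=> /Hchi[].
have near z : Q z -> nrm (chi z - psi z) < r / 8.
  move=> Qz.
  have := expand _ _ _ (Hd _ Qz) (chir _ Qz) (_ : nrm (psi z - psi z) < r).
  rewrite subrr nrm0 => /(_ r0) /le_lt_trans; apply.
  rewrite chiE // H1 //.
  have := phistep _ _ jn Qz; rewrite -(ltr_pM2l (_ : 0 < 2 / d)) ?divr_gt0 //.
  move/lt_le_trans; apply; rewrite le_eqVlt; apply/orP; left; apply/eqP.
  by field; rewrite gt_eqF.
exists chi; split=> //.
- have := expand (psi z0) (chi z0) w0 (Hd _ Qz0) (chir _ Qz0).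
  rewrite {1}H2 subrr nrm0 => /(_ r0); rewrite chiE // sz0 Ew0 subrr nrm0 mulr0.
  move=> h; apply/eqP; rewrite -subr_eq0 -nrm_eq0 eq_le h; exact: nrm_ge0.
- move=> z w Qz Qw; rewrite lt_min => /andP[zw1 zw2].
  have wr : nrm (chi w - psi z) < r.
    rewrite (le_lt_trans (nrm_tri (psi w) _ _)) //.
    have h1 := near _ Qw.
    have h2 : nrm (psi w - psi z) <= L' * nrm (w - z).
      by apply: H3 => //; rewrite nrmB lt_min zw1 zw2.
    have h3 : L' * nrm (w - z) < r / 4 by rewrite nrmB mulrC -ltr_pdivlMr.
    lra.
  apply: le_trans (expand _ _ _ (Hd _ Qz) (chir _ Qz) wr) _.
  rewrite !chiE // /L' -[2 / d * L * _]mulrA ler_wpM2l ?divr_ge0 ?(ltW d0) //.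
  have zwj := slip j.+1 z w jn.
  apply: le_trans (Hphi _ _ (sQ _ _ jn Qz) (sQ _ _ jn Qw) (le_lt_trans zwj zw1)) _.
  by rewrite ler_wpM2l // ltW.
- move=> z Qz rz; apply: conj_fix.
  have cr : nrm ((chi z)^* - psi z) < r.
    by rewrite -(real_conj (H4 _ Qz rz)) -conjB nrm_conj; exact: chir.
  have := expand (psi z) (chi z)^* (chi z) (Hd _ Qz) cr (chir _ Qz).
  rewrite conjE chiE // (real_conj (realphi _ (sQ _ _ jn Qz) (reals _ _ rz))).
  rewrite subrr nrm0 mulr0 => h; apply/eqP; rewrite -subr_eq0 -nrm_eq0 eq_le h.
  exact: nrm_ge0.
Qed.

End Lifting.

(** * Inverse branches of the lift *)

Section Branches.
Variable R : realType.
Implicit Types (z w u v : R[i]) (a b x y : R) (phi psi : R[i] -> R[i]) (Q : set R[i]).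

Lemma loc_lipschitz_nrm Q phi c : loc_lipschitz Q phi ->
  continuous_on Q (fun z => nrm (c - phi z)).
Proof.
move=> [L [eta [L0 eta0 H]]] z Qz e e0.
exists (Num.min eta (e / L)); first by rewrite lt_min eta0 divr_gt0.
move=> w Qw; rewrite lt_min => /andP[h1 h2].
rewrite (le_lt_trans (nrm_dist _ _)) //.
have -> : c - phi w - (c - phi z) = phi z - phi w by ring.
rewrite nrmB (le_lt_trans (H _ _ Qw Qz h1)) //.
by rewrite mulrC -ltr_pdivlMr.
Qed.

Lemma nrm_nat n : nrm (n%:R : R[i]) = n%:R.
Proof. by rewrite -(rmorph_nat (real_complex R)) nrm_real normr_nat. Qed.

Section Rectangle.
Variables x1 x2 y1 y2 : R.
Hypotheses (x12 : x1 <= x2) (y12 : y1 <= y2).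
Let Q := rect x1 x2 y1 y2.

Lemma rect_bounded phi : loc_lipschitz Q phi ->
  exists P : R, forall z, Q z -> nrm (phi z) <= P.
Proof.
move=> Hphi.
have cn : continuous_on Q (fun z => - nrm (0 - phi z)).
  move=> z Qz e e0; have [d d0 H] := loc_lipschitz_nrm 0 Hphi Qz e0.
  by exists d => // w Qw wz; rewrite -opprD normrN; exact: H.
have [c Qc cmin] := rect_EVT_min x12 y12 cn.
exists (nrm (phi c)) => z Qz; have := cmin z Qz.
by rewrite /= lerN2 !sub0r !nrmN.
Qed.

Lemma cexp_lower_bound phi : loc_lipschitz Q phi -> (forall z, Q z -> phi z != 0) ->
  exists2 d : R, 0 < d & forall z w, Q z -> cexp w = phi z -> d <= nrm (cexp w).
Proof.
move=> Hphi phi0.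
have [c Qc cmin] := rect_EVT_min x12 y12 (loc_lipschitz_nrm 0 Hphi).
exists (nrm (phi c)); first by rewrite nrm_gt0 phi0.
by move=> z w Qz ->; have := cmin z Qz; rewrite !sub0r !nrmN.
Qed.

(** Where F' is small both exponentials in sin w are bounded, so F(w) - 2w is
    bounded there and |F(w)| controls |w|. *)
Lemma small_dclift_bounded a b (P : R) : 0 < b <= 1 -> exists S : R, forall w,
  nrm (dclift b w) <= 1 -> nrm (clift a b w) <= P -> nrm w <= S.
Proof.
move=> /andP[b0 b1]; pose T := 3 / b + 1.
exists (P + nrm (2 * pi * a)%:C + 2 * b * T) => w dw Fw.
set p := cexp ('i * w); set q := cexp (- ('i * w)).
have pq : nrm p * nrm q = 1.
  by rewrite -nrmM /p /q cexpN mulfV ?cexp_neq0 // nrm1.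
have p0 : 0 < nrm p by rewrite nrm_gt0 cexp_neq0.
have q0 : 0 < nrm q by rewrite nrm_gt0 cexp_neq0.
have bpq : nrm (p + q) <= 3 / b.
  rewrite ler_pdivlMr // mulrC -{1}(ger0_norm (ltW b0)) -nrm_real -nrmM.
  have -> : b%:C * (p + q) = dclift b w - 2 by rewrite /dclift -/p -/q; ring.
  by rewrite (le_trans (nrmD _ _)) // nrmN nrm_nat; lra.
have [pT qT] : nrm p <= T /\ nrm q <= T.
  have h1 := nrmDB p q; have h2 := nrmDB q p; rewrite [q + p]addrC in h2.
  have b3 : 0 <= 3 / b by rewrite divr_ge0 // ltW.
  have [p1|p1] := leP (nrm p) 1; first by rewrite /T; split; lra.
  have q1 : nrm q < 1 by rewrite -pq ltr_pMl.
  by rewrite /T; split; lra.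
have wE : 2 * w = clift a b w - (2 * pi * a)%:C + 'i * b%:C * (p - q).
  by rewrite /clift -/p -/q; ring.
have : 2 * nrm w <= P + nrm (2 * pi * a)%:C + b * (T + T).
  rewrite -[X in X * nrm w](nrm_nat 2) -nrmM wE (le_trans (nrmD _ _)) //.
  rewrite lerD //.
    by rewrite (le_trans (nrmD _ _)) // nrmN lerD2r.
  rewrite nrmM nrmM nrm_i mul1r nrm_real ger0_norm ?(ltW b0) // ler_wpM2l ?(ltW b0) //.
  by rewrite (le_trans (nrmD _ _)) // nrmN lerD.
have := nrm_ge0 w; lra.
Qed.

(** The hypothesis of [lifting], from compactness: |F'(w)| + dist(F(w), phi(Q))
    is continuous and positive, and by the previous lemma only a bounded range
    of w matters. *)
Lemma dclift_lower_bound a b phi : 0 <= b <= 1 -> loc_lipschitz Q phi ->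
  (forall z w, Q z -> clift a b w = phi z -> dclift b w != 0) ->
  exists2 d : R, 0 < d &
    forall z w, Q z -> clift a b w = phi z -> d <= nrm (dclift b w).
Proof.
move=> /andP[b0 b1] Hphi ncrit.
have [b00|bn0] := eqVneq b 0.
  exists 1 => // z w _ _; rewrite /dclift b00 mul0r addr0 nrm_nat.
  by rewrite ler1n.
have {bn0}b0 : 0 < b by rewrite lt_def bn0.
have [P HP] := rect_bounded Hphi.
have [S HS] := @small_dclift_bounded a b P ltac:(by rewrite b0 b1).
have mind v : exists c, Q c /\ forall z, Q z -> nrm (v - phi c) <= nrm (v - phi z).
  have [c Qc cmin] := rect_EVT_min x12 y12 (loc_lipschitz_nrm v Hphi).
  by exists c.
have [c Hc] := choice mind; pose D v := nrm (v - phi (c v)).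
have Dlip v v' : `|D v - D v'| <= nrm (v - v').
  have h v1 v2 : D v1 <= D v2 + nrm (v1 - v2).
    rewrite (le_trans ((Hc v1).2 _ (Hc v2).1)) // [D v2 + _]addrC.
    by rewrite /D; exact: nrm_tri.
  have := h v v'; have := h v' v; rewrite (nrmB v') ler_norml => h1 h2.
  by apply/andP; split; lra.
(* The function D is the distance to the compact set phi(Q). *)
pose m w := nrm (dclift b w) + D (clift a b w).
pose Box := rect (- `|S|) `|S| (- `|S|) `|S|.
have SS : - `|S| <= `|S| by rewrite ge0_cp.
have mc : continuous_on Box m.
  move=> w _ e e0; have e20 : 0 < e / 2 by rewrite divr_gt0.
  have [k Hk] := dclift_cderiv b w.
  have [d1 d10 H1] := cderiv_cont Hk e20.
  have [d2 d20 H2] := cderiv_cont (clift_cderiv a b w) e20.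
  exists (Num.min d1 d2); first by rewrite lt_min d10.
  move=> w' _; rewrite lt_min => /andP[/H1 h1 /H2 h2].
  have -> : m w' - m w = (nrm (dclift b w') - nrm (dclift b w)) +
    (D (clift a b w') - D (clift a b w)) by rewrite /m; ring.
  rewrite (le_lt_trans (ler_normD _ _)) // [e]splitr ltrD //.
    by rewrite (le_lt_trans (nrm_dist _ _)).
  by rewrite (le_lt_trans (Dlip _ _)).
have [w0 _ wmin] := rect_EVT_min SS SS mc.
have m0 : 0 < m w0.
  rewrite lt_def addr_ge0 ?nrm_ge0 // andbT paddr_eq0 ?nrm_ge0 //.
  apply/negP => /andP[dw0]; rewrite nrm_eq0 subr_eq0 => /eqP Fw.
  by have := ncrit _ _ (Hc _).1 Fw; rewrite -nrm_eq0 dw0.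
exists (Num.min 1 (m w0)); first by rewrite lt_min ltr01.
move=> z w Qz Fw; have [d1|d1] := leP 1 (nrm (dclift b w)).
  by rewrite ge_min d1.
have wS : nrm w <= S by apply: HS; rewrite ?(ltW d1) // Fw HP.
have Bw : Box w.
  have := le_trans (absRe_le w) (le_trans wS (ler_norm _)).
  have := le_trans (absIm_le w) (le_trans wS (ler_norm _)).
  by rewrite !ler_norml => /andP[? ?] /andP[? ?]; split.
rewrite ge_min; apply/orP; right; rewrite (le_trans (wmin _ Bw)) // /m gerDl.
by rewrite (le_trans ((Hc _).2 _ Qz)) // Fw subrr nrm0.
Qed.

End Rectangle.

End Branches.

Section BranchDerivatives.
Variable R : realType.
Implicit Types (z w u v : R[i]) (a b x y : R) (E dE phi psi : R[i] -> R[i]) (Q : set R[i]).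

(** The Lipschitz bound on psi turns E'(psi z) (psi(z + h) - psi z) = phi'(z) h
    + o(h) into a derivative. *)
Lemma lifting_cderiv Q E phi psi z l m (r : R) : loc_lipschitz Q psi ->
  (forall z, Q z -> E (psi z) = phi z) -> 0 < r ->
  (forall w, nrm (w - z) < r -> Q w) -> l != 0 ->
  cderiv E (psi z) l -> cderiv phi z m -> cderiv psi z (m / l).
Proof.
move=> [L [eta [L0 eta0 H]]] Epsi r0 Qr l0 El phim e e0.
have nl0 : 0 < nrm l by rewrite nrm_gt0.
have [d1 d10 H1] := El (e / 2 * nrm l / L) ltac:(by rewrite divr_gt0 // mulr_gt0 ?divr_gt0).
have [d2 d20 H2] := phim (e / 2 * nrm l) ltac:(by rewrite mulr_gt0 ?divr_gt0).
exists (Num.min (Num.min r eta) (Num.min (d1 / L) d2)).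
  by rewrite !lt_min r0 eta0 d20 divr_gt0.
move=> h; rewrite !lt_min => /andP[/andP[hr heta] /andP[hd1 hd2]].
have Qh : Q (z + h) by apply: Qr; rewrite addrAC subrr add0r.
have Qz : Q z by apply: Qr; rewrite subrr nrm0.
have kL : nrm (psi (z + h) - psi z) <= L * nrm h.
  by have := H _ _ Qh Qz; rewrite [z + h]addrC addrK; apply.
set k := psi (z + h) - psi z in kL *.
have kd : nrm k < d1 by rewrite (le_lt_trans kL) // mulrC -ltr_pdivlMr.
have := H1 _ kd; rewrite {1}/k [psi z + _]addrC subrK !Epsi // => h1.
have h2 := H2 _ hd2.
have kE : k - m / l * h = l^-1 * ((phi (z + h) - phi z - m * h) -
   (phi (z + h) - phi z - l * k)) by field.
rewrite kE nrmM nrmV ler_pdivrMl //.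
rewrite (le_trans (nrmD _ _)) // nrmN.
have : e / 2 * nrm l / L * nrm k <= e / 2 * nrm l * nrm h.
  have c0 : 0 < e / 2 * nrm l by rewrite mulr_gt0 ?divr_gt0.
  by rewrite -!mulrA [L^-1 * _]mulrC !mulrA -mulrA ler_pM2l // ler_pdivrMr // mulrC.
lra.
Qed.

Definition open_rect x1 x2 y1 y2 : set R[i] :=
  [set z | [/\ x1 < re z, re z < x2, y1 < im z & im z < y2]].

Lemma open_rect_nbhs x1 x2 y1 y2 z : open_rect x1 x2 y1 y2 z -> exists2 r : R, 0 < r &
  forall w, nrm (w - z) < r -> open_rect x1 x2 y1 y2 w.
Proof.
case=> h1 h2 h3 h4.
exists (Num.min (Num.min (re z - x1) (x2 - re z)) (Num.min (im z - y1) (y2 - im z))).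
  by rewrite !lt_min !subr_gt0 h1 h2 h3 h4.
move=> w; rewrite !lt_min => /andP[/andP[r1 r2] /andP[r3 r4]].
have := absRe_le (w - z); have := absIm_le (w - z).
rewrite reD imD reN imN !ler_norml => /andP[? ?] /andP[? ?].
by split; lra.
Qed.

Lemma open_rect_sub x1 x2 y1 y2 : open_rect x1 x2 y1 y2 `<=` rect x1 x2 y1 y2.
Proof. by move=> z [? ? ? ?]; split; apply: ltW. Qed.

Definition twice_derivable (U : set R[i]) phi := exists dphi, forall z, U z ->
  cderiv phi z (dphi z) /\ exists m, cderiv dphi z m.

Lemma lifting_twice_derivable x1 x2 y1 y2 E dE phi psi :
  let Q := rect x1 x2 y1 y2 in let U := open_rect x1 x2 y1 y2 in
  loc_lipschitz Q psi -> (forall z, Q z -> E (psi z) = phi z) ->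
  (forall z, Q z -> dE (psi z) != 0) -> (forall w, cderiv E w (dE w)) ->
  (forall w, exists m, cderiv dE w m) ->
  twice_derivable U phi -> twice_derivable U psi.
Proof.
move=> Q U Hpsi Epsi dE0 HE HdE [dphi Hphi].
exists (fun z => dphi z * (dE (psi z))^-1) => z Uz.
have Qz := open_rect_sub Uz.
have [r r0 Ur] := open_rect_nbhs Uz.
have [phi1 [m phi2]] := Hphi _ Uz.
have D1 : cderiv psi z (dphi z * (dE (psi z))^-1).
  apply: (lifting_cderiv Hpsi Epsi r0 _ (dE0 _ Qz) (HE _) phi1).
  by move=> w /Ur /open_rect_sub.
split=> //; have [k Hk] := HdE (psi z).
eexists; apply: cderivM phi2 _.
apply: (@cderivV _ (fun w => dE (psi w)) z _ (dE0 _ Qz)).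
exact: cderiv_comp D1 Hk.
Qed.

Lemma iter_clift_real a b n x :
  iter n (clift a b) x%:C = (iter n (rlift a b) x)%:C.
Proof. by elim: n => //= n ->; rewrite clift_real. Qed.

Lemma twice_derivable_id U : twice_derivable U (fun z => z).
Proof.
exists (fun=> 1) => z _; split; first exact: cderiv_id.
by exists 0; exact: cderiv_cst.
Qed.

Definition square x0 r : set R[i] := rect (x0 - r) (x0 + r) (- r) r.

Lemma center_square x0 r : 0 <= r -> square x0 r x0%:C.
Proof. by move=> r0; split=> /=; lra. Qed.

Lemma square_star x0 r z (t : R) : square x0 r z -> 0 <= t <= 1 ->
  square x0 r (x0%:C + t%:C * (z - x0%:C)).
Proof.
case=> h1 h2 h3 h4 /andP[t0 t1]; have r0 : 0 <= r by lra.
have p0 : 0 <= (1 - t) * r by rewrite mulr_ge0 ?subr_ge0.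
have p1 : 0 <= t * (re z - (x0 - r)) by rewrite mulr_ge0 ?subr_ge0.
have p2 : 0 <= t * (x0 + r - re z) by rewrite mulr_ge0 ?subr_ge0.
have p3 : 0 <= t * (im z - (- r)) by rewrite mulr_ge0 ?subr_ge0.
have p4 : 0 <= t * (r - im z) by rewrite mulr_ge0 ?subr_ge0.
by split; rewrite !reimE /=; lra.
Qed.

Lemma square_bounded x0 r z : square x0 r z -> nrm (z - x0%:C) <= 2 * r.
Proof.
case=> h1 h2 h3 h4; rewrite (le_trans (nrm_le_ReIm _)) // !reimE /= oppr0 addr0.
have : `|re z - x0| <= r by rewrite ler_norml; apply/andP; split; lra.
have : `|im z| <= r by rewrite ler_norml; apply/andP; split; lra.
lra.
Qed.

(** The square contains no critical value of any iterate of F, which is the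
    condition for branches of all F^(-N) to exist on it. *)
Definition no_critical_orbit a b (Q : set R[i]) := forall c n, dclift b c = 0 ->
  ~ Q (iter n.+1 (clift a b) c).

Section Square.
Variables (a b x0 r : R).
Hypothesis hb : 0 <= b <= 1.
Hypothesis r0 : 0 < r.
Let Q := square x0 r.
Let U := open_rect (x0 - r) (x0 + r) (- r) r.

Let Qx0 : Q x0%:C.
Proof. exact/center_square/ltW. Qed.

Let xx : x0 - r <= x0 + r.
Proof. by rewrite lerD2l ge0_cp // ltW. Qed.
Let yy : - r <= r.
Proof. by rewrite ge0_cp // ltW. Qed.

Hypothesis nocrit : no_critical_orbit a b Q.

(** One lifting through F per iterate. If F(w) = phi(z) at a critical point w,
    where phi is the branch of F^(-N), then F^(N+1)(w) = z lies in the square,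
    which is excluded. *)
Lemma inverse_branch N y0 : iter N (rlift a b) y0 = x0 ->
  exists psi, [/\ forall z, Q z -> iter N (clift a b) (psi z) = z, psi x0%:C = y0%:C,
    loc_lipschitz Q psi, real_on_reals Q psi & twice_derivable U psi].
Proof.
elim: N y0 => [|N IH] y0.
  move=> /= ->; exists id; split=> //; last exact: twice_derivable_id.
  by exists 1, 1; split=> // z w _ _ _; rewrite mul1r.
rewrite iterSr => /IH[phi [h1 h2 h3 h4 h5]].
have ncr z w : Q z -> clift a b w = phi z -> dclift b w != 0.
  move=> Qz Fw; apply/negP => /eqP dw.
  have QN : Q (iter N.+1 (clift a b) w) by rewrite iterSr Fw h1.
  exact: (nocrit dw QN).
have [d d0 dlow] := dclift_lower_bound xx yy hb h3 ncr.
have Fy0 : clift a b y0%:C = phi x0%:C by rewrite h2 clift_real.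
have [psi [k1 k2 k3 k4]] := lifting (clift_uniformly_strict a hb) (clift_conj a b)
  Qx0 (@square_star x0 r) (@square_bounded x0 r) erefl h3 h4 d0 dlow Fy0 erefl.
exists psi; split=> //.
  by move=> z Qz; rewrite iterSr k1 // h1.
apply: (lifting_twice_derivable k3 k1 _ (clift_cderiv a b) (dclift_cderiv b) h5).
by move=> z Qz; apply: (ncr z) => //; exact: k1.
Qed.

(** A logarithm H of psi - t, obtained as one more lifting, through exp: psi = t
    would force z = F^N(t), a real point left of the square. *)
Lemma log_inverse_branch N y0 t : iter N (rlift a b) y0 = x0 -> t < y0 ->
  iter N (rlift a b) t < x0 - r ->
  exists H, [/\ forall z, Q z -> iter N (clift a b) (t%:C + cexp (H z)) = z,
    H x0%:C = (ln (y0 - t))%:C,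
    loc_lipschitz Q H, real_on_reals Q H & twice_derivable U H].
Proof.
move=> /inverse_branch[psi [h1 h2 h3 h4 [dpsi h5]]] ty tx.
pose phi z := psi z - t%:C.
have phi0 z : Q z -> phi z != 0.
  move=> Qz; rewrite subr_eq0; apply/negP => /eqP e.
  have := h1 _ Qz; rewrite e iter_clift_real => ez; case: Qz; rewrite -ez /= => le_t _ _ _.
  by rewrite leNgt tx in le_t.
have phil : loc_lipschitz Q phi.
  case: h3 => L [eta [L0 eta0 H3]]; exists L, eta; split=> // z w Qz Qw zw.
  by rewrite /phi opprB addrA subrK H3.
have phir : real_on_reals Q phi.
  by move=> z Qz rz; rewrite /phi imD imN /= h4 // subr0.
have phid : twice_derivable U phi.
  exists dpsi => z /h5[D1 D2]; split=> //.
  by have := cderivB D1 (cderiv_cst t%:C z); rewrite subr0.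
have [d d0 dlow] := cexp_lower_bound xx yy phil phi0.
have Fy0 : cexp (ln (y0 - t))%:C = phi x0%:C.
  by rewrite cexp_real lnK ?posrE ?subr_gt0 // /phi h2 rmorphB.
have [H [k1 k2 k3 k4]] := lifting (@cexp_uniformly_strict R) (@cexp_conj R)
  Qx0 (@square_star x0 r) (@square_bounded x0 r) erefl phil phir d0 dlow Fy0 erefl.
exists H; split=> //.
  by move=> z Qz; rewrite k1 // /phi addrC subrK h1.
apply: (lifting_twice_derivable k3 k1 _ (@cexp_cderiv R) _ phid).
  by move=> z _; exact: cexp_neq0.
by move=> w; exists (cexp w); exact: cexp_cderiv.
Qed.

End Square.
End BranchDerivatives.

(** * The lift on the real line *)

Section RealLift.
Variable R : realType.
Implicit Types (a b x y : R).

Lemma sin_lt_id x : 0 < x -> `|sin x| < x.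
Proof.
move=> x0; have [x2|x2] := leP 2 x.
  by rewrite (le_lt_trans (sin_max x)) //; lra.
have sx : 0 < sin x by apply: sin2_gt0; rewrite x0 x2.
rewrite gtr0_norm //.
have cs : {within `[0, x], continuous (@sin R)}.
  by apply: continuous_subspaceT; exact: continuous_sin.
have [c] := MVT x0 (fun y _ => is_derive_sin y) cs.
rewrite sin0 !subr0 in_itv /= => /andP[c0 cx] ->.
rewrite gtr_pMl // -[ltRHS](@cos0 R).
have pi2 := @pi_ge2 R.
by rewrite ltr_cos // in_itv /=; apply/andP; split; lra.
Qed.

Lemma sin_lip x y : `|sin x - sin y| <= `|x - y|.
Proof.
have [->|xy] := eqVneq x y; first by rewrite !subrr.
wlog lt_xy : x y xy / y < x.
  move=> H; have [|yx] := ltP y x; first exact: H.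
  by rewrite distrC [leRHS]distrC H // ?lt_neqAle ?xy // eq_sym.
have cs : {within `[y, x], continuous (@sin R)}.
  by apply: continuous_subspaceT; exact: continuous_sin.
have [c _ ->] := MVT lt_xy (fun y _ => is_derive_sin y) cs.
by rewrite normrM ler_piMl // cos_max.
Qed.

(** Strictness matters for b = 1, where F' vanishes at odd multiples of pi and F
    is increasing nonetheless. *)
Lemma sin_diff_gt x y : x < y -> - (y - x) < sin y - sin x.
Proof.
move=> xy; pose h := (y - x) / 2; pose m := (x + y) / 2.
have -> : sin y - sin x = 2 * (cos m * sin h).
  have -> : y = m + h by rewrite /m /h; field.
  have -> : sin x = sin (m - h) by congr sin; rewrite /m /h; field.
  by rewrite sinD sinB; ring.
have h0 : 0 < h by rewrite divr_gt0 // subr_gt0.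
have : `|cos m * sin h| < h.
  rewrite normrM (le_lt_trans _ (sin_lt_id h0)) // ler_piMl // cos_max //.
rewrite ltr_norml => /andP[h1 _].
have -> : y - x = 2 * h by rewrite /h; field.
lra.
Qed.

Section Monotone.
Variables (a b : R).
Hypothesis hb : 0 <= b <= 1.

Lemma rlift_lt x y : x < y -> rlift a b x < rlift a b y.
Proof.
move=> xy; case/andP: hb => b0 b1; rewrite /rlift.
have h := sin_diff_gt xy.
have : - (y - x) <= b * (sin y - sin x).
  have [s0|s0] := leP 0 (sin y - sin x).
    by have := mulr_ge0 b0 s0; lra.
  have : sin y - sin x <= b * (sin y - sin x) by rewrite ler_nMl.
  lra.
have : b < 1 \/ b = 1 by move: b1; rewrite le_eqVlt => /predU1P[]; [right|left].
case=> [bl1|->]; last lra.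
have : - (y - x) < b * (sin y - sin x).
  have [s0|s0] := leP 0 (sin y - sin x).
    by have := mulr_ge0 b0 s0; lra.
  have : sin y - sin x <= b * (sin y - sin x) by rewrite ler_nMl.
  lra.
lra.
Qed.

Lemma iter_rlift_lt n x y : x < y -> iter n (rlift a b) x < iter n (rlift a b) y.
Proof. by move=> xy; elim: n => //= n IH; exact: rlift_lt. Qed.

Lemma iter_rlift_le n x y : x <= y -> iter n (rlift a b) x <= iter n (rlift a b) y.
Proof.
by rewrite le_eqVlt => /predU1P[->//|/(iter_rlift_lt n)/ltW].
Qed.

Lemma iter_rlift_inj n : injective (iter n (rlift a b)).
Proof.
move=> x y e; have [/(iter_rlift_lt n)|/(iter_rlift_lt n)|//] := ltgtP x y;
  by rewrite e ltxx.
Qed.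

Lemma iter_rlift_ltE n x y :
  (iter n (rlift a b) x < iter n (rlift a b) y) = (x < y).
Proof.
apply/idP/idP; last exact: iter_rlift_lt.
by apply: contraTT; rewrite -!leNgt; exact: iter_rlift_le.
Qed.

Lemma iter_rlift_leE n x y :
  (iter n (rlift a b) x <= iter n (rlift a b) y) = (x <= y).
Proof. by rewrite !leNgt iter_rlift_ltE. Qed.

Lemma rlift_lip x y : `|rlift a b x - rlift a b y| <= 4 * `|x - y|.
Proof.
case/andP: hb => b0 b1.
have -> : rlift a b x - rlift a b y = 2 * (x - y) + 2 * b * (sin x - sin y).
  by rewrite /rlift; ring.
rewrite (le_trans (ler_normD _ _)) // !normrM.
have h := sin_lip x y.
have hs := normr_ge0 (sin x - sin y).
rewrite (ger0_norm b0) (@ger0_norm _ 2) //.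
have : b * `|sin x - sin y| <= `|sin x - sin y| by rewrite ler_piMl.
lra.
Qed.

Lemma iter_rlift_lip n x y :
  `|iter n (rlift a b) x - iter n (rlift a b) y| <= 4 ^+ n * `|x - y|.
Proof.
elim: n => [|n IH]; first by rewrite expr0 mul1r.
by rewrite exprS -mulrA (le_trans (rlift_lip _ _)) // ler_pM2l.
Qed.

Lemma iter_rlift_continuous n : continuous (iter n (rlift a b)).
Proof.
move=> x; apply/cvgrPdist_lt => e e0.
apply/nbhs_ballP; exists (e / 4 ^+ n); first by rewrite /= divr_gt0 ?exprn_gt0.
move=> y; rewrite /ball /= => xy; rewrite (le_lt_trans (iter_rlift_lip _ _ _)) //.
by rewrite mulrC -ltr_pdivlMr // exprn_gt0.
Qed.

Lemma rlift_period x (k : int) :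
  rlift a b (x + k%:~R * (pi *+ 2)) = rlift a b x + (k *+ 2)%:~R * (pi *+ 2).
Proof. by apply: complexI; rewrite -clift_real rmorphD /= clift_period clift_real -rmorphD. Qed.

(** F^n doubles translations n times; this is the degree of g^n on the circle.
    *)
Lemma iter_rlift_period n x (k : int) : iter n (rlift a b) (x + k%:~R * (pi *+ 2)) =
  iter n (rlift a b) x + (k *+ (2 ^ n))%:~R * (pi *+ 2).
Proof.
elim: n x k => [|n IH] x k; first by rewrite expn0 mulr1n.
by rewrite !iterSr rlift_period IH -mulrnA expnS.
Qed.

Lemma iter_rlift_surj n x : exists y, iter n (rlift a b) y = x.
Proof.
have p0 : 0 < pi *+ 2 :> R by rewrite pmulrn_lgt0 ?pi_gt0.
pose c := iter n (rlift a b) 0.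
pose k := (Num.truncn (`|x - c| / (pi *+ 2))).+1.
have kx : `|x - c| < k%:R * (pi *+ 2) by rewrite -ltr_pdivrMr // truncnS_gt.
have k2 : k%:R * (pi *+ 2) <= (k%:Z *+ 2 ^ n)%:~R * (pi *+ 2) :> R.
  by rewrite ler_pM2r // rmorphMn /= -mulrnA ler_nat leq_pmulr // expn_gt0.
have k3 : (- k%:Z *+ 2 ^ n)%:~R = - (k%:Z *+ 2 ^ n)%:~R :> R.
  by rewrite mulNrn rmorphN.
have e1 := iter_rlift_period n 0 k%:Z; rewrite add0r -/c in e1.
have e2 := iter_rlift_period n 0 (- k%:Z); rewrite add0r -/c k3 in e2.
have kp : (- k%:Z)%:~R * (pi *+ 2) <= k%:Z%:~R * (pi *+ 2) :> R.
  by rewrite ler_pM2r // rmorphN ge0_cp // ler0z.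
have cF : {within `[(- k%:Z)%:~R * (pi *+ 2), k%:Z%:~R * (pi *+ 2)],
    continuous (iter n (rlift a b))}.
  by apply: continuous_subspaceT; exact: iter_rlift_continuous.
have [|y _ yx] := @IVT R (iter n (rlift a b)) _ _ x kp cF; last by exists y.
rewrite e1 e2; move: kx; rewrite ltr_norml => /andP[x1 x2].
by rewrite ge_min le_max; apply/andP; split; apply/orP; [left|right]; lra.
Qed.

End Monotone.
End RealLift.

(** * A maximum principle *)

Section MaximumPrinciple.
Variable R : realType.
Implicit Types (z w : R[i]) (x y : R) (K : R[i] -> R[i]).

Lemma second_derivative_test (u u' : R -> R) (m s : R) : 0 < s ->
  (forall t : R, `|t| < s -> is_derive t 1 u (u' t)) -> is_derive (0 : R) 1 u' m ->
  (forall t, `|t| < s -> u t <= u 0) -> m <= 0.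
Proof.
move=> s0 Du Du' umax.
have ns x : x \in `]-s, s[ -> `|x| < s by rewrite in_itv /= ltr_norml.
have u'0 : u' 0 = 0.
  have D0 : is_derive (0 : R) 1 u 0.
    apply: (@derive1_at_max R u (- s) s 0).
    - lra.
    - by move=> t /ns /Du [].
    - by rewrite in_itv /=; apply/andP; split; lra.
    - by move=> t /ns /umax.
  have [_ e1] := Du 0 ltac:(by rewrite normr0).
  by have [_ e2] := D0; rewrite -e1 e2.
rewrite leNgt; apply/negP => m0.
have [d d0 H] := is_derive_small Du' (divr_gt0 m0 (@ltr0n R 2)).
pose h := Num.min d s / 2; have h0 : 0 < h by rewrite divr_gt0 // lt_min d0.
have hd : h < d /\ h < s.
  have : Num.min d s <= d by rewrite ge_min lexx.
  have : Num.min d s <= s by rewrite ge_min lexx orbT.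
  have : 0 < Num.min d s by rewrite lt_min d0.
  by rewrite /h; split; lra.
have sub x : 0 <= x <= h -> `|x| < s.
  by move=> /andP[x0 xh]; rewrite ger0_norm //; lra.
have [c] : exists2 c, c \in `]0, h[ & u h - u 0 = u' c * (h - 0).
  apply: (MVT h0).
    move=> x; rewrite in_itv /= => /andP[x0 xh]; apply/Du/sub; lra.
  apply: derivable_within_continuous => x; rewrite in_itv /= => xh.
  by have [] := Du x (sub x xh).
rewrite in_itv /= => /andP[c0 ch] e.
have := umax h (sub h ltac:(lra)); rewrite -subr_le0 e subr0 pmulr_lle0 // => uc.
have := H c; rewrite add0r u'0 subr0 gtr0_norm // => /(_ ltac:(lra)).
rewrite ler_norml => /andP[h1 _].
have : 0 < m * c by rewrite mulr_gt0.
lra.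
Qed.

Lemma im_cderiv_line K d z (t : R) l : nrm d = 1 ->
  cderiv K (z + t%:C * d) l ->
  is_derive t 1 (fun s : R => im (K (z + s%:C * d))) (im (l * d)).
Proof.
move=> d1 Kl; apply: small_is_derive => e e0.
have [r r0 H] := Kl e e0; exists r => // h hr.
have hd : nrm (h%:C * d) = `|h| by rewrite nrmM nrm_real d1 mulr1.
have := H (h%:C * d); rewrite hd => /(_ hr); apply: le_trans.
rewrite (le_trans _ (absIm_le _)) //.
have -> : z + (t + h)%:C * d = z + t%:C * d + h%:C * d by rewrite rmorphD /=; ring.
have e1 : im (l * (h%:C * d)) = im (l * d) * h.
  by rewrite mulrCA; case: (l * d) => p q /=; ring.
by rewrite !imD !imN e1.
Qed.

(** The imaginary part u of K has u_xx = im K'' and u_yy = - im K''. Adding e (x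
    - x1)^2 makes the sum of the two second derivatives positive, which excludes
    an interior maximum; then e is taken small. *)
Lemma maximum_principle x1 x2 y1 y2 K : x1 < x2 -> y1 <= y2 ->
  let Q := rect x1 x2 y1 y2 in let U := open_rect x1 x2 y1 y2 in
  continuous_on Q (fun z => im (K z)) -> twice_derivable U K ->
  (forall z, Q z -> ~ U z -> im (K z) <= 0) ->
  forall z, Q z -> im (K z) <= 0.
Proof.
move=> x12 y12 Q U cK [dK HK] bd z1 Qz1; rewrite leNgt; apply/negP => k0.
pose e := im (K z1) / (2 * (x2 - x1) ^+ 2).
have xx0 : 0 < (x2 - x1) ^+ 2 by rewrite exprn_gt0 // subr_gt0.
have e0 : 0 < e by rewrite divr_gt0 // mulr_gt0.
have eE : e * (x2 - x1) ^+ 2 = im (K z1) / 2 by rewrite /e; field; lra.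
clearbody e.
pose v z := im (K z) + e * (re z - x1) ^+ 2.
have cv : continuous_on Q (fun z => - v z).
  move=> z Qz g g0; have [d1 d10 H1] := cK z Qz (g / 2) ltac:(by rewrite divr_gt0).
  pose c := g / 2 / (2 * e * (x2 - x1)).
  have c1 : 0 < 2 * e * (x2 - x1) by rewrite mulr_gt0 ?subr_gt0 // mulr_gt0.
  have c0 : 0 < c by rewrite !divr_gt0.
  exists (Num.min d1 c); first by rewrite lt_min d10.
  move=> w Qw; rewrite lt_min => /andP[wd wc].
  have -> : - v w - - v z = - (im (K w) - im (K z)) -
     (e * (re w - re z) * ((re w - x1) + (re z - x1))) by rewrite /v; ring.
  rewrite (le_lt_trans (ler_normB _ _)) // normrN [g]splitr ltrD //; first exact: H1.
  rewrite !normrM (gtr0_norm e0).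
  have h1 : `|re w - re z| < c.
    by rewrite (le_lt_trans _ wc) // -reN -reD absRe_le.
  have h2 : `|re w - x1 + (re z - x1)| <= 2 * (x2 - x1).
    case: Qw => ? ? _ _; case: Qz => ? ? _ _.
    by rewrite ger0_norm; lra.
  rewrite ltr_pdivlMr // in h1.
  apply: le_lt_trans h1; rewrite (_ : _ * (2 * e * _) =
    e * `|re w - re z| * (2 * (x2 - x1))); last by ring.
  by rewrite ler_wpM2l // mulr_ge0 // ltW.
have [c Qc cmin] := rect_EVT_min (ltW x12) y12 cv.
have vmax z : Q z -> v z <= v c by move=> /cmin; rewrite lerN2.
have Uc : U c.
  apply: contrapT => nU; have := vmax _ Qz1; have := bd _ Qc nU.
  have h1 : 0 <= e * (re z1 - x1) ^+ 2 by rewrite mulr_ge0 ?sqr_ge0 // ltW.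
  have h2 : e * (re c - x1) ^+ 2 <= e * (x2 - x1) ^+ 2.
    rewrite ler_pM2l // ler_sqr ?nnegrE; case: Qc => ? ? _ _; lra.
  rewrite /v; lra.
have [r r0 Ur] := open_rect_nbhs Uc.
have Uline (d : R[i]) (t : R) : nrm d = 1 -> `|t| < r -> U (c + t%:C * d).
  by move=> d1 tr; apply: Ur; rewrite [c + _]addrC addrK nrmM nrm_real d1 mulr1.
have [_ [m Hm]] := HK _ Uc.
have c0E (d : R[i]) : c + 0%:C * d = c by rewrite rmorph0 mul0r addr0.
have A1 : im m + 2 * e <= 0.
  pose q (t : R) := e * (re c + t - x1) ^+ 2.
  pose q' (t : R) := 2 * e * (re c + t - x1).
  have Dq (t : R) : is_derive t 1 q (q' t).
    apply: small_is_derive => g g0; exists (g / e); first by rewrite divr_gt0.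
    move=> h hg; rewrite /q /q'.
    have -> : e * (re c + (t + h) - x1) ^+ 2 - e * (re c + t - x1) ^+ 2 -
      2 * e * (re c + t - x1) * h = (e * h) * h by ring.
    rewrite !normrM (gtr0_norm e0) ler_wpM2r // mulrC -ler_pdivlMr //.
    exact: ltW.
  have Dq' : is_derive (0 : R) 1 q' (2 * e).
    apply: small_is_derive => g g0; exists 1 => // h _; rewrite /q'.
    have -> : 2 * e * (re c + (0 + h) - x1) - 2 * e * (re c + 0 - x1) - 2 * e * h = 0.
      by ring.
    by rewrite normr0 mulr_ge0 // ltW.
  pose u (t : R) := im (K (c + t%:C * 1)) + q t.
  pose u' (t : R) := im (dK (c + t%:C * 1) * 1) + q' t.
  apply: (@second_derivative_test u u' _ r) => //.
  - move=> t tr; have D1 := im_cderiv_line (@nrm1 R) (HK _ (Uline 1 t (@nrm1 R) tr)).1.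
    exact: (@is_deriveD _ _ _ _ _ _ _ _ _ D1 (Dq t)).
  - have Hm1 : cderiv (fun z => dK z * 1) (c + 0%:C * 1) m.
      by rewrite c0E; apply: cderiv_ext Hm => w; rewrite mulr1.
    have D1 := im_cderiv_line (@nrm1 R) Hm1; rewrite mulr1 in D1.
    exact: (@is_deriveD _ _ _ _ _ _ _ _ _ D1 Dq').
  - move=> t tr; have := vmax _ (open_rect_sub (Uline 1 t (@nrm1 R) tr)).
    by rewrite /u /q /v !reimE c0E /= !mulr0 !mulr1 !subr0 addr0; lra.
have A2 : - im m <= 0.
  pose u (t : R) := im (K (c + t%:C * 'i)).
  pose u' (t : R) := im (dK (c + t%:C * 'i) * 'i).
  have -> : - im m = im (m * 'i * 'i) by rewrite -mulrA mulii mulrN1 imN.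
  apply: (@second_derivative_test u u' _ r) => //.
  - move=> t tr; apply: im_cderiv_line; rewrite ?nrm_i //.
    by apply: (HK _ (Uline _ _ _ tr)).1; rewrite nrm_i.
  - rewrite /u'; apply: (@im_cderiv_line (fun z => dK z * 'i)); rewrite ?nrm_i // c0E.
    by have := cderivM Hm (cderiv_cst 'i c); rewrite mulr0 addr0.
  - move=> t tr; have := vmax _ (open_rect_sub (Uline 'i t (@nrm_i R) tr)).
    by rewrite /u /v !reimE c0E /= !mulr0 !mul0r subr0 !addr0; lra.
lra.
Qed.

End MaximumPrinciple.

(** * Distortion of inverse branches *)

Section LogBranch.
Variable R : realType.
Implicit Types (z w : R[i]) (a b x y : R) (H : R[i] -> R[i]).

Lemma loc_lipschitz_segment (Q : set R[i]) H z0 v : loc_lipschitz Q H ->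
  (forall s : R, 0 <= s <= 1 -> Q (z0 + s%:C * v)) ->
  {within `[0, 1], continuous (fun s : R => `|im (H (z0 + s%:C * v))|)}.
Proof.
move=> [L [eta [L0 eta0 HL]]] Qs.
apply/subspace_continuousP => s; rewrite /= in_itv /= => s01.
apply/cvgrPdist_lt => e e0.
pose m := Num.min eta (e / L) / (nrm v + 1).
have m0 : 0 < m by rewrite divr_gt0 // ?lt_min ?eta0 ?divr_gt0 // ltr_wpDl ?nrm_ge0.
rewrite near_withinE; apply/nbhs_ballP; exists m => // t.
rewrite /ball /= in_itv /= => st t01.
have dE : nrm (z0 + s%:C * v - (z0 + t%:C * v)) < Num.min eta (e / L).
  have -> : z0 + s%:C * v - (z0 + t%:C * v) = (s - t)%:C * v.
    by rewrite rmorphB /=; ring.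
  rewrite nrmM nrm_real; move: st.
  rewrite ltr_pdivlMr ?ltr_wpDl ?nrm_ge0 //; apply: le_lt_trans.
  by rewrite ler_wpM2l // lerDl.
rewrite lt_min in dE; case/andP: dE => d1 d2.
rewrite (le_lt_trans (ler_dist_dist _ _)) // -imN -imD.
rewrite (le_lt_trans (absIm_le _)) // (le_lt_trans (HL _ _ (Qs _ s01) (Qs _ t01) d1)) //.
by rewrite mulrC -ltr_pdivlMr.
Qed.

Section Square.
Variables (a b x0 r : R).
Hypothesis hb : 0 <= b <= 1.
Hypothesis r0 : 0 < r.
Let Q := square x0 r.
Let U := open_rect (x0 - r) (x0 + r) (- r) r.

(** If |im H| reached pi somewhere on the segment from x0 to z, psi - t would be
    a negative real there; but psi is real only over real points, and there it
    is greater than t. *)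
Lemma log_im_bound N t H :
  (forall z, Q z -> iter N (clift a b) (t%:C + cexp (H z)) = z) ->
  im (H x0%:C) = 0 -> loc_lipschitz Q H -> iter N (rlift a b) t < x0 - r ->
  forall z, Q z -> `|im (H z)| < pi.
Proof.
move=> HE H0 Hl tx z Qz; rewrite ltNge; apply/negP => piz.
have Qs (s : R) : 0 <= s <= 1 -> Q (x0%:C + s%:C * (z - x0%:C)) by exact: square_star.
have cg := loc_lipschitz_segment Hl Qs.
have [|s] := @IVT R _ 0 1 pi ler01 cg.
  rewrite rmorph0 mul0r addr0 H0 normr0 rmorph1 mul1r addrC subrK.
  by rewrite ge_min le_max pi_ge0 piz orbT.
rewrite in_itv /= => /Qs Qw.
set w := x0%:C + _ in Qw * => impi.
have cosE : cos (im (H w)) = -1 by rewrite -cos_norm impi cospi.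
have sinE : sin (im (H w)) = 0 by apply: cos1sin0; rewrite cosE normrN1.
have wE : cexp (H w) = (- expR (re (H w)))%:C.
  by rewrite /cexp cosE sinE; complex_ext; ring.
have := HE _ Qw; rewrite wE -rmorphD /= iter_clift_real => ew.
have := iter_rlift_lt a hb N (_ : t - expR (re (H w)) < t).
rewrite gtrBl expR_gt0 => /(_ erefl) lt_t.
case: Qw => h1 _ _ _; rewrite -ew /= in h1.
by have := le_lt_trans h1 (lt_trans lt_t tx); rewrite ltxx.
Qed.

(** On the upper half of the square of half-side p = r/2 around x, im H vanishes
    on the axis and is less than pi elsewhere. It is compared with the harmonic
    function pi (2Y + X^2 - Y^2), where X = (re z - x)/p and Y = im z/p, which
    is nonnegative on the axis, at least pi on the three other sides, and has
    normal derivative 2 pi/p at x. *)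
Lemma log_derivative_bound N t H dH :
  (forall z, Q z -> iter N (clift a b) (t%:C + cexp (H z)) = z) ->
  im (H x0%:C) = 0 -> loc_lipschitz Q H -> real_on_reals Q H ->
  iter N (rlift a b) t < x0 - r ->
  (forall z, U z -> cderiv H z (dH z) /\ exists m, cderiv dH z m) ->
  forall x, x0 - r / 2 <= x <= x0 + r / 2 -> re (dH x%:C) <= 4 * pi / r.
Proof.
move=> HE H0 Hl Hr tx HdH x /andP[xl xr].
have Hpi := log_im_bound HE H0 Hl tx.
have pi0 := @pi_gt0 R.
pose p := r / 2; have p0 : 0 < p by rewrite divr_gt0.
have rp : r = 2 * p by rewrite /p; field.
(* The imaginary part of B is the comparison function. *)
pose B z := (2 * pi / p)%:C * (z - x%:C) +
   (pi / p ^+ 2)%:C * ('i * (z - x%:C) * (z - x%:C)).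
pose K z := H z - B z.
have imK z : im (K z) = im (H z) - (2 * pi / p * im z +
   pi / p ^+ 2 * ((re z - x) ^+ 2 - im z ^+ 2)).
  by rewrite /K /B; case: (H z) => q1 q2; case: z => z1 z2 /=; ring.
pose Q' := rect (x - p) (x + p) 0 p.
pose U' := open_rect (x - p) (x + p) 0 p.
have Q'Q : Q' `<=` Q.
  by move=> z [h1 h2 h3 h4]; split; lra.
have U'U : U' `<=` U.
  by move=> z [h1 h2 h3 h4]; split; lra.
have xp : x - p < x + p by lra.
have cK : continuous_on Q' (fun z => im (K z)).
  have dB z : exists m, cderiv B z m.
    have D1 : cderiv (fun z => z - x%:C) z (1 - 0).
      by apply: cderivB; [exact: cderiv_id|exact: cderiv_cst].
    eexists; apply: cderivD; first by apply: cderivZ; exact: D1.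
    by apply: cderivZ; apply: (cderivM _ D1); apply: cderivZ; exact: D1.
  move=> z Qz e e0; have e2 : 0 < e / 2 by rewrite divr_gt0.
  case: (Hl) => L [eta [L0 eta0 HL]]; have [m Hm] := dB z.
  have [d1 d10 H1] := cderiv_cont Hm e2.
  exists (Num.min d1 (Num.min eta (e / 2 / L))).
    by rewrite !lt_min d10 eta0 divr_gt0.
  move=> w Qw; rewrite !lt_min => /and3P[h1 h2 h3].
  rewrite -imN -imD (le_lt_trans (absIm_le _)) // /K.
  rewrite (_ : H w - B w - (H z - B z) = (H w - H z) - (B w - B z)); last by ring.
  rewrite (le_lt_trans (nrmD _ _)) // nrmN [e]splitr ltrD //; last exact: H1.
  rewrite (le_lt_trans (HL _ _ (Q'Q _ Qw) (Q'Q _ Qz) h2)) //.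
  by rewrite mulrC -ltr_pdivlMr.
have dK : twice_derivable U' K.
  exists (fun z => dH z - ((2 * pi / p)%:C * (1 - 0) +
   (pi / p ^+ 2)%:C * ('i * (1 - 0) * (z - x%:C) + 'i * (z - x%:C) * (1 - 0)))).
  move=> z /U'U /HdH[D1 [m D2]].
  have D0 : cderiv (fun z => z - x%:C) z (1 - 0).
    by apply: cderivB; [exact: cderiv_id|exact: cderiv_cst].
  split.
    apply: cderivB => //; apply: cderivD; first by apply: cderivZ; exact: D0.
    by apply: cderivZ; apply: (cderivM _ D0); apply: cderivZ; exact: D0.
  eexists; apply: (cderivB D2 _); apply: cderivD; first exact: cderiv_cst.
  apply: cderivZ; apply: cderivD.
    by apply: cderivZ; exact: D0.
  by apply: (cderivM _ (cderiv_cst _ _)); apply: cderivZ; exact: D0.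
have bd z : Q' z -> ~ U' z -> im (K z) <= 0.
  move=> Q'z nU; rewrite imK subr_le0.
  case: (Q'z) => h1 h2 h3 h4.
  have Hz := Hpi _ (Q'Q _ Q'z); rewrite ltr_norml in Hz; case/andP: Hz => _ Hz.
  pose X := (re z - x) / p; pose Y := im z / p.
  have Y0 : 0 <= Y by rewrite divr_ge0 // ltW.
  have Y1 : Y <= 1 by rewrite ler_pdivrMr // mul1r.
  have -> : 2 * pi / p * im z + pi / p ^+ 2 * ((re z - x) ^+ 2 - im z ^+ 2) =
     pi * (2 * Y + X ^+ 2 - Y ^+ 2) by rewrite /X /Y; field; rewrite gt_eqF.
  have [im0|im0] := eqVneq (im z) 0.
    rewrite (Hr _ (Q'Q _ Q'z) im0) mulr_ge0 ?pi_ge0 // /Y im0 mul0r.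
    by rewrite mulr0 add0r expr0n /= subr0 sqr_ge0.
  apply: le_trans (ltW Hz) _; rewrite ler_peMr ?pi_ge0 //.
  have YY : Y ^+ 2 <= Y by rewrite expr2 ler_piMl.
  have XX := sqr_ge0 X.
  have : X ^+ 2 = 1 \/ Y = 1.
    apply: contrapT => /not_orP[nX nY]; apply: nU; split.
    - rewrite lt_def h1 andbT; apply/eqP => e; apply: nX.
      by rewrite /X e; field; rewrite gt_eqF.
    - rewrite lt_def h2 andbT; apply/eqP => e; apply: nX.
      by rewrite /X -e; field; rewrite gt_eqF.
    - by rewrite lt_def im0 h3.
    - rewrite lt_def h4 andbT; apply/eqP => e; apply: nY.
      by rewrite /Y -e divff // gt_eqF.
  case=> e; first by rewrite e; lra.
  by rewrite e expr1n; lra.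
have KQ := maximum_principle xp (ltW p0) cK dK bd.
have Ux : U x%:C by split=> /=; lra.
have [D _] := HdH _ Ux.
have Qx : Q x%:C by exact: open_rect_sub.
have Hx0 : im (H x%:C) = 0 by exact: Hr.
rewrite leNgt; apply/negP => lt_d.
(* A larger derivative would push im H above the comparison function at x + iy
   for small y. *)
pose e := re (dH x%:C) - 4 * pi / r; have e0 : 0 < e by rewrite subr_gt0.
have [d d0 Hd] := D (e / 2) ltac:(by rewrite divr_gt0).
pose y := Num.min d p / 2.
have [yd yp y0] : [/\ y < d, y <= p & 0 < y].
  have : Num.min d p <= d by rewrite ge_min lexx.
  have : Num.min d p <= p by rewrite ge_min lexx orbT.
  have : 0 < Num.min d p by rewrite lt_min d0.
  by rewrite /y; split; lra.
have Qy : Q' (x%:C + 'i * y%:C) by split; rewrite !reimE /=; lra.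
have := KQ _ Qy; rewrite imK.
have := Hd ('i * y%:C); rewrite nrmM nrm_i mul1r nrm_real gtr0_norm // => /(_ yd).
move=> /(le_trans (absIm_le _)); rewrite !imD !imN Hx0.
have -> : im (dH x%:C * ('i * y%:C)) = re (dH x%:C) * y.
  by case: (dH x%:C) => q1 q2 /=; ring.
rewrite ler_norml => /andP[h1 _].
rewrite subr_le0 !reimE /= => h2.
have h3 : 0 <= pi / p ^+ 2 * y ^+ 2.
  by rewrite mulr_ge0 ?sqr_ge0 // divr_ge0 ?pi_ge0 // ltW // exprn_gt0.
have h4 : 2 * pi / p * y = (4 * pi / r) * y by rewrite rp; field; rewrite gt_eqF.
have h5 : 0 < e * y by rewrite mulr_gt0.
have h6 : e * y = re (dH x%:C) * y - 4 * pi / r * y by rewrite /e mulrBl.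
have h7 : im (H (x%:C + 'i * y%:C)) <= 4 * pi / r * y.
  apply: le_trans h2 _; rewrite -h4.
  rewrite (_ : (_ + _ - x) ^+ 2 - _ = - y ^+ 2); last by ring.
  rewrite (_ : 0 + _ = y); last by ring.
  by rewrite mulrN gerDl oppr_le0.
lra.
Qed.

End Square.
End LogBranch.

Section RealDistortion.
Variable R : realType.
Implicit Types (z w : R[i]) (a b x y r : R) (H : R[i] -> R[i]).

Lemma re_cderiv_real H x l : cderiv H x%:C l ->
  is_derive x 1 (fun t : R => re (H t%:C)) (re l).
Proof.
move=> Hl; apply: small_is_derive => e e0.
have [d d0 Hd] := Hl e e0; exists d => // h hd.
have := Hd h%:C; rewrite nrm_real => /(_ hd); apply: le_trans.
rewrite (le_trans _ (absRe_le _)) // -rmorphD /= !reD !reN.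
by rewrite (_ : re (l * h%:C) = re l * h) //; case: (l) => p q /=; ring.
Qed.

(** The bound on the derivative of log (psi - t), integrated from F^N y1 to F^N
    y2. Only distances to a point t whose image lies left of the square are
    compared, so there is no loss with N. *)
Lemma distortion_left a b x0 r N t y1 y2 : 0 <= b <= 1 -> 0 < r ->
  no_critical_orbit a b (square x0 r) ->
  iter N (rlift a b) t < x0 - r -> x0 - r / 2 <= iter N (rlift a b) y1 ->
  y1 <= y2 -> iter N (rlift a b) y2 <= x0 + r / 2 ->
  y2 - t <= expR (4 * pi / r * (iter N (rlift a b) y2 - iter N (rlift a b) y1)) * (y1 - t).
Proof.
move=> hb r0 nocrit tx x1l; rewrite le_eqVlt => /predU1P[-> _|y12 x2r].
  by rewrite subrr mulr0 expR0 mul1r.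
have x12 := iter_rlift_lt a hb N y12.
have [y0 y0E] := iter_rlift_surj a hb N x0.
have ty0 : t < y0 by rewrite -(iter_rlift_ltE a hb N) y0E; lra.
have [H [HE H0 Hl Hr [dH HdH]]] := log_inverse_branch hb r0 nocrit y0E ty0 tx.
have H0' : im (H x0%:C) = 0 by rewrite H0.
have bound := log_derivative_bound hb r0 HE H0' Hl Hr tx HdH.
have Qx x : x0 - r / 2 <= x <= x0 + r / 2 -> square x0 r x%:C.
  by move=> /andP[? ?]; split=> /=; lra.
have val y : x0 - r / 2 <= iter N (rlift a b) y <= x0 + r / 2 ->
    y - t = expR (re (H (iter N (rlift a b) y)%:C)).
  move=> /Qx Qy; have := HE _ Qy.
  have := Hr _ Qy erefl; set w := H _ => rw.
  rewrite (complex_split w) rw complexr0 cexp_real -rmorphD /= iter_clift_real.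
  by move=> /complexI /(iter_rlift_inj hb) <-; rewrite addrC addKr.
set x1 := iter N (rlift a b) y1 in x1l x12 *.
set x2 := iter N (rlift a b) y2 in x2r x12 *.
rewrite (val y1) ?(val y2) -/x1 -/x2; try (apply/andP; split; lra).
rewrite -expRD ler_expR.
have D x : x \in `[x1, x2] -> is_derive x 1 (fun t : R => re (H t%:C)) (re (dH x%:C)).
  rewrite in_itv /= => /andP[? ?]; apply: re_cderiv_real.
  by have [] := HdH x%:C; first by split=> /=; lra.
have [c] := @MVT R (fun t : R => re (H t%:C)) (fun x => re (dH x%:C)) x1 x2 x12
  (fun x xin => D x (subset_itv_oo_cc xin)) ltac:(by apply: derivable_within_continuous => x /D []).
rewrite in_itv /= => /andP[c1 c2] e.
rewrite -lerBlDr e ler_wpM2r ?subr_ge0 ?(ltW x12) //.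
by apply: bound; apply/andP; split; lra.
Qed.

Lemma iter_rlift_opp a b n x : iter n (rlift (- a) b) (- x) = - iter n (rlift a b) x.
Proof.
elim: n => //= n ->; apply: complexI.
by rewrite -clift_real rmorphN /= clift_opp clift_real rmorphN.
Qed.

Lemma iter_clift_opp a b n w : iter n (clift (- a) b) (- w) = - iter n (clift a b) w.
Proof. by elim: n => //= n ->; rewrite clift_opp. Qed.

(** The mirror image under x -> -x, which replaces a by -a. *)
Lemma distortion_right a b x0 r N s y1 y2 : 0 <= b <= 1 -> 0 < r ->
  no_critical_orbit a b (square x0 r) ->
  x0 + r < iter N (rlift a b) s -> x0 - r / 2 <= iter N (rlift a b) y1 ->
  y1 <= y2 -> iter N (rlift a b) y2 <= x0 + r / 2 ->
  s - y1 <= expR (4 * pi / r * (iter N (rlift a b) y2 - iter N (rlift a b) y1)) * (s - y2).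
Proof.
move=> hb r0 nocrit sx x1l y12 x2r.
have nocrit' : no_critical_orbit (- a) b (square (- x0) r).
  move=> c n dc; rewrite -[c]opprK iter_clift_opp; set z := iter _ _ _ => Qz.
  have : square x0 r z.
    by case: Qz; rewrite /square /rect /= reN imN => h1 h2 h3 h4; split; lra.
  by apply: nocrit; rewrite dclift_opp.
have := @distortion_left (- a) b (- x0) r N (- s) (- y2) (- y1) hb r0 nocrit'.
rewrite !iter_rlift_opp => /(_ ltac:(lra) ltac:(lra) ltac:(lra) ltac:(lra)).
by rewrite !opprK ![- _ + _]addrC.
Qed.

(** Take t = y - 2 pi: its image is at least 2 pi left of F^N y, outside the
    square. *)
Lemma inverse_branch_contraction a b x0 r N y y' : 0 <= b <= 1 ->
  0 < r -> r < pi *+ 2 -> no_critical_orbit a b (square x0 r) ->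
  iter N (rlift a b) y = x0 -> `|iter N (rlift a b) y' - x0| <= r / 2 ->
  `|y' - y| <= (expR (4 * pi / r * `|iter N (rlift a b) y' - x0|) - 1) * (pi *+ 2).
Proof.
move=> hb r0 r2 nocrit yE y'r.
have p0 : 0 < pi *+ 2 :> R by rewrite pmulrn_lgt0 ?pi_gt0.
(* Translating y by -2 pi translates F^N y by -2^N 2 pi. *)
have tx : iter N (rlift a b) (y - pi *+ 2) < x0 - r.
  have := iter_rlift_period a b N y (-1); rewrite mulN1r => ->.
  rewrite yE ltrD2l mulNrn rmorphN /= mulNr ltrN2 (lt_le_trans r2) //.
  by rewrite ler_peMl ?(ltW p0) // rmorphMn rmorph1 ler1n expn_gt0.
have [yy|yy] := leP y y'.
  have xx := iter_rlift_le a hb N yy; rewrite yE in xx.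
  rewrite !ger0_norm ?subr_ge0 // in y'r *.
  have := @distortion_left a b x0 r N (y - pi *+ 2) y y' hb r0 nocrit tx.
  rewrite yE => /(_ ltac:(lra) yy ltac:(lra)).
  rewrite opprB [y + _]addrC subrK mulrBl mul1r; lra.
have xx := iter_rlift_lt a hb N yy; rewrite yE in xx.
rewrite !ltr0_norm ?subr_lt0 // !opprB in y'r *.
have := @distortion_left a b x0 r N (y - pi *+ 2) y' y hb r0 nocrit tx.
rewrite yE => /(_ ltac:(lra) (ltW yy) ltac:(lra)).
set e := expR _; have e1 : 1 <= e.
  by rewrite -expR0 ler_expR mulr_ge0 ?subr_ge0 ?(ltW xx) // divr_ge0 ?(ltW r0) // mulr_ge0 // pi_ge0.
have : 0 <= (e - 1) * (y - y') by rewrite mulr_ge0 ?subr_ge0 // ltW.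
rewrite !mulrBr !mulrBl; lra.
Qed.

End RealDistortion.

(** * The basin of an attracting cycle, lifted to the plane *)

Section LiftedBasin.
Variable R : realType.
Implicit Types (z w u v : R[i]) (x y : R) (k : int) (n j i : nat).

Let twopi_gt0 : 0 < pi *+ 2 :> R.
Proof. by rewrite pmulrn_lgt0 ?pi_gt0. Qed.

Lemma perD k k' : per (k + k') = per k + per k' :> R.
Proof. by rewrite rmorphD mulrDl. Qed.

Lemma perN k : per (- k) = - per k :> R.
Proof. by rewrite rmorphN mulNr. Qed.

Lemma perB k k' : per (k - k') = per k - per k' :> R.
Proof. by rewrite perD perN. Qed.

Lemma per0 : per 0 = 0 :> R.
Proof. by rewrite mulr0z mul0r. Qed.

Lemma per_small k : `|per k : R| < pi *+ 2 -> k = 0.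
Proof.
rewrite normrM (gtr0_norm twopi_gt0) -[ltRHS]mul1r ltr_pM2r //.
by rewrite -intr_norm -[1]/(1%:~R) ltr_int => h; lia.
Qed.

Lemma iter_clift_period a b n w k : iter n (clift a b) (w + (per k)%:C) =
  iter n (clift a b) w + (per (k *+ 2 ^ n))%:C.
Proof.
elim: n w k => [|n IH] w k; first by rewrite expn0 mulr1n.
by rewrite !iterSr clift_period IH -mulrnA expnS.
Qed.

Lemma iter_clift_conj a b n w : iter n (clift a b) w^* = (iter n (clift a b) w)^*.
Proof. by elim: n => //= n ->; rewrite clift_conj. Qed.

Lemma iter_clift_cderiv a b n w : exists l, cderiv (iter n (clift a b)) w l.
Proof.
elim: n => [|n [l IH]]; first by exists 1; exact: cderiv_id.
by eexists; apply: (cderiv_comp IH (clift_cderiv _ _ _)).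
Qed.

Lemma iter_clift_cont a b n w (e : R) : 0 < e -> exists2 d : R, 0 < d &
  forall u, nrm (u - w) < d -> nrm (iter n (clift a b) u - iter n (clift a b) w) < e.
Proof. by have [l /cderiv_cont] := iter_clift_cderiv a b n w; apply. Qed.

Lemma exists_uniform_pos (P : nat -> R -> Prop) n :
  (forall i, (i < n)%N -> exists2 d : R, 0 < d & P i d) ->
  (forall i d d', 0 < d' -> d' <= d -> P i d -> P i d') ->
  exists2 d : R, 0 < d & forall i, (i < n)%N -> P i d.
Proof.
elim: n => [|n IH] H mono; first by exists 1.
have [d d0 Hd] := IH (fun i h => H i (ltnW h)) mono.
have [d' d'0 Hd'] := H n (ltnSn n).
exists (Num.min d d'); first by rewrite lt_min d0.
move=> i; rewrite ltnS leq_eqVlt => /predU1P[->|/Hd].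
  by apply: mono Hd'; rewrite ?lt_min ?d0 // ge_min lexx orbT.
by apply: mono; rewrite ?lt_min ?d0 // ge_min lexx.
Qed.

Lemma geometric_small (q c e : R) : 0 <= q < 1 -> 0 < e -> exists n, forall j,
  (n <= j)%N -> q ^+ j * c < e.
Proof.
move=> /andP[q0 q1] e0.
have /cvgrPdist_lt /(_ e e0) [n _ Hn] : geometric c q @ \oo --> (0 : R).
  by apply: cvg_geometric; rewrite ger0_norm.
exists n => j nj; have := Hn j nj; rewrite sub0r normrN /geometric /= mulrC.
exact/le_lt_trans/ler_norm.
Qed.

(** A lift e of a point of the cycle, which F^p translates by 2 pi m, with a
    disc of radius delta around e contracted by F^p. The condition
    [al_delta_small] is chosen for [trapped_same_fibre]: F is 4-Lipschitz on the
    line, so two points of the disc stay within 2 pi of each other for a whole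
    period. *)
Record attracting_lift (a b e kappa delta : R) (p : nat) (m : int) : Prop := {
  al_b01 : 0 <= b <= 1;
  al_period_gt0 : (0 < p)%N;
  al_periodic : iter p (rlift a b) e = e + per m;
  al_kappa01 : 0 <= kappa < 1;
  al_delta_gt0 : 0 < delta;
  al_delta_small : 4 ^+ p * (delta *+ 2) <= pi;
  al_contraction : forall w, nrm (w - e%:C) < delta ->
    nrm (iter p (clift a b) w - (e + per m)%:C) <= kappa * nrm (w - e%:C) }.

Variables (a b e kappa delta : R) (p : nat) (m : int).
Hypothesis attr : attracting_lift a b e kappa delta p m.
Let F := clift a b.
Let f := rlift a b.
Let p_gt0 : (0 < p)%N. Proof. by case: attr. Qed.
Let e_periodic : iter p f e = e + per m. Proof. by case: attr. Qed.
Let kappa01 : 0 <= kappa < 1. Proof. by case: attr. Qed.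
Let contraction w : nrm (w - e%:C) < delta ->
  nrm (iter p F w - (e + per m)%:C) <= kappa * nrm (w - e%:C).
Proof. by case: attr => *; auto. Qed.

(** A point belongs to the basin exactly when its orbit enters one of the
    contracted discs; see [basin_cexpP]. *)
Definition lifted_basin w := exists n k, nrm (iter n F w - (e + per k)%:C) < delta.

Definition lifted_cycle x := exists i k, x = iter i f e + per k.

Lemma trap w k : nrm (w - (e + per k)%:C) < delta ->
  nrm (iter p F w - (e + per (m + k *+ 2 ^ p))%:C) <= kappa * nrm (w - (e + per k)%:C).
Proof.
have wE : w - (e + per k)%:C = w - (per k)%:C - e%:C by rewrite rmorphD /=; ring.
rewrite wE => h; have := contraction h.
have -> : iter p F w = iter p F (w - (per k)%:C) + (per (k *+ 2 ^ p))%:C.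
  by rewrite -iter_clift_period subrK.
by congr (nrm _ <= _); rewrite perD !rmorphD /=; ring.
Qed.

Lemma kappa_lt1 x : 0 <= x -> kappa * x <= x.
Proof. by move=> x0; case/andP: kappa01 => k0 k1; rewrite ler_piMl // ltW. Qed.

(** The translation k' is the same for all points of the disc; two trapped
    points therefore stay close in the plane, and not just modulo 2 pi. *)
Lemma trap_iter k j : exists k', forall w, nrm (w - (e + per k)%:C) < delta ->
  nrm (iter (p * j) F w - (e + per k')%:C) <= kappa ^+ j * nrm (w - (e + per k)%:C).
Proof.
elim: j => [|j [k' IH]].
  by exists k => w _; rewrite muln0 expr0 mul1r.
exists (m + k' *+ 2 ^ p) => w h.
have h' : nrm (iter (p * j) F w - (e + per k')%:C) < delta.
  apply: le_lt_trans (IH _ h) _; apply: le_lt_trans _ h.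
  case/andP: kappa01 => k0 k1.
  by rewrite ler_piMl ?nrm_ge0 // exprn_ile1 // ltW.
rewrite mulnS iterD (le_trans (trap h')) //.
by rewrite exprS -mulrA ler_wpM2l ?IH //; case/andP: kappa01.
Qed.

Lemma lifted_basin_iter n w : lifted_basin w <-> lifted_basin (iter n F w).
Proof.
split; last first.
  by case=> j [k H]; exists (j + n)%N, k; rewrite iterD.
case=> j [k]; elim: n j k w => [|n IH] j k w H; first by exists j, k.
rewrite iterSr; case: j H => [|j] H; last by apply: (IH j k); rewrite -iterSr.
have h := trap H; have := p_gt0; case E: p h => [//|q] h _.
apply: (IH q (m + k *+ 2 ^ p)); rewrite -iterSr.
rewrite -E in h; rewrite -E; apply: le_lt_trans h _.
exact: le_lt_trans (kappa_lt1 (nrm_ge0 _)) H.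
Qed.

Lemma lifted_basin_period k w : lifted_basin (w + (per k)%:C) <-> lifted_basin w.
Proof.
have H k' v : lifted_basin v -> lifted_basin (v + (per k')%:C).
  case=> n [k1 h]; exists n, (k1 + k' *+ 2 ^ n); rewrite /F iter_clift_period.
  rewrite (_ : _ - _ = iter n F v - (e + per k1)%:C) //.
  by rewrite perD !rmorphD /=; ring.
split=> [/(H (- k))|]; last exact: H.
by rewrite perN rmorphN /= addrK.
Qed.

Lemma lifted_basin_conj w : lifted_basin w -> lifted_basin w^*.
Proof.
case=> n [k h]; exists n, k; rewrite /F iter_clift_conj.
have -> : (iter n (clift a b) w)^* - (e + per k)%:C = (iter n F w - (e + per k)%:C)^*.
  by rewrite conjB [X in _ = _ - X]real_conj.
by rewrite nrm_conj.
Qed.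

Lemma lifted_basin_open w : lifted_basin w ->
  exists2 r : R, 0 < r & forall u, nrm (u - w) < r -> lifted_basin u.
Proof.
case=> n [k h].
have h0 : 0 < delta - nrm (iter n F w - (e + per k)%:C) by rewrite subr_gt0.
have [d d0 H] := iter_clift_cont a b n w h0.
exists d => // u /H hu; exists n, k.
rewrite (le_lt_trans (nrm_tri (iter n F w) _ _)) //.
by rewrite -ltrBrDr.
Qed.

Lemma lifted_basin_cycle x : lifted_cycle x -> lifted_basin x%:C.
Proof.
case=> i [k ->]; rewrite rmorphD /=; apply/lifted_basin_period.
rewrite -iter_clift_real; apply: (lifted_basin_iter i e%:C).1.
exists 0%N, 0; rewrite per0 addr0 -[iter 0 _ _]/(e%:C) subrr nrm0.
by case: attr.
Qed.

(** Indices can be reduced modulo p, which leaves finitely many points modulo 2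
    pi. *)
Lemma lifted_cycle_lt x : lifted_cycle x ->
  exists i k, (i < p)%N /\ x = iter i f e + per k.
Proof.
case=> i [k ->].
have [k' ->] : exists k', iter i f e = iter (i %% p) f e + per k'.
  rewrite {1}(divn_eq i p) addnC mulnC; elim: (i %/ p)%N => [|j [k' IH]].
    by exists 0; rewrite muln0 addn0 per0 addr0.
  have iE : (i %% p + p * j.+1 = (i %% p + p * j) + p)%N.
    by rewrite mulnS [(p + _)%N]addnC addnA.
  exists (k' + m *+ 2 ^ (i %% p + p * j)).
  rewrite iE iterD -/f e_periodic /f iter_rlift_period -/f.
  by rewrite IH perD addrA.
by exists (i %% p)%N, (k' + k); rewrite ltn_pmod // perD addrA.
Qed.

Lemma lifted_basin_near_cycle : exists2 r : R, 0 < r &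
  forall x w, lifted_cycle x -> nrm (w - x%:C) < r -> lifted_basin w.
Proof.
have [r r0 H] : exists2 r : R, 0 < r & forall i, (i < p)%N ->
    (forall w, nrm (w - (iter i f e)%:C) < r -> lifted_basin w).
  apply: (@exists_uniform_pos (fun i r => forall w,
    nrm (w - (iter i f e)%:C) < r -> lifted_basin w)).
    move=> i _; apply: lifted_basin_open; apply: lifted_basin_cycle.
    by exists i, 0; rewrite per0 addr0.
  by move=> i d d' _ dd H w h; apply: H; exact: lt_le_trans dd.
exists r => // x w /lifted_cycle_lt[i [k [ip ->]]] h.
apply/(lifted_basin_period (- k)); apply: (H i) => //.
rewrite (_ : _ - _ = w - (iter i f e + per k)%:C) //.
by rewrite perN !(rmorphD, rmorphN) /=; ring.
Qed.

Lemma lifted_basin_converges w (d : R) : lifted_basin w -> 0 < d ->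
  exists n, forall j, (n <= j)%N -> exists2 x, lifted_cycle x &
    nrm (iter j F w - x%:C) < d.
Proof.
move=> [n0 [k h]] d0.
have [c c0 Hc] : exists2 c : R, 0 < c & forall i, (i < p)%N ->
    (forall u, nrm (u - e%:C) < c -> nrm (iter i F u - iter i F e%:C) < d).
  apply: (@exists_uniform_pos (fun i c => forall u,
    nrm (u - e%:C) < c -> nrm (iter i F u - iter i F e%:C) < d)).
    by move=> i _; exact: iter_clift_cont.
  by move=> i c c' _ cc H u hu; apply: H; exact: lt_le_trans cc.
have [n1 Hn1] := geometric_small (nrm (iter n0 F w - (e + per k)%:C)) kappa01 c0.
exists (n0 + p * n1)%N => j jn.
pose q := ((j - n0) %/ p)%N; pose i := ((j - n0) %% p)%N.
have jE : (j = i + (p * q + n0))%N.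
  have nj : (n0 <= j)%N by apply: leq_trans jn; rewrite leq_addr.
  by rewrite -{1}(subnK nj) {1}(divn_eq (j - n0) p) -/q -/i; lia.
have qn : (n1 <= q)%N.
  rewrite /q leq_divRL // mulnC; move: jn; lia.
have [k' Hk'] := trap_iter k q.
have := le_lt_trans (Hk' _ h) (Hn1 q qn); rewrite -iterD => hc.
set u := iter _ F w in hc.
exists (iter i f e + per (k' *+ 2 ^ i)); first by exists i, (k' *+ 2 ^ i).
rewrite jE iterD -/u -(subrK (per k')%:C u) /F iter_clift_period.
have h2 : nrm (u - (per k')%:C - e%:C) < c.
  by apply: le_lt_trans hc; rewrite rmorphD /= opprD addrAC addrA.
have := Hc i (ltn_pmod _ p_gt0) _ h2; rewrite /F iter_clift_real -/f.
by congr (nrm _ < _); rewrite !rmorphD /=; ring.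
Qed.

(** Late points of the orbit are near the cycle, which has a uniform
    neighbourhood in the basin; only finitely many early points remain. *)
Lemma lifted_basin_orbit_uniform w : lifted_basin w -> exists2 r : R, 0 < r &
  forall n u, nrm (u - iter n F w) < r -> lifted_basin u.
Proof.
move=> Bw; have [r1 r10 H1] := lifted_basin_near_cycle.
have r12 : 0 < r1 / 2 by rewrite divr_gt0.
have [n0 Hn0] := lifted_basin_converges Bw r12.
have [r2 r20 H2] : exists2 r : R, 0 < r & forall i, (i < n0)%N ->
    (forall u, nrm (u - iter i F w) < r -> lifted_basin u).
  apply: (@exists_uniform_pos (fun i r => forall u,
    nrm (u - iter i F w) < r -> lifted_basin u)).
    by move=> i _; apply: lifted_basin_open; exact: (lifted_basin_iter i w).1.
  by move=> i d d' _ dd H u h; apply: H; exact: lt_le_trans dd.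
exists (Num.min r2 (r1 / 2)); first by rewrite lt_min r20.
move=> n u; rewrite lt_min => /andP[u2 u1].
have [nn|nn] := ltnP n n0; first exact: H2 nn _ u2.
have [x Cx Hx] := Hn0 n nn; apply: (H1 x) => //.
rewrite (le_lt_trans (nrm_tri (iter n F w) _ _)) // [r1]splitr.
exact: ltrD.
Qed.

End LiftedBasin.

(** * Critical orbits and uniform expansion *)

Section UniformExpansion.
Variable R : realType.
Implicit Types (z w : R[i]) (x y r : R) (k : int).

Lemma exp_small (c s : R) : 0 < c -> 0 < s -> exists2 d : R, 0 < d &
  forall t, t <= d -> (expR (c * t) - 1) * (pi *+ 2) < s.
Proof.
move=> c0 s0; have p0 : 0 < pi *+ 2 :> R by rewrite pmulrn_lgt0 ?pi_gt0.
pose u := s / (pi *+ 2) / 2; have u0 : 0 < u by rewrite !divr_gt0.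
have u1 : 0 < 1 + u by rewrite addr_gt0.
exists (ln (1 + u) / c); first by rewrite divr_gt0 // ln_gt0 // ltrDl.
move=> t; rewrite ler_pdivlMr // mulrC => tc.
have : expR (c * t) <= 1 + u by rewrite -[leRHS]lnK ?posrE // ler_expR.
rewrite -ltr_pdivlMr // => h.
suff : s / (pi *+ 2) = 2 * u by lra.
by rewrite /u; set v := s / _; field.
Qed.

(** If F^N brings y' within d of F^N y, then y' was within s of y already, for
    all N: intervals abutting y cannot shrink under iteration. *)
Lemma uniform_contraction a b r s : 0 <= b <= 1 -> 0 < r -> r < pi *+ 2 -> 0 < s ->
  exists2 d : R, 0 < d & forall N y y',
    no_critical_orbit a b (square (iter N (rlift a b) y) r) ->
    `|iter N (rlift a b) y' - iter N (rlift a b) y| < d -> `|y' - y| < s.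
Proof.
move=> hb r0 r2 s0; have pi0 := @pi_gt0 R.
have c0 : 0 < 4 * pi / r by rewrite divr_gt0 // mulr_gt0.
have [d d0 Hd] := exp_small c0 s0.
exists (Num.min d (r / 2)); first by rewrite lt_min d0 divr_gt0.
move=> N y y' nocrit; rewrite lt_min => /andP[h1 h2].
apply: le_lt_trans (Hd _ (ltW h1)).
have H := @inverse_branch_contraction R a b _ r N y y' hb r0 r2 nocrit erefl (ltW h2).
exact: H.
Qed.


(** With z = exp(ic), F'(c) = 0 reads b (z + 1/z) = -2, so the two solutions are
    inverse to each other; conjugation of the equation shows that they are also
    exchanged, or fixed, by z -> 1/conj(z), that is by c -> conj c. *)
Lemma critical_points (b : R) (c c' : R[i]) : 0 <= b <= 1 -> dclift b c = 0 -> dclift b c' = 0 ->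
  exists k, c' = c + (per k)%:C \/ c' = c^* + (per k)%:C.
Proof.
move=> /andP[b0 b1].
have key u v : dclift b u = 0 -> dclift b v = 0 ->
    cexp ('i * v) = cexp ('i * u) \/ cexp ('i * v) = (cexp ('i * u))^-1.
  move=> du dv.
  have bn0 : b%:C != 0 :> R[i].
    apply/negP => /eqP b00; move: du; rewrite /dclift b00 mul0r addr0 => /eqP.
    by rewrite pnatr_eq0.
  have : b%:C * ((cexp ('i * v) + (cexp ('i * v))^-1) -
      (cexp ('i * u) + (cexp ('i * u))^-1)) = dclift b v - dclift b u.
    by rewrite /dclift !cexpN; ring.
  rewrite du dv subrr => /eqP; rewrite mulf_eq0 (negbTE bn0) /=.
  set s := cexp _; set t := cexp ('i * u).
  have s0 : s != 0 by exact: cexp_neq0.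
  have t0 : t != 0 by exact: cexp_neq0.
  have -> : s + s^-1 - (t + t^-1) = (s - t) * (s - t^-1) / s.
    by field; rewrite s0 t0.
  rewrite !mulf_eq0 invr_eq0 (negbTE s0) orbF !subr_eq0.
  by case/orP => /eqP; [left|right].
move=> dc dc'.
have dcJ : dclift b c^* = 0 by rewrite dclift_conj dc conjc0.
case: (key _ _ dc dc') => [/cexp_i_eq[k ->]|e]; first by exists k; left.
case: (key _ _ dc dcJ) => eJ; last first.
  by move: e; rewrite -eJ => /cexp_i_eq[k ->]; exists k; right.
suff e2 : (cexp ('i * c))^-1 = cexp ('i * c).
  by move: e; rewrite e2 => /cexp_i_eq[k ->]; exists k; left.
set t := cexp ('i * c) in e eJ *.
have t0 : t != 0 by exact: cexp_neq0.
have tJ : t^-1 = t^*.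
  have : 'i * c^* = (- ('i * c))^* by case: (c) => x y; complex_ext; ring.
  move=> h; rewrite h cexp_conj cexpN -/t in eJ.
  have h2 : t^-1 = ((t^-1)^*)^* by case: (t^-1) => x y; complex_ext; ring.
  by rewrite h2 eJ.
have tt : t * t^-1 = 1 by rewrite mulfV.
rewrite tJ in tt.
have := dc; rewrite /dclift cexpN -/t tJ; case: (t) tt => x y tt.
move: tt => -[tt _] -[ht _].
have x1 : b * x = -1 by lra.
have x2 : x ^+ 2 <= 1 by have := sqr_ge0 y; nra.
have xE : x = -1.
  apply/eqP; rewrite eq_le; apply/andP; split; rewrite leNgt; apply/negP => h.
    have := mulr_ge0 b0 (ltW (_ : 0 < x + 1)); rewrite mulrDr x1 mulr1 => h1.
    have b1' : b = 1 by apply/eqP; rewrite eq_le b1; have := h1 ltac:(lra); lra.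
    by rewrite b1' mul1r in x1; rewrite x1 ltxx in h.
  have : 0 < (- 1 - x) * (- 1 - x) by rewrite mulr_gt0 ?subr_gt0.
  lra.
have yE : y = 0.
  by apply/eqP; rewrite -sqrf_eq0 expr2; apply/eqP; rewrite xE in tt; lra.
by rewrite xE yE; complex_ext; ring.
Qed.

Variables (a b e kappa delta : R) (p : nat) (m : int).
Hypothesis attr : attracting_lift a b e kappa delta p m.
Let F := clift a b.
Let f := rlift a b.
Let B := lifted_basin a b e delta.
Let hb : 0 <= b <= 1. Proof. by case: attr. Qed.

Lemma delta_le_pihalf : delta *+ 2 <= pi.
Proof.
case: attr => _ _ _ _ d0 dp _; apply: le_trans dp; rewrite ler_peMl //.
  by rewrite pmulrn_lge0 // ltW.
by rewrite exprn_ege1 // ler1n.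
Qed.

(** Fatou's theorem in this setting. Otherwise no critical orbit enters the
    discs around the cycle, so [uniform_contraction] applies at e with N = p n
    for all n; but F^(p n) shrinks the interval from e to e + delta/2 to
    nothing. *)
Lemma attracted_critical_point : exists2 c, dclift b c = 0 & B c.
Proof.
apply: contrapT => nocrit; have d0 : 0 < delta by case: attr.
have k01 : 0 <= kappa < 1 by case: attr.
have dpi := delta_le_pihalf; have pi0 := @pi_gt0 R.
(* The square of half-side delta/4 is inside the contracted disc. *)
pose r := delta / 4; have r0 : 0 < r by rewrite divr_gt0.
have r2 : r < pi *+ 2 by rewrite /r; lra.
have av k : no_critical_orbit a b (square (e + per k) r).
  move=> c n dc /square_bounded h; apply: nocrit; exists c => //.
  apply/(lifted_basin_iter attr n.+1); exists 0%N, k.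
  by apply: le_lt_trans h _; rewrite /r; lra.
pose s := delta / 2; have s0 : 0 < s by rewrite divr_gt0.
have [d dp Hd] := uniform_contraction a hb r0 r2 s0.
have [n Hn] := geometric_small s k01 dp.
have [k' Hk'] := trap_iter attr 0 n.
have He : iter (p * n) f e = e + per k'.
  have := Hk' e%:C; rewrite per0 addr0 subrr nrm0 mulr0 => /(_ d0) h.
  apply: complexI; rewrite -iter_clift_real; apply/eqP.
  by rewrite -subr_eq0 -nrm_eq0 eq_le h nrm_ge0.
have es : nrm ((e + s)%:C - (e + per 0)%:C) = s.
  by rewrite per0 addr0 -rmorphB nrm_real /= addrAC subrr add0r gtr0_norm.
have := Hk' (e + s)%:C; rewrite es => /(_ ltac:(rewrite /s; lra)).
rewrite iter_clift_real -rmorphB nrm_real /= -He => h.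
have := Hd (p * n)%N e (e + s); rewrite -/f He => /(_ (av k')); rewrite -He.
move=> /(_ (le_lt_trans h (Hn n (leqnn n)))).
by rewrite addrAC subrr add0r gtr0_norm // ltxx.
Qed.

(** Up to translation there are two critical points, conjugate to each other.
    One is in the basin, hence both are, and their orbits have a uniform
    neighbourhood in the basin. *)
Lemma critical_orbits_avoid : exists2 r : R, 0 < r /\ r < pi *+ 2 &
  forall x, ~ B x%:C -> no_critical_orbit a b (square x r).
Proof.
have [c dc Bc] := attracted_critical_point.
have [r1 r10 H1] := lifted_basin_orbit_uniform attr Bc.
have [r2 r20 H2] := lifted_basin_orbit_uniform attr (lifted_basin_conj Bc).
have pi2 := @pi_ge2 R.
pose q := Num.min (Num.min r1 r2) 1.
have q0 : 0 < q by rewrite !lt_min r10 r20 ltr01.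
have q1 : q <= 1 by rewrite ge_min lexx orbT.
exists (q / 3); first by split; [rewrite divr_gt0|lra].
move=> x nB c' n dc' /square_bounded h; apply: nB.
have [k ck] := critical_points hb dc dc'.
have hq : nrm (x%:C - iter n.+1 F c') < q by rewrite nrmB (le_lt_trans h) //; lra.
move: hq; rewrite !lt_min => /andP[/andP[h1 h2] _].
case: ck => ck; rewrite ck /F iter_clift_period in h1 h2.
  apply/(lifted_basin_period _ _ _ _ (- (k *+ 2 ^ n.+1))); apply: (H1 n.+1).
  by rewrite opprD addrA addrAC in h1; rewrite perN rmorphN.
apply/(lifted_basin_period _ _ _ _ (- (k *+ 2 ^ n.+1))); apply: (H2 n.+1).
by rewrite opprD addrA addrAC in h2; rewrite perN rmorphN.
Qed.

Lemma uniform_expansion (s : R) : 0 < s -> exists2 d : R, 0 < d & forall N y y',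
  ~ B y%:C -> `|iter N f y' - iter N f y| < d -> `|y' - y| < s.
Proof.
move=> s0; have [r [r0 r2] Hr] := critical_orbits_avoid.
have [d d0 Hd] := uniform_contraction a hb r0 r2 s0.
exists d => // N y y' nB; apply: Hd; apply: Hr.
rewrite -iter_clift_real => h; apply: nB.
exact: (lifted_basin_iter attr N _).2 h.
Qed.

End UniformExpansion.

(** * Fibres over the doubling map *)

Section Fibres.
Variable R : realType.
Implicit Types (x y : R) (k : int) (n j i : nat).
Variables a b : R.
Hypothesis hb : 0 <= b <= 1.
Let f := rlift a b.
Let pp : 0 < pi *+ 2 :> R.
Proof. by rewrite pmulrn_lgt0 ?pi_gt0. Qed.

(** The fibres of the monotone semiconjugacy from F to multiplication by 2:
    bounded distance between orbits, where 2 pi is the threshold beyond which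
    distances grow exponentially. *)
Definition same_fibre x y := forall n, `|iter n f x - iter n f y| <= pi *+ 2.

(** Compare x with y + 2 pi. *)
Lemma iter_gap n x y : y + pi *+ 2 < x ->
  iter n f y + 2 ^+ n * (pi *+ 2) < iter n f x.
Proof.
move=> /(iter_rlift_lt a hb n); apply: le_lt_trans.
have := iter_rlift_period a b n y 1; rewrite mul1r => ->.
by rewrite lerD2l ler_pM2r // rmorphMn rmorph1 natrX.
Qed.

Lemma iter_gap_norm n x y : pi *+ 2 < `|x - y| ->
  2 ^+ n * (pi *+ 2) < `|iter n f x - iter n f y|.
Proof.
wlog yx : x y / y <= x.
  move=> H; have [|/ltW xy] := leP y x; first exact: H.
  by rewrite distrC [`|iter n f x - _|]distrC; exact: H.
rewrite ger0_norm ?subr_ge0 // ltrBrDl => /(iter_gap n) h.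
by rewrite ger0_norm ?subr_ge0 ?iter_rlift_le // ltrBrDl.
Qed.

Lemma iter_gap_ge n x y : pi *+ 2 < `|x - y| -> pi *+ 2 < `|iter n f x - iter n f y|.
Proof.
move=> /(iter_gap_norm n); apply: le_lt_trans.
by rewrite ler_peMl ?(ltW pp) // exprn_ege1 // ler1n.
Qed.

Lemma same_fibre_refl x : same_fibre x x.
Proof. by move=> n; rewrite subrr normr0 ltW. Qed.

Lemma same_fibre_sym x y : same_fibre x y -> same_fibre y x.
Proof. by move=> h n; rewrite distrC; exact: h. Qed.

(** A distance over 2 pi becomes one over 4 pi at the next step. *)
Lemma same_fibre_trans y x z : same_fibre x y -> same_fibre y z -> same_fibre x z.
Proof.
move=> xy yz n; rewrite leNgt; apply/negP => /(iter_gap_norm 1).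
rewrite expr1 -!iterD add1n => h.
have := ler_distD (iter n.+1 f y) (iter n.+1 f x) (iter n.+1 f z).
have := xy n.+1; have := yz n.+1; lra.
Qed.

Lemma same_fibre_iter n x y : same_fibre x y <-> same_fibre (iter n f x) (iter n f y).
Proof.
split=> h j; first by rewrite -!iterD; exact: h.
rewrite leNgt; apply/negP => /(iter_gap_ge n).
by rewrite -!iterD addnC !iterD ltNge h.
Qed.

Lemma same_fibre_period k x y : same_fibre x y -> same_fibre (x + per k) (y + per k).
Proof. by move=> h n; rewrite !iter_rlift_period opprD addrACA subrr addr0. Qed.

Lemma same_fibre_between x y z : same_fibre x z -> x <= y <= z -> same_fibre x y.
Proof.
move=> h /andP[xy yz] n; have := h n.
have xy' := iter_rlift_le a hb n xy; have yz' := iter_rlift_le a hb n yz.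
have xz' := le_trans xy' yz'.
rewrite ![`|iter n f x - _|]distrC !ger0_norm ?subr_ge0 //.
by apply: le_trans; rewrite lerD2r.
Qed.

Lemma same_fibre_closed x y :
  (forall d : R, 0 < d -> exists2 y', same_fibre x y' & `|y' - y| < d) -> same_fibre x y.
Proof.
move=> H n; apply/ler_addgt0Pr => d d0.
have d1 : 0 < d / 4 ^+ n by rewrite divr_gt0 ?exprn_gt0.
have [y' h1 h2] := H _ d1.
rewrite (le_trans (ler_distD (iter n f y') _ _)) // lerD //.
rewrite (le_trans (iter_rlift_lip a hb n _ _)) // mulrC -ler_pdivlMr ?exprn_gt0 //.
exact: ltW.
Qed.

(** Classes are bounded, convex and closed. *)
Lemma same_fibre_interval x : exists P Q, P <= x <= Q /\ forall y, same_fibre x y <-> P <= y <= Q.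
Proof.
pose A := [set y | same_fibre x y].
have Ax : A x by exact: same_fibre_refl.
have Ab y : A y -> `|x - y| <= pi *+ 2 by move=> /(_ 0%N).
have hs : has_sup A.
  split; first by exists x.
  by exists (x + pi *+ 2) => y /Ab; rewrite ler_norml => /andP[? ?]; lra.
have hi : has_inf A.
  split; first by exists x.
  by exists (x - pi *+ 2) => y /Ab; rewrite ler_norml => /andP[? ?]; lra.
have infA y : A y -> inf A <= y by case: hi => _ hl /(ge_inf hl).
have AQ : A (sup A).
  apply: same_fibre_closed => d d0; have [y Ay yd] := sup_adherent d0 hs.
  have h : y <= sup A by exact: sup_upper_bound.
  by exists y => //; rewrite distrC ger0_norm ?subr_ge0 // ltrBlDr -ltrBlDl.
have AP : A (inf A).
  apply: same_fibre_closed => d d0; have [y Ay yd] := inf_adherent d0 hi.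
  have h : inf A <= y by exact: infA.
  by exists y => //; rewrite ger0_norm ?subr_ge0 // ltrBlDl.
exists (inf A), (sup A); split.
  by rewrite infA ?sup_upper_bound.
move=> y; split=> [Ay|/andP[h1 h2]].
  by rewrite infA ?sup_upper_bound.
apply: (same_fibre_trans AP); apply: (@same_fibre_between _ _ (sup A)); last by rewrite h1.
exact: same_fibre_trans (same_fibre_sym AP) AQ.
Qed.

(** Iterates of F followed by a translation: these are the maps that can
    preserve a fibre on the line. *)
Definition shift_iter n k x := iter n f x - per k.

Lemma shift_iter_iter n k j : exists K, forall x,
  iter j (shift_iter n k) x = iter (n * j) f x - per K.
Proof.
elim: j => [|j [K IH]]; first by exists 0 => x; rewrite muln0 per0 subr0.
exists (K *+ 2 ^ n + k) => x.
rewrite iterS IH /shift_iter -perN iter_rlift_period -iterD mulnS.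
by rewrite mulNrn perN perD opprD addrA.
Qed.

Lemma shift_iter_lt n k : {mono shift_iter n k : x y / x < y}.
Proof. by move=> x y; rewrite /shift_iter ltrD2r iter_rlift_ltE. Qed.

Lemma shift_iter_le n k : {mono shift_iter n k : x y / x <= y}.
Proof. by move=> x y; rewrite /shift_iter lerD2r iter_rlift_leE. Qed.

Lemma same_fibre_shift_iter n k x y : same_fibre x y <-> same_fibre (shift_iter n k x) (shift_iter n k y).
Proof.
split=> [/(same_fibre_iter n)/(same_fibre_period (- k))|h]; first by rewrite perN.
by apply/(same_fibre_iter n); have := same_fibre_period k h; rewrite /shift_iter !subrK.
Qed.

Lemma shift_iter_surj n k y : exists x, shift_iter n k x = y.
Proof.
have [x xE] := iter_rlift_surj a hb n (y + per k).
by exists x; rewrite /shift_iter xE addrK.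
Qed.

(** An increasing surjection which maps the fibre onto itself fixes its ends. *)
Lemma shift_iter_fixes_ends n k x P Q : same_fibre x (shift_iter n k x) ->
  P <= x <= Q -> (forall y, same_fibre x y <-> P <= y <= Q) ->
  shift_iter n k P = P /\ shift_iter n k Q = Q.
Proof.
set G := shift_iter n k => xG /andP[Px xQ] class.
have PQ := le_trans Px xQ.
have classG y : P <= y <= Q <-> P <= G y <= Q.
  rewrite -!class; split=> [/(same_fibre_shift_iter n k)|h].
    exact: same_fibre_trans xG.
  by apply/(same_fibre_shift_iter n k); apply: same_fibre_trans (same_fibre_sym xG) h.
have [/andP[GP _] /andP[_ GQ]] : P <= G P <= Q /\ P <= G Q <= Q.
  by split; [apply: (classG P).1|apply: (classG Q).1]; rewrite lexx PQ.
split; apply/eqP; rewrite eq_le.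
  rewrite GP andbT; have [P' P'E] := shift_iter_surj n k P.
  have /andP[h _] : P <= P' <= Q by apply: (classG P').2; rewrite /G P'E lexx.
  by rewrite -{2}P'E shift_iter_le.
rewrite GQ /=; have [Q' Q'E] := shift_iter_surj n k Q.
have /andP[_ h] : P <= Q' <= Q by apply: (classG Q').2; rewrite /G Q'E lexx PQ.
by rewrite -{1}Q'E shift_iter_le.
Qed.

(** Pigeonhole on the fractional parts. *)
Lemma near_return (u : nat -> R) (d : R) : 0 < d ->
  exists n j k, (n < j)%N /\ `|u j - per k - u n| < d.
Proof.
move=> d0; pose c n := Num.floor (u n / (pi *+ 2)).
pose v n := u n - per (c n).
have v0 n : 0 <= v n by rewrite subr_ge0 -ler_pdivlMr // floor_le.
have v2 n : v n < pi *+ 2.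
  by rewrite ltrBlDl -{2}[pi *+ 2]mul1r -mulrDl -ltr_pdivrMr // -intrD1 floorD1_gt.
pose M := (Num.truncn (pi *+ 2 / d)).+1.
have vd n : 0 <= v n / d by rewrite divr_ge0 // ltW.
have vM n : (Num.truncn (v n / d) < M)%N.
  by rewrite ltnS le_truncn // ler_pM2r ?invr_gt0 // ltW.
pose g (i : 'I_M.+1) : 'I_M := Ordinal (vM i).
have [i [j [ij gij]]] : exists i j : 'I_M.+1, (i < j)%N /\ g i = g j.
  apply: contrapT => H; have /leq_card : injective g.
    move=> i j gij; apply/val_inj; have [ij|ji|//] := ltngtP i j; case: H.
      by exists i, j.
    by exists j, i.
  by rewrite !card_ord ltnn.
exists i, j, (c j - c i); split=> //.
have /(congr1 val) /= e := gij.
rewrite perB (_ : _ - _ = v j - v i); last by rewrite /v; ring.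
have /andP[] := truncn_itv (vd i); have /andP[] := truncn_itv (vd j).
rewrite -e; set t := Num.truncn _.
rewrite !ler_pdivlMr // !ltr_pdivrMr // -natr1 mulrDl mul1r => h1 h2 h3 h4.
by rewrite ltr_norml; apply/andP; split; lra.
Qed.
End Fibres.

(** * Expansion off the basin *)

Section Expansion.
Variable R : realType.
Implicit Types (x y : R) (k : int) (n j i : nat).
Variables (a b e kappa delta : R) (p : nat) (m : int).
Hypothesis attr : attracting_lift a b e kappa delta p m.
Let f := rlift a b.
Let B x := lifted_basin a b e delta x%:C.
Let Gam := lifted_cycle a b e.
Let hb : 0 <= b <= 1. Proof. by case: attr. Qed.
Let pp : 0 < pi *+ 2 :> R.
Proof. by rewrite pmulrn_lgt0 ?pi_gt0. Qed.

Lemma basin_iter n x : B x <-> B (iter n f x).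
Proof. by rewrite /B -iter_clift_real; exact: (lifted_basin_iter attr). Qed.

Lemma basin_period k x : B (x + per k) <-> B x.
Proof. by rewrite /B rmorphD; exact: lifted_basin_period. Qed.

(** At multiples of p both points are within delta of the same point of the
    cycle; in between, distances grow at most by the factor 4^p. *)
Lemma trapped_same_fibre x y k : `|x - (e + per k)| < delta -> `|y - (e + per k)| < delta ->
  same_fibre a b x y.
Proof.
move=> xk yk n; rewrite (divn_eq n p) mulnC addnC iterD.
set q := (n %/ p)%N; set i := (n %% p)%N.
have p0 : (0 < p)%N by case: attr.
have d0 : 0 < delta by case: attr.
have [k' Hk'] := trap_iter attr k q.
have tr t : `|t - (e + per k)| < delta -> `|iter (p * q) f t - (e + per k')| <= delta.
  move=> tk; have := Hk' t%:C; rewrite -rmorphB nrm_real => /(_ tk).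
  rewrite iter_clift_real -rmorphB nrm_real => /le_trans; apply.
  case: (attr) => _ _ _ /andP[k0 k1] _ _ _.
  by rewrite (le_trans _ (ltW tk)) // ler_piMl // exprn_ile1 // ltW.
rewrite -!(iterD i (p * q)) [X in iter X _ x]addnC [X in iter X _ y]addnC.
rewrite addnC !iterD (le_trans (iter_rlift_lip a hb i _ _)) //.
have h : `|iter (p * q) f x - iter (p * q) f y| <= delta *+ 2.
  rewrite (le_trans (ler_distD (e + per k') _ _)) // mulr2n lerD //; first exact: tr.
  by rewrite distrC; exact: tr.
apply: le_trans (ler_wpM2l _ h) _; first exact: exprn_ge0.
case: (attr) => _ _ _ _ _ ds _; apply: le_trans (le_trans ds _); last first.
  by rewrite mulr2n lerDl pi_ge0.
rewrite ler_wpM2r ?mulrn_wge0 ?(ltW d0) // ler_weXn2l ?ler1n //.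
by rewrite ltnW // ltn_pmod.
Qed.

Lemma basin_locally_same_fibre x : B x -> exists2 d : R, 0 < d & forall y, `|y - x| < d -> same_fibre a b x y.
Proof.
case=> n [k]; rewrite iter_clift_real -rmorphB nrm_real => h.
have h0 : 0 < delta - `|iter n f x - (e + per k)| by rewrite subr_gt0.
have e0 : 0 < (4 : R) ^+ n by rewrite exprn_gt0.
exists ((delta - `|iter n f x - (e + per k)|) / 4 ^+ n); first by rewrite divr_gt0.
move=> y; rewrite ltr_pdivlMr // mulrC => yx.
apply: (same_fibre_iter a hb n x y).2; apply: (trapped_same_fibre h).
rewrite (le_lt_trans (ler_distD (iter n f x) _ _)) // -ltrBrDr.
exact: le_lt_trans (iter_rlift_lip a hb n _ _) yx.
Qed.

(** A basin point has a neighbourhood contained in its fibre. *)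
Lemma fibre_endpoints x P Q : P <= x <= Q ->
  (forall y, same_fibre a b x y <-> P <= y <= Q) -> ~ B P /\ ~ B Q.
Proof.
move=> /andP[Px xQ] class; have PQ := le_trans Px xQ; split=> /basin_locally_same_fibre[d d0 H].
  have : same_fibre a b x (P - d / 2).
    apply: (same_fibre_trans hb ((class P).2 _)); first by rewrite lexx PQ.
    by apply: H; rewrite addrAC subrr add0r normrN gtr0_norm ?divr_gt0 //; lra.
  by move/class => /andP[h _]; lra.
have : same_fibre a b x (Q + d / 2).
  apply: (same_fibre_trans hb ((class Q).2 _)); first by rewrite lexx PQ.
  by apply: H; rewrite addrAC subrr add0r gtr0_norm ?divr_gt0 //; lra.
by move/class => /andP[_ h]; lra.
Qed.

(** The end of the fibre of e. *)
Lemma exists_not_basin : exists x, ~ B x.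
Proof.
have [P [Q [PQ class]]] := same_fibre_interval a hb e.
by have [nP _] := fibre_endpoints PQ class; exists P.
Qed.

Lemma iter_period_e j : exists k, iter (p * j) f e = e + per k.
Proof.
have d0 : 0 < delta by case: attr.
have [k' Hk'] := trap_iter attr 0 j; exists k'.
have := Hk' e%:C; rewrite per0 addr0 subrr nrm0 mulr0 => /(_ d0) h.
apply: complexI; rewrite -iter_clift_real; apply/eqP.
by rewrite -subr_eq0 -nrm_eq0 eq_le h nrm_ge0.
Qed.

Lemma cycle_shift x y : Gam x -> Gam y -> exists n k, shift_iter a b n k x = y.
Proof.
move=> [i [k ->]] [i' [k' ->]].
have [K HK] := iter_period_e i.
have p0 : (0 < p)%N by case: attr.
have le_i : (i <= p * i)%N by rewrite leq_pmull.
pose n := (i' + (p * i - i))%N.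
exists n, (K *+ 2 ^ i' + k *+ 2 ^ n - k').
rewrite /shift_iter iter_rlift_period -iterD.
have -> : (n + i = i' + p * i)%N by rewrite /n -addnA subnK.
rewrite iterD -/f HK /f iter_rlift_period !(perB, perD); ring.
Qed.

(** A shifted iterate T takes x to y > x. It preserves the fibre, so T^n x
    increases inside it; but T^p x is a translate of x, hence at least x + 2 pi,
    and the next iterate leaves the fibre. *)
Lemma cycle_same_fibre_eq x y : Gam x -> Gam y -> same_fibre a b x y -> x = y.
Proof.
wlog xy : x y / x < y.
  move=> H Gx Gy s; have [xy|yx|//] := ltgtP x y; first exact: H.
  by apply/esym; apply: H => //; exact: same_fibre_sym.
move=> Gx Gy s; exfalso; have [n [k T1]] := cycle_shift Gx Gy.
set T := shift_iter a b n k in T1.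
have Tlt j : iter j T x < iter j.+1 T x.
  elim: j => [|j IH]; first by rewrite /= T1.
  by rewrite iterS [ltRHS]iterS shift_iter_lt.
have Tmono i j : (i < j)%N -> iter i T x < iter j T x.
  elim: j => // j IH; rewrite ltnS leq_eqVlt => /predU1P[->//|/IH h].
  exact: lt_trans h (Tlt j).
have Tsim j : same_fibre a b x (iter j T x).
  elim: j => [|j IH]; first exact: same_fibre_refl.
  apply: (same_fibre_trans hb s); rewrite -T1 iterS.
  exact: (same_fibre_shift_iter a hb n k _ _).1 IH.
have p0 : (0 < p)%N by case: attr.
have [K1 HK1] := shift_iter_iter a b n k p.
have [i [k1 xE]] := Gx.
have [K2 HK2] : exists K2, iter (n * p) f x = x + per K2.
  have [K HK] := iter_period_e n.
  exists (K *+ 2 ^ i + k1 *+ 2 ^ (p * n) - k1).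
  rewrite {1}xE mulnC iter_rlift_period -iterD addnC iterD -/f HK /f.
  by rewrite iter_rlift_period !(perB, perD) {1}xE; ring.
have Tp : iter p T x = x + per (K2 - K1) by rewrite HK1 -/f HK2 perB addrA.
have xTp : x < iter p T x by exact: (Tmono 0%N).
have big : x + pi *+ 2 <= iter p T x.
  rewrite Tp lerD2l -[leLHS]mul1r ler_pM2r // -[1]/(1%:~R) ler_int.
  by move: xTp; rewrite Tp ltrDl pmulr_lgt0 // ltr0z gtz0_ge1.
have := Tsim p.+1 0%N; have := Tlt p; rewrite /= distrC => h.
by rewrite ger0_norm; lra.
Qed.

(** Move the orbit into a contracted disc. Its distance d to the centre
    satisfies |d + 2 pi M| <= kappa^n |d| for some integer M by periodicity;
    since |d| is small, M = 0 and then d = 0. *)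
Lemma basin_periodic x n k : (0 < n)%N -> B x -> iter n f x = x + per k -> Gam x.
Proof.
move=> n0 [i [k1]]; rewrite iter_clift_real -rmorphB nrm_real => h per_x.
have p0 : (0 < p)%N by case: attr.
pose y := iter i f x.
have itx j : exists K, iter (n * j) f x = x + per K.
  elim: j => [|j [K IH]]; first by exists 0; rewrite muln0 per0 addr0.
  exists (k + K *+ 2 ^ n); rewrite mulnS iterD IH /f iter_rlift_period -/f per_x.
  by rewrite perD addrA.
have [K1 HK1] := itx p.
have yE : iter (p * n) f y = y + per (K1 *+ 2 ^ i).
  by rewrite /y -iterD addnC iterD mulnC HK1 /f iter_rlift_period.
have [k' Hk'] := trap_iter attr k1 n.
have := Hk' y%:C; rewrite -rmorphB nrm_real => /(_ h).
rewrite iter_clift_real -rmorphB nrm_real -/f yE.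
set d := y - (e + per k1).
rewrite (_ : _ - _ = d + per (K1 *+ 2 ^ i + k1 - k')); last first.
  by rewrite !(perB, perD) /d; ring.
set M := _ - k' => hd.
have k01 : 0 <= kappa < 1 by case: attr.
have kn : kappa ^+ n < 1 by case/andP: k01 => ? ?; rewrite exprn_ilt1 // -lt0n.
have hd1 : `|d + per M| <= `|d|.
  by rewrite (le_trans hd) // ler_piMl // ltW.
have M0 : M = 0.
  apply: (@per_small R); have := delta_le_pihalf attr.
  have := ler_normB (d + per M) d; rewrite addrAC subrr add0r.
  by have := h; rewrite -/y -/d; have := @pi_gt0 R; lra.
have d00 : d = 0.
  apply/eqP; rewrite -normr_eq0; apply: contraT => dn0.
  have dp : 0 < `|d| by rewrite lt_def dn0 normr_ge0.
  by move: hd; rewrite M0 per0 addr0 ler_pMl // leNgt kn.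
have yk : iter i f x = e + per k1 by apply/eqP; rewrite -subr_eq0 -/y -/d d00.
have [K HK] := itx i.
have le_i : (i <= n * i)%N by rewrite leq_pmull.
exists (n * i - i)%N, (k1 *+ 2 ^ (n * i - i) - K).
rewrite perB addrA -iter_rlift_period -/f -yk -iterD subnK //.
by rewrite HK addrK.
Qed.

(** A bounded monotone sequence cannot have all its steps of length at least d;
    multiplication by c treats both directions at once. *)
Lemma monotone_small_step (u : nat -> R) (c A d : R) : 0 < d ->
  (forall n, `|u n| <= A) -> c != 0 ->
  (forall n, 0 < c * (u n.+1 - u n)) -> exists n, `|u n.+1 - u n| < d.
Proof.
move=> d0 uA c0 uc; apply: contrapT => /forallNP H.
have step n : d <= `|u n.+1 - u n| by rewrite leNgt; apply/negP/H.
have cp : 0 < `|c| by rewrite normr_gt0.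
have grow n : `|c| * d * n%:R <= c * (u n - u 0%N).
  elim: n => [|n IH]; first by rewrite subrr !mulr0.
  have -> : c * (u n.+1 - u 0%N) = c * (u n.+1 - u n) + c * (u n - u 0%N) by ring.
  rewrite -natr1 mulrDr mulr1 addrC lerD // -(gtr0_norm (uc n)) normrM.
  by rewrite ler_wpM2l.
pose n := (Num.truncn ((A + A) / d)).+1.
have hn : A + A < n%:R * d by rewrite -ltr_pdivrMr // truncnS_gt.
have := grow n; rewrite leNgt => /negP; apply.
rewrite (le_lt_trans (ler_norm _)) // normrM -mulrA ltr_pM2l //.
rewrite (le_lt_trans (ler_normB _ _)) // (le_lt_trans (lerD (uA _) (uA _))) //.
by rewrite mulrC.
Qed.

Section PeriodicClass.
Variables (n : nat) (k : int) (P Q x : R).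
Hypothesis n0 : (0 < n)%N.
Let G := shift_iter a b n k.
Hypothesis class : forall y, same_fibre a b x y <-> P <= y <= Q.
Hypothesis GP : G P = P.
Hypothesis GQ : G Q = Q.

Lemma iterG_between A C y j : G A = A -> G C = C -> A <= y <= C ->
  A <= iter j G y <= C.
Proof.
move=> GA GC h; elim: j => //= j /andP[IH1 IH2].
by rewrite -{1}GA -{1}GC !(shift_iter_le a hb) IH1.
Qed.

(** The orbit of y under G is monotone in [P, Q], so some step from G^j y to
    G^(j+1) y is as short as desired. By uniform expansion the step from y to G
    y would be shorter than itself. *)
Lemma not_basin_fixed y : P <= y <= Q -> ~ B y -> G y = y.
Proof.
move=> yPQ nB; apply/eqP; apply: contraT => Gy.
have d0 : 0 < `|G y - y| by rewrite normr_gt0 subr_eq0.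
have [d dp Hd] := uniform_expansion attr d0.
have [j Hj] : exists j, `|iter j.+1 G y - iter j G y| < d.
  apply: (@monotone_small_step (fun j => iter j G y) (G y - y) (`|P| + `|Q|)) => //.
  - move=> j; have /andP[h1 h2] := iterG_between j GP GQ yPQ.
    have := ler_norm Q; have := ler_norm (- P); rewrite normrN.
    have := normr_ge0 P; have := normr_ge0 Q.
    by rewrite ler_norml => *; apply/andP; split; lra.
  - by rewrite subr_eq0.
  - move=> j; have [lt_y|gt_y|e0] := ltgtP y (G y); last by rewrite -e0 eqxx in Gy.
      rewrite mulr_gt0 ?subr_gt0 //; elim: j => //= j IH.
      by rewrite shift_iter_lt.
    rewrite nmulr_rgt0 ?subr_lt0 //; elim: j => //= j IH.
    by rewrite shift_iter_lt.
have [K HK] := shift_iter_iter a b n k j.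
have := Hd (n * j)%N y (G y) nB; rewrite ltxx; apply.
move: Hj; rewrite iterSr !HK -/f.
by rewrite opprB addrA subrK.
Qed.

(** The orbit of y under G converges monotonically to a fixed point. That point
    is close to the cycle, hence in the basin, and being periodic modulo 2 pi it
    belongs to the cycle. *)
Lemma basin_fixed_cycle A C y : A <= y <= C -> G A = A -> G C = C ->
  B y -> exists c, [/\ A <= c <= C, Gam c & B c].
Proof.
move=> AyC GA GC By.
have bd j := iterG_between j GA GC AyC.
have cG : continuous G.
  move=> t; have h := @iter_rlift_continuous R a b hb n t.
  exact: (cvgB h (cvg_cst _)).
have [l cvl] : exists l, iter j G y @[j --> \oo] --> (l : R).
  have [le_y|ge_y] := leP y (G y).
    exists (sup (range (fun j => iter j G y))); apply: nondecreasing_cvgn.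
      apply/nondecreasing_seqP => j; elim: j => //= j IH.
      by rewrite shift_iter_le.
    by exists C => _ [j _ <-]; case/andP: (bd j).
  exists (inf (range (fun j => iter j G y))); apply: nonincreasing_cvgn.
    apply/nonincreasing_seqP => j; elim: j => [|j IH] /=; first exact: ltW.
    by rewrite shift_iter_le.
  by exists A => _ [j _ <-]; case/andP: (bd j).
have Gl : G l = l.
  have c1 : iter j.+1 G y @[j --> \oo] --> G l.
    exact: (cvg_comp (fun j => iter j G y) G cvl (cG l)).
  have c2 : iter j.+1 G y @[j --> \oo] --> l.
    by rewrite (cvg_shiftS (fun j => iter j G y)).
  exact: (cvg_unique (@Rhausdorff R) c1 c2).
have lAC : A <= l <= C.
  apply/andP; split.
    have h : \forall j \near \oo, A <= iter j G y.
      by apply: nearW => j; case/andP: (bd j).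
    exact: (@closed_cvg _ _ _ _ _ (fun t => A <= t) (@closed_ge R A) h _ cvl).
  have h : \forall j \near \oo, iter j G y <= C.
    by apply: nearW => j; case/andP: (bd j).
  exact: (@closed_cvg _ _ _ _ _ (fun t => t <= C) (@closed_le R C) h _ cvl).
have [r r0 Hr] := lifted_basin_near_cycle attr.
have r2 : 0 < r / 2 by rewrite divr_gt0.
have [N HN] := lifted_basin_converges attr By r2.
have Bl : B l.
  move/cvgrPdist_lt: cvl => /(_ _ r2) [N' _ HN'].
  pose j := maxn N N'.
  have [K HK] := shift_iter_iter a b n k j.
  have Nj : (N <= n * j)%N.
    by rewrite (leq_trans (leq_maxl N N')) // leq_pmull.
  have [c [i [k' cE]]] := HN _ Nj.
  rewrite iter_clift_real -rmorphB nrm_real -/f => h1.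
  have h2 := HN' j (leq_maxr N N'); rewrite /= -/j HK -/f in h2.
  apply: (Hr (c - per K)).
    by exists i, (k' - K); rewrite cE perB addrA.
  rewrite -rmorphB nrm_real.
  rewrite (le_lt_trans (ler_distD (iter (n * j) f y - per K) _ _)) // [r]splitr.
  by rewrite ltrD // opprB addrA subrK.
exists l; split=> //; apply: (@basin_periodic l n k) => //.
by move/eqP: Gl; rewrite /G /shift_iter subr_eq => /eqP.
Qed.

Lemma iterG_fixed y j : G y = y -> iter j G y = y.
Proof. by move=> Gy; elim: j => //= j ->. Qed.

Let gap_growth t : ~ same_fibre a b x t -> P <= Q -> forall C, P <= C <= Q ->
  exists j, pi *+ 2 < `|iter (n * j) f C - iter (n * j) f t|.
Proof.
move=> nt PQ C CPQ.
have nC : ~ same_fibre a b C t.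
  by move=> h; apply: nt; apply: (same_fibre_trans hb ((class C).2 CPQ) h).
have /existsNP[j /negP] := nC; rewrite -ltNge => h.
exists j; have le_j : (j <= n * j)%N by rewrite leq_pmull.
by rewrite -(subnK le_j) !iterD; apply: iter_gap_ge.
Qed.

(** Otherwise G is the identity on [P, C]. Points t = P - eta outside the fibre
    are expelled far to the left by iterates of G, so F^N t is left of the
    square around F^N P. The distortion inequality compares the interval from P
    to P + w0, on which F^N is a translation, with a subinterval of [t, P] of
    length less than eta, by a factor that does not depend on eta. *)
Lemma no_neutral_left C : P < C <= Q -> ~ B P -> exists2 y, P <= y <= C & B y.
Proof.
move=> /andP[PC CQ] nBP; apply: contrapT => nB.
have fixed y : P <= y <= C -> G y = y.
  move=> /andP[Py yC]; apply: not_basin_fixed; first by rewrite Py (le_trans yC).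
  by move=> By; apply: nB; exists y; rewrite ?Py.
have [r [r0 r2] Hr] := critical_orbits_avoid attr.
pose w0 := Num.min (r / 2) (C - P).
have w00 : 0 < w0 by rewrite lt_min divr_gt0 // subr_gt0.
have w0r : w0 <= r / 2 by rewrite ge_min lexx.
have w0C : w0 <= C - P by rewrite ge_min lexx orbT.
pose E : R := expR (4 * pi); have E0 : 0 < E by exact: expR_gt0.
(* E bounds the distortion factor, so w0 <= E eta = w0/2 is the contradiction.
   *)
pose eta := w0 / (2 * E); have eta0 : 0 < eta by rewrite divr_gt0 // mulr_gt0.
pose t := P - eta.
have PQ : P <= Q by rewrite (le_trans (ltW PC)).
have nt : ~ same_fibre a b x t by move/class => /andP[h _]; rewrite /t in h; lra.
have PPQ : P <= P <= Q by rewrite lexx PQ.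
have [j gap] := @gap_growth t nt PQ P PPQ.
set N := (n * j)%N in gap.
have tP : t < P by rewrite /t; lra.
have ftP := iter_rlift_lt a hb N tP.
rewrite gtr0_norm ?subr_gt0 // in gap.
have [K HK] := shift_iter_iter a b n k j.
have HP : iter N f P = P + per K.
  by have := HK P; rewrite (iterG_fixed _ GP) => e1; rewrite {2}e1 subrK.
have y2fix : G (P + w0) = P + w0 by apply: fixed; apply/andP; split; lra.
have Hy2 : iter N f (P + w0) = iter N f P + w0.
  have e2 := HK (P + w0); rewrite (iterG_fixed _ y2fix) in e2.
  by apply/eqP; rewrite HP addrAC -subr_eq; apply/eqP/esym.
(* The subinterval of [t, P] to compare with is [t, y1]. *)
have [y1 Hy1] := iter_rlift_surj a hb N (iter N f P - r / 2).
rewrite -/f in Hy1.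
have y1P : y1 < P by rewrite -(iter_rlift_ltE a hb N) -/f Hy1; lra.
have nc : no_critical_orbit a b (square (iter N f P) r).
  by apply: Hr => /(basin_iter N P).2.
have := @distortion_left R a b _ r N t y1 (P + w0) hb r0 nc.
rewrite -/f Hy1 Hy2 => /(_ ltac:(lra) (lexx _) ltac:(lra) ltac:(lra)).
rewrite (_ : iter N f P + w0 - (iter N f P - r / 2) = w0 + r / 2); last by ring.
rewrite leNgt => /negP; apply.
have ty1 : 0 <= y1 - t.
  by rewrite subr_ge0 -(iter_rlift_leE a hb N) -/f Hy1; lra.
have le_E : expR (4 * pi / r * (w0 + r / 2)) <= E.
  rewrite ler_expR -mulrA ler_piMr ?mulr_ge0 ?pi_ge0 //.
  by rewrite mulrC ler_pdivrMr // mul1r; lra.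
apply: (@le_lt_trans _ _ (E * eta)).
  by apply: ler_pM => //; rewrite /t; lra.
have -> : E * eta = w0 / 2 by rewrite /eta; field; rewrite gt_eqF.
by rewrite /t; lra.
Qed.

Lemma no_neutral_right C : P <= C < Q -> ~ B Q -> exists2 y, C <= y <= Q & B y.
Proof.
move=> /andP[PC CQ] nBQ; apply: contrapT => nB.
have fixed y : C <= y <= Q -> G y = y.
  move=> /andP[Cy yQ]; apply: not_basin_fixed; first by rewrite yQ (le_trans PC).
  by move=> By; apply: nB; exists y; rewrite ?Cy.
have [r [r0 r2] Hr] := critical_orbits_avoid attr.
pose w0 := Num.min (r / 2) (Q - C).
have w00 : 0 < w0 by rewrite lt_min divr_gt0 // subr_gt0.
have w0r : w0 <= r / 2 by rewrite ge_min lexx.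
have w0C : w0 <= Q - C by rewrite ge_min lexx orbT.
pose E : R := expR (4 * pi); have E0 : 0 < E by exact: expR_gt0.
pose eta := w0 / (2 * E); have eta0 : 0 < eta by rewrite divr_gt0 // mulr_gt0.
pose t := Q + eta.
have PQ : P <= Q by rewrite (le_trans PC) // ltW.
have nt : ~ same_fibre a b x t by move/class => /andP[_ h]; rewrite /t in h; lra.
have PQQ : P <= Q <= Q by rewrite lexx PQ.
have [j gap] := @gap_growth t nt PQ Q PQQ.
set N := (n * j)%N in gap.
have tQ : Q < t by rewrite /t; lra.
have ftQ := iter_rlift_lt a hb N tQ.
rewrite ltr0_norm ?subr_lt0 // opprB in gap.
have [K HK] := shift_iter_iter a b n k j.
have HQ : iter N f Q = Q + per K.
  by have := HK Q; rewrite (iterG_fixed _ GQ) => e1; rewrite {2}e1 subrK.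
have y1fix : G (Q - w0) = Q - w0 by apply: fixed; apply/andP; split; lra.
have Hy1 : iter N f (Q - w0) = iter N f Q - w0.
  have e2 := HK (Q - w0); rewrite (iterG_fixed _ y1fix) in e2.
  by apply/eqP; rewrite HQ addrAC -subr_eq; apply/eqP/esym.
have [y2 Hy2] := iter_rlift_surj a hb N (iter N f Q + r / 2).
rewrite -/f in Hy2.
have y2Q : Q < y2 by rewrite -(iter_rlift_ltE a hb N) -/f Hy2; lra.
have nc : no_critical_orbit a b (square (iter N f Q) r).
  by apply: Hr => /(basin_iter N Q).2.
have := @distortion_right R a b _ r N t (Q - w0) y2 hb r0 nc.
rewrite -/f Hy1 Hy2 => /(_ ltac:(lra) ltac:(lra) ltac:(lra) (lexx _)).
rewrite (_ : iter N f Q + r / 2 - (iter N f Q - w0) = w0 + r / 2); last by ring.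
rewrite leNgt => /negP; apply.
have ty2 : 0 <= t - y2.
  by rewrite subr_ge0 -(iter_rlift_leE a hb N) -/f Hy2; lra.
have le_E : expR (4 * pi / r * (w0 + r / 2)) <= E.
  rewrite ler_expR -mulrA ler_piMr ?mulr_ge0 ?pi_ge0 //.
  by rewrite mulrC ler_pdivrMr // mul1r; lra.
apply: (@le_lt_trans _ _ (E * eta)).
  by apply: ler_pM => //; rewrite /t; lra.
have -> : E * eta = w0 / 2 by rewrite /eta; field; rewrite gt_eqF.
by rewrite /t; lra.
Qed.

End PeriodicClass.

(** The contradiction described at the top: otherwise near returns of the orbit
    of x produce a fibre [P, Q] preserved by some G, with a fixed point y inside
    which is not in the basin; the cycle would have a point in [P, y] and
    another in [y, Q]. *)
Lemma not_basin_expands x u1 u2 : ~ B x -> u1 < x < u2 -> ~ same_fibre a b u1 u2.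
Proof.
move=> nBx /andP[u1x xu2] s12.
have nB j : ~ B (iter j f x) by move/(basin_iter j x).2.
pose s := Num.min (x - u1) (u2 - x).
have s0 : 0 < s by rewrite lt_min !subr_gt0 u1x.
have [d d0 Hd] := uniform_expansion attr s0.
have sx y : u1 <= y <= u2 -> same_fibre a b x y.
  move=> yu; apply: (same_fibre_trans hb (y := u1)).
    by apply: same_fibre_sym; apply: (same_fibre_between hb s12); rewrite !ltW.
  exact: (same_fibre_between hb s12).
(* All fibres along the orbit have width at least d on both sides of it. *)
have wide j y : `|y - iter j f x| < d -> same_fibre a b (iter j f x) y.
  move=> yd; have [y' y'E] := iter_rlift_surj a hb j y.
  have : `|y' - x| < s by apply: (Hd j) => //; rewrite -/f /f y'E.
  rewrite lt_min !ltr_norml => /andP[/andP[h1 h2] /andP[h3 h4]].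
  rewrite -y'E; apply: (same_fibre_iter a hb j x y').1; apply: sx.
  by apply/andP; split; lra.
have [n [j [k [nj ret]]]] := near_return (fun j => iter j f x) d0.
set y := iter n f x in ret.
have jE : iter j f x = iter (j - n) f y by rewrite /y -iterD subnK // ltnW.
have yG : same_fibre a b y (shift_iter a b (j - n) k y).
  by apply: wide; rewrite /shift_iter -/f -jE.
have [P [Q [PyQ class]]] := same_fibre_interval a hb y.
have [GP GQ] := shift_iter_fixes_ends hb yG PyQ class.
have q0 : (0 < j - n)%N by rewrite subn_gt0.
have [nBP nBQ] := fibre_endpoints PyQ class.
have nBy : ~ B y by exact: nB.
have d2 : 0 < d / 2 by rewrite divr_gt0.
have Py : P < y.
  have /class/andP[h _] : same_fibre a b y (y - d / 2).
    by apply: wide; rewrite addrAC subrr add0r normrN gtr0_norm //; lra.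
  lra.
have yQ : y < Q.
  have /class/andP[_ h] : same_fibre a b y (y + d / 2).
    by apply: wide; rewrite addrAC subrr add0r gtr0_norm //; lra.
  lra.
have Gy : shift_iter a b (j - n) k y = y.
  by apply: (not_basin_fixed GP GQ PyQ).
have PyQ1 : P < y <= Q by rewrite Py ltW.
have PyQ2 : P <= y < Q by rewrite yQ ltW.
have [z1 z1P Bz1] := no_neutral_left q0 class GP GQ PyQ1 nBP.
have [z2 z2Q Bz2] := no_neutral_right q0 class GP GQ PyQ2 nBQ.
have [c1 [c1P C1 Bc1]] := basin_fixed_cycle q0 z1P GP Gy Bz1.
have [c2 [c2Q C2 Bc2]] := basin_fixed_cycle q0 z2Q Gy GQ Bz2.
have c12 : c1 = c2.
  apply: cycle_same_fibre_eq => //; apply: (same_fibre_trans hb (y := y)).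
    apply: same_fibre_sym; apply/class; move: c1P; lra.
  by apply/class; move: c2Q; lra.
apply: nBy; have -> : y = c1 by move: c1P c2Q; rewrite -c12; lra.
exact: Bc1.
Qed.

Lemma expansion x u1 u2 : ~ B x -> u1 < x < u2 -> exists n, forall j, (n <= j)%N ->
  2 ^+ (j - n) * (pi *+ 2) < iter j f u2 - iter j f u1.
Proof.
move=> nBx ux; have /andP[u1x xu2] := ux.
have /existsNP[n /negP] := not_basin_expands nBx ux.
rewrite -ltNge => h; exists n => j nj.
have := iter_gap_norm a hb (j - n) h; rewrite -!iterD subnK //.
rewrite distrC ger0_norm // subr_ge0.
by apply: iter_rlift_le => //; apply: ltW; exact: lt_trans xu2.
Qed.

Lemma not_basin_transitive x y u1 u2 : ~ B x -> u1 < x < u2 -> ~ B y ->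
  exists n u k, [/\ u1 <= u <= u2, ~ B u & iter n f u = y + per k].
Proof.
move=> nBx ux nBy; have [n /(_ n (leqnn n))] := expansion nBx ux.
have /andP[u1x xu2] := ux; have u12 := ltW (lt_trans u1x xu2).
rewrite subnn expr0 mul1r => gap.
pose k := Num.floor ((iter n f u2 - y) / (pi *+ 2)).
have k1 : per k <= iter n f u2 - y by rewrite -ler_pdivlMr // floor_le.
have k2 : iter n f u2 - y < per k + pi *+ 2.
  by rewrite -{2}[pi *+ 2]mul1r -mulrDl -ltr_pdivrMr // -intrD1 floorD1_gt.
have cF : {within `[u1, u2], continuous (iter n f)}.
  by apply: continuous_subspaceT; exact: (@iter_rlift_continuous R a b hb n).
have [|u] := @IVT R (iter n f) u1 u2 (y + per k) u12 cF.
  by rewrite ge_min le_max; apply/andP; split; apply/orP; [left|right]; lra.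
rewrite in_itv /= => u_in uE; exists n, u, k; split=> //.
by move/(basin_iter n u).1; rewrite uE => /basin_period.
Qed.

(** On a neighbourhood of x that contains no point of the cycle, F^n u - u
    varies by more than 2 pi for large n, so it takes a value in 2 pi Z. The
    point found is not in the basin, since by [basin_periodic] it would belong
    to the cycle. *)
Lemma not_basin_periodic x u1 u2 : ~ B x -> u1 < x < u2 ->
  exists n u k, [/\ (0 < n)%N, u1 <= u <= u2, ~ B u & iter n f u = u + per k].
Proof.
move=> nBx /andP[u1x xu2].
have [r r0 Hr] := lifted_basin_near_cycle attr.
pose s := Num.min 1 (r / 2).
have pi2 := @pi_ge2 R.
have s0 : 0 < s by rewrite lt_min ltr01 divr_gt0.
have s1 : s <= 1 by rewrite ge_min lexx.
have sr : s <= r / 2 by rewrite ge_min lexx orbT.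
(* The interval [v1, v2] is closer to x than any point of the cycle can be. *)
pose v1 := Num.max u1 (x - s); pose v2 := Num.min u2 (x + s).
have v1x : v1 < x by rewrite gt_max u1x; lra.
have xv2 : x < v2 by rewrite lt_min xu2; lra.
have v1s : x - s <= v1 by rewrite le_max lexx orbT.
have v2s : v2 <= x + s by rewrite ge_min lexx orbT.
have v1u : u1 <= v1 by rewrite le_max lexx.
have v2u : v2 <= u2 by rewrite ge_min lexx.
have vx : v1 < x < v2 by rewrite v1x.
have [n0 gap0] := expansion nBx vx.
have gap := gap0 n0.+1 (leqnSn n0); rewrite subSnn expr1 in gap.
set n := n0.+1 in gap.
pose h y := iter n f y - y.
have v12 : v1 <= v2 by lra.
pose k := Num.floor (h v2 / (pi *+ 2)).
have k1 : per k <= h v2 by rewrite -ler_pdivlMr // floor_le.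
have k2 : h v2 < per k + pi *+ 2.
  by rewrite -{2}[pi *+ 2]mul1r -mulrDl -ltr_pdivrMr // -intrD1 floorD1_gt.
have ch : {within `[v1, v2], continuous h}.
  apply: continuous_subspaceT => t; have ct := @iter_rlift_continuous R a b hb n t.
  exact: (cvgB ct cvg_id).
have [|u] := @IVT R h v1 v2 (per k) v12 ch.
  rewrite ge_min le_max; apply/andP; split; apply/orP; [left|right] => //.
  by move: k2; rewrite /h; lra.
rewrite in_itv /= => /andP[u_v1 u_v2] uE.
have fu : iter n f u = u + per k by rewrite -uE /h addrC subrK.
exists n, u, k; split=> //; first by apply/andP; split; lra.
move=> Bu; apply: nBx; have Gu := basin_periodic (isT : (0 < n)%N) Bu fu.
apply: (Hr u) => //; rewrite -rmorphB nrm_real ltr_norml.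
by apply/andP; split; lra.
Qed.

End Expansion.

(** * Dynamics on the circle *)

Section Circle.
Variable R : realType.
Implicit Types (z w u v : R[i]) (x y : R) (k : int) (n j i : nat).

Definition circle_point x : R[i] := cexp ('i * x%:C).

Lemma unit_circleP z : unit_circle z <-> nrm z = 1.
Proof.
rewrite /unit_circle /= normrC; split=> [e|->//].
by apply: complexI; rewrite e.
Qed.

Lemma circle_point_unit x : unit_circle (circle_point x).
Proof. by apply/unit_circleP; rewrite nrm_cexp reM /= mul0r mulr0 subrr expR0. Qed.

Lemma unit_circle_point z : unit_circle z -> exists x, z = circle_point x.
Proof.
move=> /unit_circleP; case: z => x y /= e.
have e2 : x ^+ 2 + y ^+ 2 = 1.
  have h : 0 <= x ^+ 2 + y ^+ 2 by rewrite addr_ge0 ?sqr_ge0.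
  by rewrite -(sqr_sqrtr h) e expr1n.
have x1 : -1 <= x <= 1.
  by rewrite -ler_norml -[leRHS]normr1 -ler_sqr ?nnegrE // !real_normK ?num_real // expr1n -e2 lerDl sqr_ge0.
have cx : cos (acos x) = x by rewrite acosK // in_itv.
have sx : sin (acos x) = `|y|.
  by rewrite sin_acos // -e2 addrAC subrr add0r sqrtr_sqr.
have [y0|y0] := leP 0 y.
  by exists (acos x); rewrite /circle_point cexp_im cx sx ger0_norm.
by exists (- acos x); rewrite /circle_point cexp_im cosN sinN cx sx ltr0_norm // opprK.
Qed.

Lemma cderiv_continuous (f : R[i] -> R[i]) z l : cderiv f z l -> {for z, continuous f}.
Proof.
move=> D A /= /nbhs_nrmP[e e0 eA]; apply/nbhs_nrmP.
have [d d0 H] := cderiv_cont D e0.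
by exists d => // w /H /eA.
Qed.

Lemma cexp_i_cont w (e : R) : 0 < e -> exists2 d : R, 0 < d &
  forall u, nrm (u - w) < d -> nrm (cexp ('i * u) - cexp ('i * w)) < e.
Proof. by move=> e0; exact: (cderiv_cont (cderiv_cexp_lin 'i w) e0). Qed.

Lemma circle_point_continuous : continuous circle_point.
Proof.
move=> x A /= /nbhs_nrmP[e e0 eA]; apply/nbhs_ballP.
have [d d0 H] := cexp_i_cont x%:C e0.
exists d => // y; rewrite /ball /= => xy; apply/eA/H.
by rewrite -rmorphB nrm_real distrC.
Qed.

Lemma circle_point_near x A : nbhs (circle_point x) A ->
  exists2 d : R, 0 < d & forall y, `|y - x| < d -> A (circle_point y).
Proof.
move=> /circle_point_continuous /nbhs_ballP[d /= d0 H]; exists d => // y yx.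
by apply: H; rewrite /ball /= distrC.
Qed.

Lemma cexp_i_open u (e : R) : 0 < e -> exists2 d : R, 0 < d &
  forall z, nrm (z - cexp ('i * u)) < d -> exists2 v, nrm (v - u) < e & z = cexp ('i * v).
Proof.
move=> e0; pose w := 'i * u.
have n0 : 0 < nrm (cexp w) by rewrite nrm_gt0 cexp_neq0.
have [r r0 Hr] := @cexp_uniformly_strict R _ n0.
pose s := Num.min r e; have s0 : 0 < s by rewrite lt_min r0.
exists (nrm (cexp w) * s / 16); first by rewrite divr_gt0 // mulr_gt0.
move=> z zd; have [||v vs vE] := @local_inversion R (@cexp R) (@cexp R) w s n0 _ z.
- move=> t1 t2; rewrite !lt_min => /andP[t1r _] /andP[t2r _].
  exact: Hr (lexx _) _ _ t1r t2r.
- by [].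
exists (- 'i * v); last by rewrite mulrA mulrN mulii opprK mul1r vE.
have -> : - 'i * v - u = - 'i * (v - w).
  have -> : u = - ('i * 'i) * u by rewrite mulii opprK mul1r.
  by rewrite /w; ring.
rewrite nrmM nrmN nrm_i mul1r.
by move: vs; rewrite lt_min => /andP[].
Qed.

Lemma iter_dsm_cexp a b n w :
  iter n (dsm a b) (cexp ('i * w)) = cexp ('i * iter n (clift a b) w).
Proof. by elim: n => //= n ->; rewrite dsm_cexp. Qed.

Lemma iter_dsm_circle a b n x :
  iter n (dsm a b) (circle_point x) = circle_point (iter n (rlift a b) x).
Proof. by rewrite /circle_point iter_dsm_cexp iter_clift_real. Qed.

Lemma circle_point_eq x y : circle_point x = circle_point y ->
  exists k, x = y + per k.
Proof.
move=> /cexp_i_eq[k]; rewrite -rmorphD => /complexI e; by exists k.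
Qed.

Lemma circle_point_period x k : circle_point (x + per k) = circle_point x.
Proof. by rewrite /circle_point rmorphD cexp_i_period. Qed.

(** Differentiating exp(i F^p(w)) = g^p(exp(iw)) at e shows that F^p has the
    same multiplier at e as g^p at the point of the cycle. *)
Lemma attracting_cycle_lift a b gamma : 0 <= b <= 1 ->
  attracting_cycle a b gamma -> gamma `<=` @unit_circle R ->
  exists e kappa delta p m, attracting_lift a b e kappa delta p m /\
    gamma = circle_point @` lifted_cycle a b e.
Proof.
move=> hb [z [p [p0 zp _ gE [la Dz la1]]]] gU.
have gz : gamma z by rewrite gE; exists 0%N.
have [e ze] := unit_circle_point (gU _ gz).
have nla : nrm la < 1 by rewrite normrC ltcR in la1.
have := zp; rewrite ze iter_dsm_circle => /circle_point_eq[m em].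
have [l Dl] := iter_clift_cderiv a b p e%:C.
have D1 : cderiv (fun w => iter p (dsm a b) (cexp ('i * w))) e%:C (la * ('i * z)).
  apply: (cderiv_comp (f := iter p (dsm a b)) (g := fun w => cexp ('i * w))).
    by rewrite ze; exact: cderiv_cexp_lin.
  by rewrite -/(circle_point e) -ze; apply/cderivP.
have D2 : cderiv (fun w => cexp ('i * iter p (clift a b) w)) e%:C ('i * z * l).
  have := cderiv_comp Dl (cderiv_cexp_lin 'i _).
  by rewrite -iter_dsm_cexp -/(circle_point e) -ze zp.
have lE : l = la.
  have iz0 : 'i * z != 0.
    rewrite mulf_neq0 //; last by rewrite ze cexp_neq0.
    by rewrite -nrm_eq0 nrm_i oner_eq0.
  apply: (mulfI iz0); rewrite [RHS]mulrC.
  apply: (cderiv_uniq D2); apply: cderiv_ext D1 => w.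
  by rewrite iter_dsm_cexp.
rewrite lE {l lE D1 D2} in Dl.
have e2 : 0 < (1 - nrm la) / 2 by rewrite divr_gt0 // subr_gt0.
have [d d0 Hd] := Dl _ e2.
have p4 : 0 < (4 : R) ^+ p by rewrite exprn_gt0.
pose delta := Num.min d (pi / (4 ^+ p * 2)).
have delta0 : 0 < delta by rewrite lt_min d0 divr_gt0 ?pi_gt0 ?mulr_gt0.
exists e, ((1 + nrm la) / 2), delta, p, m; split.
  have la0 := nrm_ge0 la; split=> //.
  - by apply/andP; split; lra.
  - have : delta <= pi / (4 ^+ p * 2) by rewrite ge_min lexx orbT.
    by rewrite ler_pdivlMr ?mulr_gt0 // mulrC -mulrA [2 * _]mulrC mulr_natr.
  move=> w; rewrite lt_min => /andP[wd _].
  have := Hd _ wd; rewrite [e%:C + _]addrC subrK iter_clift_real em => h.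
  have -> : iter p (clift a b) w - (e + per m)%:C =
    (iter p (clift a b) w - (e + per m)%:C - la * (w - e%:C)) + la * (w - e%:C).
    by rewrite subrK.
  rewrite (le_trans (nrmD _ _)) // nrmM.
  have -> : (1 + nrm la) / 2 * nrm (w - e%:C) =
    (1 - nrm la) / 2 * nrm (w - e%:C) + nrm la * nrm (w - e%:C) by field.
  by rewrite lerD2r.
rewrite gE; apply/seteqP; split=> [y [k /= kp <-]|_ [x [i [k ->]] <-]].
  exists (iter k (rlift a b) e); last by rewrite -iter_dsm_circle ze.
  by exists k, 0; rewrite per0 addr0.
rewrite circle_point_period -iter_dsm_circle -ze.
exists (i %% p)%N; first by rewrite /= ltn_pmod.
rewrite {2}(divn_eq i p) addnC iterD; congr iter.
by elim: (i %/ p)%N => //= j IH; rewrite mulSn iterD -IH zp.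
Qed.

Section Basin.
Variables (a b e kappa delta : R) (p : nat) (m : int).
Hypothesis attr : attracting_lift a b e kappa delta p m.
Let g := dsm a b.
Let gamma : set R[i] := circle_point @` lifted_cycle a b e.
Let LB := lifted_basin a b e delta.
Let hb : 0 <= b <= 1. Proof. by case: attr. Qed.

(** The image of the lifted basin, an open set whose points on the circle are
    those of the basin. *)
Definition basin_image : set R[i] := [set cexp ('i * w) | w in LB].

Lemma basin_imageP w : basin_image (cexp ('i * w)) <-> LB w.
Proof.
split=> [[u Bu /cexp_i_eq[k uE]]|]; last by exists w.
by move: Bu; rewrite uE => /lifted_basin_period.
Qed.

Lemma basin_image_open : open basin_image.
Proof.
rewrite openE => _ [w Bw <-]; apply/nbhs_nrmP.
have [r r0 Hr] := lifted_basin_open Bw.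
have [d d0 Hd] := cexp_i_open w r0.
by exists d => // z /Hd[v /Hr Bv ->]; exists v.
Qed.

Lemma cycle_basin_image : gamma `<=` basin_image.
Proof.
by move=> _ [x Cx <-]; apply/basin_imageP; exact: (lifted_basin_cycle attr Cx).
Qed.

(** One direction uses the image of the lifted basin as a neighbourhood of the
    cycle; the other, that points of the plane near the lifted cycle map into
    any given neighbourhood of gamma. *)
Lemma basin_cexpP w : basin a b gamma (cexp ('i * w)) <-> LB w.
Proof.
split=> [[_ cvg_w]|Bw].
  have V : set_nbhs gamma basin_image.
    move=> y gy; apply: open_nbhs_nbhs; split; first exact: basin_image_open.
    exact: cycle_basin_image.
  have [n _ /(_ n (leqnn n))] := cvg_w _ V.
  rewrite /= iter_dsm_cexp => /basin_imageP h.
  exact: (lifted_basin_iter attr n w).2 h.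
split; first exact: cexp_neq0.
move=> V gV.
have [d d0 Hd] : exists2 d : R, 0 < d & forall i, (i < p)%N ->
    (forall u, nrm (u - (iter i (rlift a b) e)%:C) < d -> V (cexp ('i * u))).
  apply: (@exists_uniform_pos _ (fun i d => forall u,
    nrm (u - (iter i (rlift a b) e)%:C) < d -> V (cexp ('i * u)))).
    move=> i _; have /gV /nbhs_nrmP[r r0 Hr] : gamma (circle_point (iter i (rlift a b) e)).
      by exists (iter i (rlift a b) e) => //; exists i, 0; rewrite per0 addr0.
    have [d d0 Hd] := cexp_i_cont (iter i (rlift a b) e)%:C r0.
    by exists d => // u /Hd /Hr.
  by move=> i d d' _ dd H u h; apply: H; exact: lt_le_trans dd.
have [n Hn] := lifted_basin_converges attr Bw d0.
exists n => // j /= nj; have [x Cx] := Hn j nj.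
have [i [k [ip ->]]] := lifted_cycle_lt attr Cx.
rewrite rmorphD /= opprD addrA => h.
rewrite iter_dsm_cexp -(subrK (per k)%:C (iter j (clift a b) w)) cexp_i_period.
by apply: (Hd i ip); rewrite addrAC.
Qed.

(** Once the orbit is in a contracted disc, an arc of the circle inside the
    basin joins it to a point of the cycle, so it is in the immediate basin. *)
Lemma total_circle_basinP x :
  total_circle_basin a b gamma (circle_point x) <-> LB x%:C.
Proof.
split=> [[[j _ [y gy cy]] _]|[n [k h]]].
  move: cy => /connected_component_sub; rewrite iter_dsm_circle => /basin_cexpP.
  by rewrite -iter_clift_real => /(lifted_basin_iter attr j x%:C).2.
split; last exact: circle_point_unit.
exists n => //=; rewrite iter_dsm_circle; set y := iter n _ x.
have {}h : `|y - per k - e| < delta.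
  by rewrite iter_clift_real -rmorphB nrm_real /= opprD addrA addrAC in h.
have ge : gamma (circle_point e).
  by exists e => //; exists 0%N, 0; rewrite per0 addr0.
exists (circle_point e) => //.
pose I : set R := [set t | `|t - e| < delta].
have cI : connected I.
  apply/connected_intervalP => t1 t2; rewrite /I /= => h1 h2 t /andP[t1t tt2].
  move: h1 h2; rewrite !ltr_norml => /andP[? ?] /andP[? ?].
  by apply/andP; split; lra.
apply: (@connected_component_max _ _ (circle_point @` I)).
- by exists e => //; rewrite /I /= subrr normr0; case: attr.
- move=> _ [t It <-]; apply/basin_cexpP; exists 0%N, 0.
  by rewrite per0 addr0 -rmorphB nrm_real.
- apply: connected_continuous_connected cI _; apply: continuous_subspaceT.
  exact: circle_point_continuous.
- by exists (y - per k) => //; rewrite -perN circle_point_period.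
Qed.

Let C := basin_complement a b gamma.

Lemma basin_complementP x : C (circle_point x) <-> ~ LB x%:C.
Proof.
split=> [[_ h] /total_circle_basinP //|h].
by split; [exact: circle_point_unit|move/total_circle_basinP].
Qed.

Lemma basin_complement_point z : C z -> exists2 x, z = circle_point x & ~ LB x%:C.
Proof.
move=> Cz; have [x zx] := unit_circle_point Cz.1; exists x => //.
by apply/basin_complementP; rewrite -zx.
Qed.

Lemma basin_complement_closed : closed C.
Proof.
move=> z clz.
have zU : unit_circle z.
  apply/unit_circleP; apply: contrapT => /eqP; rewrite -subr_eq0 -normr_gt0 => h.
  have : nbhs z [set w | nrm (w - z) < `|nrm z - 1|].
    by apply/nbhs_nrmP; exists `|nrm z - 1|.
  move=> /clz[w [[/unit_circleP w1 _] /=]].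
  by rewrite ltNge => /negP; apply; rewrite -w1 nrmB nrm_dist.
have [x zx] := unit_circle_point zU; rewrite zx; apply/basin_complementP => Bx.
have : nbhs z basin_image.
  apply: open_nbhs_nbhs; split; first exact: basin_image_open.
  by rewrite zx; apply/basin_imageP.
move=> /clz[w [/basin_complement_point[y -> nB]]].
by move/basin_imageP.
Qed.

Lemma basin_complement_forward : forward_invariant g C.
Proof.
move=> _ [_ /basin_complement_point[x -> nB] <-].
rewrite /g -[dsm a b _]/(iter 1 (dsm a b) _) iter_dsm_circle; apply/basin_complementP.
by rewrite -iter_clift_real => /(lifted_basin_iter attr 1 x%:C).2.
Qed.

Lemma dsm_continuous_circle x : {for circle_point x, continuous g}.
Proof.
have z0 : circle_point x != 0 by exact: cexp_neq0.
set z := circle_point x in z0 *.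
suff [l Dl] : exists l, cderiv g z l by exact: cderiv_continuous Dl.
have Db c : cderiv (fun w : R[i] => c * w) z c by exact: cderiv_lin.
have DV := @cderivV R id z 1 z0 (cderiv_id z).
eexists; apply: cderivM.
  apply: cderivM; first exact: cderiv_cst.
  apply: (cderiv_ext (f := fun w => w * w)); first by move=> w; rewrite expr2.
  by apply: cderivM; exact: cderiv_id.
apply: cderiv_comp (@cexp_cderiv R _).
apply: cderivB; first exact: Db.
exact: cderivZ DV.
Qed.

Lemma basin_complement_chaotic : devaney_chaotic_on C g.
Proof.
split.
- apply: continuous_in_subspaceT => z; rewrite inE => /basin_complement_point[x -> _].
  exact: dsm_continuous_circle.
- exact: basin_complement_forward.
- move=> U V oU oV [z [Cz Uz]] [z' [Cz' Vz']].
  have [x zx nBx] := basin_complement_point Cz.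
  have [y zy nBy] := basin_complement_point Cz'.
  have [d d0 Hd] : exists2 d : R, 0 < d & forall t, `|t - x| < d -> U (circle_point t).
    by apply: circle_point_near; rewrite -zx; exact: open_nbhs_nbhs.
  have xd : x - d / 2 < x < x + d / 2 by apply/andP; split; lra.
  have [n [u [k [/andP[u1 u2] nBu uE]]]] := not_basin_transitive attr nBx xd nBy.
  exists n, z'; split=> //; exists (circle_point u).
    split; first exact/basin_complementP.
    by apply: Hd; rewrite ltr_norml; apply/andP; split; lra.
  by rewrite iter_dsm_circle uE circle_point_period -zy.
- move=> _ /basin_complement_point[x -> nBx] A /circle_point_near[d d0 Hd].
  have xd : x - d / 2 < x < x + d / 2 by apply/andP; split; lra.
  have [n [u [k [n0 /andP[u1 u2] nBu uE]]]] := not_basin_periodic attr nBx xd.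
  exists (circle_point u); split.
    split; first exact/basin_complementP.
    by exists n => //; rewrite iter_dsm_circle uE circle_point_period.
  by apply: Hd; rewrite ltr_norml; apply/andP; split; lra.
Qed.

Lemma basin_complement_nonempty : C !=set0.
Proof.
have [x nB] := exists_not_basin attr.
by exists (circle_point x); apply/basin_complementP.
Qed.

Lemma gamma_closed : closed gamma.
Proof.
have /accessible_finite_set_closed : accessible_space (R[i] : topologicalType).
  by apply: hausdorff_accessible; exact: norm_hausdorff.
apply.
have : finite_set [set circle_point (iter i (rlift a b) e) | i in `I_p].
  exact/finite_image/finite_II.
apply: sub_finite_set => _ [x /(lifted_cycle_lt attr)[i [k [ip ->]]] <-].
by exists i => //; rewrite circle_point_period.
Qed.

Lemma gamma_iter n z : gamma z -> gamma (iter n g z).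
Proof.
move=> [_ [i [k ->]] <-]; rewrite iter_dsm_circle iter_rlift_period -iterD.
by eexists; first by exists (n + i)%N, (k *+ 2 ^ n).
Qed.

Lemma gamma_transitive z z' : gamma z -> gamma z' -> exists n, iter n g z = z'.
Proof.
move=> [x Cx <-] [y Cy <-]; have [n [k xy]] := cycle_shift attr Cx Cy.
exists n; rewrite iter_dsm_circle -xy /shift_iter -perN.
by rewrite circle_point_period.
Qed.

Lemma periodic_in_basin x : periodic_point g (circle_point x) -> LB x%:C ->
  gamma (circle_point x).
Proof.
move=> [n n0]; rewrite iter_dsm_circle => /circle_point_eq[k nk] Bx.
by exists x => //; exact: (basin_periodic attr n0 Bx nk).
Qed.

(** Points of Y in the basin are limits of periodic points of Y in the basin,
    which lie on the closed set gamma. So Y contains gamma, and an orbit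
    starting in the basin part of Y never leaves gamma: by transitivity there is
    nothing else in Y. *)
Lemma chaotic_meeting_basin (Y : set R[i]) z : Y `<=` @unit_circle R ->
  devaney_chaotic_on Y g -> Y z -> basin_image z -> Y = gamma.
Proof.
move=> YU [_ fwd trans dens] Yz Bz.
have YB (y : R[i]) : Y y -> basin_image y -> gamma y.
  move=> Yy By; apply: gamma_closed => A Ay.
  have : nbhs y (A `&` basin_image).
    apply: filterI => //; apply: open_nbhs_nbhs; split=> //.
    exact: basin_image_open.
  move=> /(dens _ Yy)[w [[Yw pw] [Aw Bw]]]; exists w; split=> //.
  have [x wx] := unit_circle_point (YU _ Yw); rewrite wx in pw Bw *.
  by apply: periodic_in_basin => //; apply/basin_imageP.
have gz := YB _ Yz Bz.
have Yiter n (y : R[i]) : Y y -> Y (iter n g y).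
  by move=> Yy; elim: n => //= n IH; apply: fwd; exists (iter n g y).
have gY : gamma `<=` Y.
  by move=> y /(gamma_transitive gz)[n <-]; exact: Yiter.
apply/seteqP; split=> // q Yq; apply: contrapT => nq.
have oV : open (~` gamma) by apply: closed_openC; exact: gamma_closed.
have [||n [_ [[c [Yc Bc] <-] [_ nc]]]] := trans _ _ basin_image_open oV.
- by exists z.
- by exists q.
- by apply: nc; apply: gamma_iter; exact: YB.
Qed.

Lemma gamma_disjoint z : gamma z -> ~ C z.
Proof.
by move=> [x Cx <-] /basin_complementP; apply; exact: (lifted_basin_cycle attr Cx).
Qed.

Lemma chaotic_dichotomy (Y : set R[i]) : Y `<=` @unit_circle R ->
  devaney_chaotic_on Y g -> Y = gamma \/ Y `<=` C.
Proof.
move=> YU Ych; have [[z [Yz Bz]]|H] := pselect (Y `&` basin_image !=set0).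
  by left; exact: chaotic_meeting_basin Yz Bz.
right=> y Yy; have [x yx] := unit_circle_point (YU _ Yy).
rewrite yx; apply/basin_complementP => Bx; apply: H; exists y; split=> //.
by rewrite yx; apply/basin_imageP.
Qed.

Lemma basin_complement_maximal : maximal_chaotic_set a b C.
Proof.
split.
- by move=> z [].
- exact: basin_complement_closed.
- exact: basin_complement_forward.
- exact: basin_complement_chaotic.
move=> [Y [YU [CY nYC] _ Ych]].
have [Yg|//] := chaotic_dichotomy YU Ych.
have [z Cz] := basin_complement_nonempty.
by apply: (gamma_disjoint (z := z)) => //; rewrite -Yg; exact: CY.
Qed.

Lemma maximal_chaotic_unique (X : set R[i]) : maximal_chaotic_set a b X ->
  X <> gamma -> X = C.
Proof.
move=> [XU _ _ Xch Xmax] Xg; have [//|XC] := chaotic_dichotomy XU Xch.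
apply/seteqP; split=> //; apply: contrapT => nCX; apply: Xmax; exists C; split.
- by move=> z [].
- by split.
- exact: basin_complement_forward.
- exact: basin_complement_chaotic.
Qed.

End Basin.
End Circle.

Theorem proposition4p10 (R : realType) (a b : R) (hb : 0 <= b <= 1)
    (gamma : set R[i]) (hgamma : attracting_cycle a b gamma)
    (hcircle : gamma `<=` @unit_circle R) :
  [/\ devaney_chaotic_on (basin_complement a b gamma) (dsm a b),
      maximal_chaotic_set a b (basin_complement a b gamma) &
      forall X : set R[i], maximal_chaotic_set a b X -> X <> gamma ->
        X = basin_complement a b gamma].
Proof.
have [e [kappa [delta [p [m [attr gE]]]]]] := attracting_cycle_lift hb hgamma hcircle.
rewrite gE; split.
- exact: basin_complement_chaotic attr.
- exact: basin_complement_maximal attr.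
- by move=> X; apply: (maximal_chaotic_unique attr).
Qed.
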